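(* Let $P\in\mathbb{C}[x,y]$ have no zeros in $\mathbb{H}^2$, satisfy $P(0,0)=0$, and have no common factors with $\bar P$. Let $[P]$, $L_1,\dots,L_M$, $q_1,\dots,q_M$ be as in the context, and $O_{jk}$ as in the context. Then for $\mathfrak{p}\in[1,\infty)$, $$\dim\bigl(\mathcal{I}^{\mathfrak{p}}_P/([P],\overline{[P]})\bigr)=\sum_{(j,k):\,j<k}O_{jk}+\sum_{k=1}^{M}\left(\left\lceil\frac{2L_k+1}{\mathfrak{p}}\right\rceil-1\right),$$ and $$\dim\bigl(\mathcal{I}^{\infty}_P/([P],\overline{[P]})\bigr)=\sum_{(j,k):\,j<k}O_{jk}.$$
   Context: $\mathbb{H}=\{z\in\mathbb{C}:\operatorname{Im} z>0\}$, $\mathbb{H}^2=\mathbb{H}\times\mathbb{H}$. For a polynomial or power series $P$, $\bar P(x,y)=\overline{P(\bar x,\bar y)}$. $\mathbb{C}\{x,y\}$ is the ring of convergent power series at $(0,0)$; $(F,G)$ denotes the ideal generated by $F,G$ there. $f\in L^{\mathfrak{p}}_{loc}$ means $f\in L^{\mathfrak{p}}(U)$ (Lebesgue measure) for some neighborhood $U$ of $(0,0)$ in $\mathbb{R}^2$ ($\mathfrak{p}\in[1,\infty]$); $\mathcal{I}^{\mathfrak{p}}_P=\{Q\in\mathbb{C}\{x,y\}:Q/P\in L^{\mathfrak{p}}_{loc}\}$. By a theorem of Bickel–Knese–Pascoe–Sola, for such $P$ vanishing to order $M$ at $(0,0)$ there exist $L_1,\dots,L_M\in\mathbb{N}$ and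 $q_1,\dots,q_M\in\mathbb{R}[x]$ with $q_j(0)=0$, $q_j'(0)>0$, $\deg q_j<2L_j$, such that $[P](x,y)=\prod_{j=1}^M(y+q_j(x)+ix^{2L_j})$ satisfies: $P/[P]$ and $[P]/P$ are bounded on a punctured neighborhood of $(0,0)$ in $\mathbb{R}^2$. $O_{ij}=\min\{\mathrm{Ord}(q_j-q_i),2L_j,2L_i\}$, where Ord is the order of vanishing at $0$. *)

(* Defs.v *)
From HB Require Import structures.
From mathcomp Require Import all_boot all_order all_algebra.
From mathcomp Require Import all_classical all_reals all_analysis.
From mathcomp Require Import complex.
Set Implicit Arguments. Unset Strict Implicit. Unset Printing Implicit Defensive.
Import Order.TTheory GRing.Theory Num.Theory.
Import numFieldNormedType.Exports.
Local Open Scope classical_set_scope.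
Local Open Scope ring_scope.
Local Open Scope complex_scope.

Section Defs.
Variable R : realType.
Local Notation C := R[i].

Definition cconj (z : C) : C := Complex (complex.Re z) (- complex.Im z).
Definition cabs (z : C) : R := Num.sqrt (complex.Re z ^+ 2 + complex.Im z ^+ 2).

(* Polynomials in C[x,y] are encoded as {poly {poly C}}: the OUTER variable
   is y and the INNER variable is x, i.e. P = \sum_j P`_j(x) y^j. *)
(* formal power series in (x,y): coefficient of x^i y^j *)
Definition pser := nat -> nat -> C.

Definition coef2 (P : {poly {poly C}}) : pser := fun i j => (P`_j)`_i.

Definition peval2 (P : {poly {poly C}}) (x y : C) : C :=
  \sum_(j < size P) \sum_(i < size (P`_j)) coef2 P i j * x ^+ i * y ^+ j.

(* \bar P (x,y) = conj (P (conj x, conj y)) : conjugate all coefficients *)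
Definition pconj (P : {poly {poly C}}) : {poly {poly C}} :=
  map_poly (map_poly cconj) P.

Definition pdvd2 (D P : {poly {poly C}}) : Prop := exists Q, P = Q * D.

Definition no_common_factor (P Q : {poly {poly C}}) : Prop :=
  forall D, pdvd2 D P -> pdvd2 D Q -> exists c : C, c != 0 /\ D = c%:P%:P.

Definition no_zeros_H2 (P : {poly {poly C}}) : Prop :=
  forall z w : C, 0 < complex.Im z -> 0 < complex.Im w -> peval2 P z w != 0.

Definition vanish_order (P : {poly {poly C}}) (M : nat) : Prop :=
  (exists i j, (i + j = M)%N /\ coef2 P i j != 0) /\
  (forall i j, (i + j < M)%N -> coef2 P i j = 0).

Definition bracketP (M : nat) (L : 'I_M -> nat) (q : 'I_M -> {poly R})
  : {poly {poly C}} :=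
  \prod_(j < M) ('X + (map_poly (fun r : R => r%:C) (q j)
                        + (Complex 0 1) *: 'X^(2 * L j))%:P).

Definition evalR (P : {poly {poly C}}) (x y : R) : C := peval2 P x%:C y%:C.

Definition bounded_ratio (P B : {poly {poly C}}) : Prop :=
  exists e : R, 0 < e /\ exists K : R, forall x y : R,
    (x, y) != (0, 0) -> x ^+ 2 + y ^+ 2 < e ^+ 2 ->
    [/\ evalR P x y != 0, evalR B x y != 0,
        cabs (evalR P x y / evalR B x y) <= K &
        cabs (evalR B x y / evalR P x y) <= K].

Definition cps (a : pser) : Prop :=
  exists r : R, 0 < r /\ exists K : R, forall n : nat,
    \sum_(i < n) \sum_(j < n) cabs (a i j) * r ^+ (i + j) <= K.

Definition pmul (a b : pser) : pser := fun i j =>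
  \sum_(k < i.+1) \sum_(l < j.+1) a k l * b (i - k)%N (j - l)%N.

Definition ideal2 (F G : pser) : set pser :=
  [set Q | exists A B, [/\ cps A, cps B & Q = fun i j => pmul A F i j + pmul B G i j]].

Definition psum (a : pser) (x y : R) (n : nat) : C :=
  \sum_(i < n) \sum_(j < n) a i j * x%:C ^+ i * y%:C ^+ j.
Definition pval (a : pser) (x y : R) : C :=
  Complex (limn (fun n => complex.Re (psum a x y n)))
          (limn (fun n => complex.Im (psum a x y n))).

Definition leb2 := ((@lebesgue_measure R) \x (@lebesgue_measure R))%E.

Definition Lp_on (U : set (R * R)) (p : R) (f : R * R -> C) : Prop :=
  [/\ measurable U,
      measurable_fun U (fun z => complex.Re (f z)),
      measurable_fun U (fun z => complex.Im (f z)) &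
      (\int[leb2]_(z in U) ((cabs (f z)) `^ p)%:E < +oo)%E].

Definition Linf_on (U : set (R * R)) (f : R * R -> C) : Prop :=
  [/\ measurable U,
      measurable_fun U (fun z => complex.Re (f z)),
      measurable_fun U (fun z => complex.Im (f z)) &
      exists K : R, {ae leb2, forall z, U z -> cabs (f z) <= K}].

Definition Lp_loc (p : R) (f : R * R -> C) : Prop :=
  exists U, nbhs ((0 : R), (0 : R)) U /\ Lp_on U p f.
Definition Linf_loc (f : R * R -> C) : Prop :=
  exists U, nbhs ((0 : R), (0 : R)) U /\ Linf_on U f.

Definition Ip (p : R) (P : {poly {poly C}}) : set pser :=
  [set Q | cps Q /\ Lp_loc p (fun z => pval Q z.1 z.2 / evalR P z.1 z.2)].
Definition Iinf (P : {poly {poly C}}) : set pser :=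
  [set Q | cps Q /\ Linf_loc (fun z => pval Q z.1 z.2 / evalR P z.1 z.2)].

Definition lincomb (n : nat) (c : 'I_n -> C) (v : 'I_n -> pser) : pser :=
  fun i j => \sum_(k < n) c k * v k i j.
Definition quot_dim (V W : set pser) (N : nat) : Prop :=
  [/\ W `<=` V,
      exists v : 'I_N -> pser, (forall k, V (v k)) /\
        (forall c : 'I_N -> C, W (lincomb c v) -> forall k, c k = 0) &
      forall v : 'I_N.+1 -> pser, (forall k, V (v k)) ->
        exists c : 'I_N.+1 -> C, (exists k, c k != 0) /\ W (lincomb c v)].

(* order of vanishing at 0 of a nonzero real polynomial *)
Definition pord (p : {poly R}) : nat := find (fun c => c != 0) p.

(* O_{jk} = min (Ord (q_k - q_j), 2 L_k, 2 L_j), with Ord 0 = +oo *)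
Definition Ojk (M : nat) (L : 'I_M -> nat) (q : 'I_M -> {poly R}) (j k : 'I_M) : nat :=
  if q k == q j then minn (2 * L k) (2 * L j)
  else minn (pord (q k - q j)) (minn (2 * L k) (2 * L j)).

End Defs.

(* Main.v *)
Require Import Defs.
From HB Require Import structures.
From mathcomp Require Import all_boot all_order all_algebra.
From mathcomp Require Import all_classical all_reals all_analysis.
From mathcomp Require Import complex measurable_realfun polyXY.
From mathcomp Require Import ring lra zify.
Set Implicit Arguments. Unset Strict Implicit. Unset Printing Implicit Defensive.
Import Order.TTheory GRing.Theory Num.Theory.
Import numFieldNormedType.Exports.
Local Open Scope classical_set_scope.
Local Open Scope ring_scope.
Local Open Scope complex_scope.

(** By the bounded ratio, P may be replaced by the product B of the branches
    f_j = y + q_j + i x^(2 L_j). Put c_l = ceil((2 L_l + 1)/p) - 1 (0 if p = oo) and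
    a_l(S) = sum_(j in S) O_jl - c_l for a set S of branches, and order the branches
    greedily, so that the first branch k of every final segment S maximizes a_l(S).

    Division by f_k (the substitution y = root of f_k) writes a convergent series
    as Q = c(x) + f_k Q'. If Q / prod_S f_j is in L^p, then c has order at least
    a_k(S): expand Q in the coordinate w = y + q_k on the strip w = t x^(2 L_k),
    0 < t < 1, where |f_j| is at most a constant times x^(O_jk), and let t = -i at the
    end. Conversely x^(a_k(S)) / prod_S f_j is in L^p: at each point the smallest |f_l|
    satisfies |f_j| >= |f_j - conj f_l| / 2 >= const |x|^(O_jl). Hence the series with
    quotient in L^p are, modulo B, the sums of the terms x^(a_k + s) prod_(j before k) f_j.
    Multiplication by conj B is triangular for this basis, with diagonal entries of order
    b_k = sum_j O_jk, so that the dimension is the sum of the b_k - a_k. *)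

(** * Formal power series *)

(** For p < oo, c_l is the largest integer c with c p < 2 L_l + 1: the strip |w| <= |x|^(2 L_l)
    along f_l has width of order |x|^(2 L_l), and x^(-c) is in L^p there exactly under this
    inequality.

    The bound a_k(S) on the order of the remainder is necessary for every k in S, whereas x^a /
    prod_S f_j is shown to be in L^p only if a >= a_l(S) for all l in S. The two bounds meet when k
    maximizes a_l(S); this is the reason for the greedy order.

    The obstacle is that f_k has no real zero off the line x = 0, so the remainder, a value at a
    complex point, cannot be estimated on the domain of integration. Integrability instead controls
    the coefficients of the powers of x in Q at w = t x^(2 L_k). These are polynomials in t; they
    vanish identically, and so t may become complex.

    Branches are compared through conj f_j - f_k rather than f_j - f_k: the former is a polynomial
    in x of order exactly O_jk, the latter may be zero. *)

Record fps (A : Type) := Fps { fcoef : nat -> A }.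

HB.instance Definition _ (A : Type) := gen_eqMixin (fps A).
HB.instance Definition _ (A : Type) := gen_choiceMixin (fps A).

Lemma fpsP (A : Type) (a b : fps A) : (forall n, fcoef a n = fcoef b n) -> a = b.
Proof. by case: a => a; case: b => b /= ab; congr Fps; apply/funext. Qed.

HB.lock Definition fps_mul (A : comNzRingType) (a b : fps A) : fps A :=
  Fps (fun n => \sum_(k < n.+1) fcoef a k * fcoef b (n - k)%N).

Section FpsRing.
Variable A : comNzRingType.
Implicit Types a b : fps A.

Definition fps_zero : fps A := Fps (fun=> 0).
Definition fps_opp a : fps A := Fps (fun n => - fcoef a n).
Definition fps_add a b : fps A := Fps (fun n => fcoef a n + fcoef b n).
Definition fps_const (c : A) : fps A := Fps (fun n => if n == 0%N then c else 0).

Fact fps_addA : associative fps_add.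
Proof. by move=> a b c; apply: fpsP => n /=; rewrite addrA. Qed.
Fact fps_addC : commutative fps_add.
Proof. by move=> a b; apply: fpsP => n /=; rewrite addrC. Qed.
Fact fps_add0 : left_id fps_zero fps_add.
Proof. by move=> a; apply: fpsP => n /=; rewrite add0r. Qed.
Fact fps_addN : left_inverse fps_zero fps_opp fps_add.
Proof. by move=> a; apply: fpsP => n /=; rewrite addNr. Qed.
HB.instance Definition _ :=
  GRing.isZmodule.Build (fps A) fps_addA fps_addC fps_add0 fps_addN.

Definition fps_trunc n a : {poly A} := \poly_(i < n) fcoef a i.

(** A coefficient of a product depends on finitely many coefficients of the factors, so the ring
    laws can be taken over from polynomials by truncating beyond the index in question. *)
Lemma fps_mul_trunc a b n m : (n < m)%N ->
  fcoef (fps_mul a b) n = (fps_trunc m a * fps_trunc m b)`_n.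
Proof.
move=> nm; rewrite coefM fps_mul.unlock /=; apply: eq_bigr => i _; rewrite !coef_poly.
by rewrite (leq_ltn_trans (leq_subr _ _) nm) (leq_ltn_trans _ nm) // -ltnS.
Qed.

Lemma coefM_congr (p p' s : {poly A}) m n : (n < m)%N ->
  (forall i, (i < m)%N -> p`_i = p'`_i) -> (p * s)`_n = (p' * s)`_n.
Proof.
move=> nm pp'; rewrite !coefM; apply: eq_bigr => i _.
by rewrite pp' // (leq_ltn_trans _ nm) // -ltnS.
Qed.

Fact fps_mulC : commutative (@fps_mul A).
Proof.
by move=> a b; apply: fpsP => n; rewrite !(fps_mul_trunc _ _ (ltnSn n)) mulrC.
Qed.
Lemma fps_mulA_left a b c n :
  fcoef (fps_mul (fps_mul a b) c) n
  = (fps_trunc n.+1 a * fps_trunc n.+1 b * fps_trunc n.+1 c)`_n.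
Proof.
rewrite (fps_mul_trunc _ _ (ltnSn n)); apply: (coefM_congr _ (ltnSn n)) => i im.
by rewrite coef_poly im (fps_mul_trunc _ _ im).
Qed.
Fact fps_mulA : associative (@fps_mul A).
Proof.
move=> a b c; apply: fpsP => n; rewrite fps_mulA_left fps_mulC fps_mulA_left.
by congr (nth _ (polyseq _) _); rewrite mulrC mulrA.
Qed.
Fact fps_mul1 : left_id (fps_const 1) (@fps_mul A).
Proof.
move=> a; apply: fpsP => n; rewrite fps_mul.unlock /= big_ord_recl /= subn0 mul1r big1 ?addr0 //.
by move=> i _; rewrite /= mul0r.
Qed.
Fact fps_mulDl : left_distributive (@fps_mul A) fps_add.
Proof.
move=> a b c; apply: fpsP => n; rewrite fps_mul.unlock /= -big_split /=; apply: eq_bigr => i _.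
by rewrite mulrDl.
Qed.
Fact fps_oner_neq0 : fps_const 1 != fps_zero.
Proof.
apply/eqP => /(congr1 (fun a => fcoef a 0)) /= /eqP; by rewrite oner_eq0.
Qed.
HB.instance Definition _ := GRing.Zmodule_isComNzRing.Build (fps A)
  fps_mulA fps_mulC fps_mul1 fps_mulDl fps_oner_neq0.

Lemma fcoefD a b n : fcoef (a + b) n = fcoef a n + fcoef b n. Proof. by []. Qed.
Lemma fcoefB a b n : fcoef (a - b) n = fcoef a n - fcoef b n. Proof. by []. Qed.
Lemma fcoefM a b n :
  fcoef (a * b) n = \sum_(k < n.+1) fcoef a k * fcoef b (n - k)%N.
Proof. by rewrite /GRing.mul /= fps_mul.unlock. Qed.
Lemma fcoef1 n : fcoef (1 : fps A) n = (n == 0%N)%:R.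
Proof. by rewrite /=; case: (n == 0%N). Qed.
Lemma fcoef_sum (I : Type) (r : seq I) (P : pred I) (F : I -> fps A) n :
  fcoef (\sum_(i <- r | P i) F i) n = \sum_(i <- r | P i) fcoef (F i) n.
Proof. by elim/big_rec2: _ => // i x y _ <-. Qed.

Fact fps_const_is_zmod : zmod_morphism fps_const.
Proof.
by move=> x y; apply: fpsP => n; rewrite fcoefB /=; case: (n == 0%N); rewrite ?subr0.
Qed.
Fact fps_const_is_monoid : monoid_morphism fps_const.
Proof.
split=> // x y; apply: fpsP => n; rewrite fcoefM big_ord_recl /= subn0.
rewrite big1 ?addr0 => [|i _]; last by rewrite mul0r.
by case: (n == 0%N); rewrite ?mulr0.
Qed.
HB.instance Definition _ := GRing.isZmodMorphism.Build A (fps A) fps_const fps_const_is_zmod.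
HB.instance Definition _ := GRing.isMonoidMorphism.Build A (fps A) fps_const fps_const_is_monoid.

Lemma fcoef_constM c a n : fcoef (fps_const c * a) n = c * fcoef a n.
Proof.
rewrite fcoefM big_ord_recl /= subn0 big1 ?addr0 // => i _.
by rewrite mul0r.
Qed.

Definition fps_poly (p : {poly A}) : fps A := Fps (fun n => p`_n).
Fact fps_poly_is_zmod : zmod_morphism fps_poly.
Proof. by move=> p s; apply: fpsP => n /=; rewrite coefB. Qed.
Fact fps_poly_is_monoid : monoid_morphism fps_poly.
Proof.
split=> [|p s]; apply: fpsP => n; first by rewrite fcoef1 /= coef1.
by rewrite fcoefM /= coefM.
Qed.
HB.instance Definition _ := GRing.isZmodMorphism.Build _ _ fps_poly fps_poly_is_zmod.
HB.instance Definition _ := GRing.isMonoidMorphism.Build _ _ fps_poly fps_poly_is_monoid.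

Lemma fps_polyC c : fps_poly c%:P = fps_const c.
Proof. by apply: fpsP => n /=; rewrite coefC. Qed.

Definition fps_X : fps A := fps_poly 'X.

Lemma fcoefXM a n : fcoef (fps_X * a) n = if n is m.+1 then fcoef a m else 0.
Proof.
rewrite fcoefM big_ord_recl /= coefX mul0r add0r.
case: n => [|n]; first by rewrite big_ord0.
rewrite big_ord_recl /= coefX mul1r subn1 big1 ?addr0 //.
by move=> i _; rewrite coefX mul0r.
Qed.

Lemma fcoefXnM a k n :
  fcoef (fps_X ^+ k * a) n = if (n < k)%N then 0 else fcoef a (n - k)%N.
Proof.
elim: k n => [|k IH] n; first by rewrite expr0 mul1r subn0.
by rewrite exprS -mulrA fcoefXM; case: n => [|n].
Qed.

Lemma fps_XnK a k : (forall n, (n < k)%N -> fcoef a n = 0) ->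
  a = fps_X ^+ k * Fps (fun n => fcoef a (k + n)%N).
Proof.
move=> a0; apply: fpsP => n; rewrite fcoefXnM; case: ltnP => [/a0 //|kn] /=.
by rewrite subnKC.
Qed.

End FpsRing.

(** * Formal division by y - r(x) *)

Section Division.
Variable A : comNzRingType.
Notation F2 := (fps (fps A)).
Implicit Types (r : {poly A}) (Q : F2).

(** With the outer variable written y, this is y - r(x). If r(0) = 0, division by it is Weierstrass
    division in degree one; the remainder is the series in x obtained by putting y = r(x). *)
Definition root_poly (r : {poly A}) : F2 := fps_X _ - fps_const (fps_poly r).

Lemma fcoef_root_polyM r (G : F2) u :
  fcoef (root_poly r * G) u
  = (if u is v.+1 then fcoef G v else 0) - fps_poly r * fcoef G u.
Proof. by rewrite mulrBl fcoefB fcoefXM fcoef_constM. Qed.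

(* c = (y - r) G reads G_u = r G_(u+1) for every u, so G_u = r^n G_(u+n) is
   divisible by every power of x. *)
Lemma root_poly_unique (r : {poly A}) (G : F2) (c : fps A) :
  r`_0 = 0 -> fps_const c = root_poly r * G -> G = 0 /\ c = 0.
Proof.
move=> r0 cG.
have rec u : fcoef G u = fps_poly r * fcoef G u.+1.
  have := congr1 (fun a => fcoef a u.+1) cG.
  by rewrite fcoef_root_polyM /= => /esym/eqP; rewrite subr_eq0 => /eqP.
have G0 n u : fcoef (fcoef G u) n = 0.
  elim/ltn_ind: n u => n IH u; rewrite rec fcoefM big_ord_recl /= r0 mul0r add0r.
  apply: big1 => i _; rewrite IH ?mulr0 //.
  by case: n i {IH} => [|n] [i ii] //=; rewrite /bump /= add1n subSS ltnS leq_subr.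
have GE : G = 0 by apply: fpsP => u; apply: fpsP => n; rewrite G0.
split=> //; have := congr1 (fun a => fcoef a 0%N) cG.
by rewrite GE mulr0 /=.
Qed.

Lemma root_poly_lreg (r : {poly A}) : r`_0 = 0 -> GRing.lreg (root_poly r).
Proof.
move=> r0 G H /eqP; rewrite -subr_eq0 -mulrBr => /eqP e; apply/eqP; rewrite -subr_eq0.
by apply/eqP; have [] := @root_poly_unique r (G - H) 0 r0; rewrite ?raddf0.
Qed.

Lemma fcoef_polyM0 r (a : fps A) n : r`_0 = 0 ->
  fcoef (fps_poly r * a) n = \sum_(i < n) r`_i.+1 * fcoef a (n - i.+1)%N.
Proof. by move=> r0; rewrite fcoefM big_ord_recl /= r0 mul0r add0r. Qed.

(** Its fixed point is D_u = sum_n r^n Q_(u+n). The remainder of Q is D_0 and the quotient has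
    coefficients D_(u+1). As r has no constant term, each iteration makes one more coefficient in x
    final, so coefficient n can be read off after n + 1 iterations. *)
Definition divstep (r : {poly A}) (Q D : F2) : F2 :=
  Fps (fun u => fcoef Q u + fps_poly r * fcoef D u.+1).

Lemma fcoef_divstep r Q D u :
  fcoef (divstep r Q D) u = fcoef Q u + fps_poly r * fcoef D u.+1.
Proof. by []. Qed.

Lemma divstep_stable r Q k m u n : r`_0 = 0 -> (n < k)%N -> (n < m)%N ->
  fcoef (fcoef (iter k (divstep r Q) 0) u) n = fcoef (fcoef (iter m (divstep r Q) 0) u) n.
Proof.
move=> r0; elim: k m u n => [//|k IH] [//|m] u n nk nm.
rewrite !iterS !fcoef_divstep !fcoefD !fcoef_polyM0 //; congr (_ + _).
by apply: eq_bigr => i _; congr (_ * _); apply: IH; have := ltn_ord i; lia.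
Qed.

Definition divlim r Q : F2 :=
  Fps (fun u => Fps (fun n => fcoef (fcoef (iter n.+1 (divstep r Q) 0) u) n)).

Lemma fcoef_divlim r Q u n : r`_0 = 0 ->
  fcoef (fcoef (divlim r Q) u) n
  = fcoef (fcoef Q u) n + \sum_(i < n) r`_i.+1 * fcoef (fcoef (divlim r Q) u.+1) (n - i.+1)%N.
Proof.
move=> r0.
have -> : fcoef (fcoef (divlim r Q) u) n = fcoef (fcoef (iter n.+1 (divstep r Q) 0) u) n by [].
rewrite iterS fcoef_divstep fcoefD fcoef_polyM0 //; congr (_ + _).
apply: eq_bigr => i _; congr (_ * _).
by apply: (@divstep_stable r Q n (n - i.+1).+1) => //; have := ltn_ord i; lia.
Qed.

Lemma divlimE r Q u : r`_0 = 0 ->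
  fcoef (divlim r Q) u = fcoef Q u + fps_poly r * fcoef (divlim r Q) u.+1.
Proof. by move=> r0; apply: fpsP => n; rewrite fcoef_divlim // fcoefD fcoef_polyM0. Qed.

Definition root_quo r Q : F2 := Fps (fun u => fcoef (divlim r Q) u.+1).
Definition root_rem r Q : fps A := fcoef (divlim r Q) 0.

Lemma root_polyE r Q : r`_0 = 0 ->
  Q = root_poly r * root_quo r Q + fps_const (root_rem r Q).
Proof.
move=> r0; apply: fpsP => u; rewrite fcoefD fcoef_root_polyM.
have e : fcoef Q u = fcoef (divlim r Q) u - fps_poly r * fcoef (root_quo r Q) u.
  by rewrite (divlimE Q u r0) addrK.
rewrite e; case: u {e} => [|u]; first by rewrite sub0r addrC.
by rewrite [fcoef (fps_const _) _]/= addr0.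
Qed.

End Division.

(** * Convergent power series *)

Import ComplexField.Normc.

Section Cabs.
Variable R : realType.
Implicit Types z w : R[i].

Lemma cabsE z : cabs z = normc z. Proof. by case: z. Qed.
Lemma cabs_ge0 z : 0 <= cabs z. Proof. exact: sqrtr_ge0. Qed.
Lemma cabsD z w : cabs (z + w) <= cabs z + cabs w.
Proof. by rewrite !cabsE; exact: le_normcD. Qed.
Lemma cabsM z w : cabs (z * w) = cabs z * cabs w.
Proof. by rewrite !cabsE normcM. Qed.
Lemma cabsN z : cabs (- z) = cabs z.
Proof. by rewrite !cabsE normcN. Qed.
Lemma cabsV z : cabs z^-1 = (cabs z)^-1.
Proof. by rewrite !cabsE normcV. Qed.
Lemma cabs0 : cabs (0 : R[i]) = 0.
Proof. by rewrite cabsE normc0. Qed.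
Lemma cabs1 : cabs (1 : R[i]) = 1.
Proof. by rewrite cabsE normc1. Qed.
Lemma cabs_eq0 z : (cabs z == 0) = (z == 0).
Proof.
apply/eqP/eqP => [|->]; last exact: cabs0.
by rewrite cabsE => /eq0_normc.
Qed.
Lemma cabs_gt0 z : (0 < cabs z) = (z != 0).
Proof. by rewrite lt0r cabs_ge0 andbT cabs_eq0. Qed.
Lemma cabsX z n : cabs (z ^+ n) = cabs z ^+ n.
Proof. by elim: n => [|n IH]; rewrite ?expr0 ?cabs1 // !exprS cabsM IH. Qed.
Lemma cabsR (x : R) : cabs x%:C = `|x|.
Proof. by rewrite /cabs /= expr0n addr0 sqrtr_sqr. Qed.
Lemma Re_le_cabs z : `|complex.Re z| <= cabs z.
Proof.
by rewrite /cabs -sqrtr_sqr ler_wsqrtr // lerDl sqr_ge0.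
Qed.
Lemma Im_le_cabs z : `|complex.Im z| <= cabs z.
Proof.
by rewrite /cabs -sqrtr_sqr ler_wsqrtr // lerDr sqr_ge0.
Qed.
Lemma cabs_le z : cabs z <= `|complex.Re z| + `|complex.Im z|.
Proof.
rewrite /cabs -(ger0_norm (addr_ge0 (normr_ge0 _) (normr_ge0 _))) -sqrtr_sqr.
apply: ler_wsqrtr; rewrite sqrrD !real_normK ?num_real //.
rewrite addrAC lerDl mulrn_wge0 // mulr_ge0 //.
Qed.
Lemma cabs_sum (I : Type) (r : seq I) (P : pred I) (F : I -> R[i]) :
  cabs (\sum_(i <- r | P i) F i) <= \sum_(i <- r | P i) cabs (F i).
Proof.
elim/big_rec2: _ => [|i x y _ h]; first by rewrite cabs0.
by rewrite (le_trans (cabsD _ _)) // lerD2l.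
Qed.
Lemma cabs_prod (I : Type) (r : seq I) (P : pred I) (F : I -> R[i]) :
  cabs (\prod_(i <- r | P i) F i) = \prod_(i <- r | P i) cabs (F i).
Proof. by elim/big_rec2: _ => [|i x y _ <-]; rewrite ?cabs1 ?cabsM. Qed.
Lemma cabs_lerB z w : cabs z - cabs w <= cabs (z + w).
Proof.
rewrite lerBlDr -[X in cabs X](addrK w) (le_trans (cabsD _ _)) // cabsN //.
Qed.
End Cabs.

(** * Square partial sums of real double families *)

Section RealDouble.
Variable R : realType.
Implicit Types (w b : nat -> nat -> R).

Definition sqsum w n : R := \sum_(i < n) \sum_(j < n) w i j.

Lemma sqsum_rect w n m k : (forall i j, 0 <= w i j) -> (n <= k)%N -> (m <= k)%N ->
  \sum_(i < n) \sum_(j < m) w i j <= sqsum w k.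
Proof.
move=> w0 nk mk; rewrite /sqsum.
have S0 (i l : nat) : 0 <= \sum_(j < l) w i j by apply: sumr_ge0.
have le1 (F : nat -> R) a c : (forall i, 0 <= F i) -> (a <= c)%N ->
    \sum_(i < a) F i <= \sum_(i < c) F i.
  move=> F0 ac; rewrite (big_ord_widen _ _ ac) [leRHS](bigID (fun i : 'I_c => (i < a)%N)) /=.
  by rewrite lerDl sumr_ge0.
apply: (@le_trans _ _ (\sum_(i < n) \sum_(j < k) w i j)).
  by apply: ler_sum => i _; apply: (le1 (w i)).
exact: (le1 (fun i => \sum_(j < k) w i j)).
Qed.

Lemma sqsum_nd w : (forall i j, 0 <= w i j) -> nondecreasing_seq (sqsum w).
Proof. by move=> w0 n m nm; apply: sqsum_rect. Qed.

Lemma sqsumD w b n : sqsum (fun i j => w i j + b i j) n = sqsum w n + sqsum b n.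
Proof. by rewrite /sqsum -big_split; apply: eq_bigr => i _; rewrite -big_split. Qed.

Lemma sqsumZ c b n : sqsum (fun i j => c * b i j) n = c * sqsum b n.
Proof. by rewrite /sqsum mulr_sumr; apply: eq_bigr => i _; rewrite mulr_sumr. Qed.

Lemma sqsum_le w b n : (forall i j, w i j <= b i j) -> sqsum w n <= sqsum b n.
Proof. by move=> h; apply: ler_sum => i _; apply: ler_sum. Qed.

Lemma sqsum_norm w n : `|sqsum w n| <= sqsum (fun i j => `|w i j|) n.
Proof.
by rewrite (le_trans (ler_norm_sum _ _ _))//; apply: ler_sum => i _; apply: ler_norm_sum.
Qed.

(** The family is the difference of the nonnegative families |w| + w and |w|, whose square sums are
    monotone and bounded. *)
Lemma abs_sqsum_cvg w K : (forall n, sqsum (fun i j => `|w i j|) n <= K) ->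
  cvgn (sqsum w).
Proof.
move=> wK.
have c1 : cvgn (sqsum (fun i j => `|w i j|)).
  apply: nondecreasing_is_cvgn; first by apply: sqsum_nd.
  by exists K => _ [n _ <-].
have c2 : cvgn (sqsum (fun i j => `|w i j| + w i j)).
  apply: nondecreasing_is_cvgn.
    by apply: sqsum_nd => i j; have := ler_norm (- w i j); rewrite normrN; lra.
  exists (2 * K) => _ [n _ <-]; rewrite sqsumD.
  have := sqsum_norm w n; have := wK n; have := ler_norm (sqsum w n); lra.
have -> : sqsum w = (fun n => sqsum (fun i j => `|w i j| + w i j) n - sqsum (fun i j => `|w i j|) n).
  by apply/funext => n; rewrite sqsumD addrAC subrr add0r.
exact: is_cvgB.
Qed.

Lemma abs_sqsum_lim_le w K : (forall n, sqsum (fun i j => `|w i j|) n <= K) ->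
  `|limn (sqsum w)| <= K.
Proof.
move=> wK; have cw := abs_sqsum_cvg wK.
have h n : `|sqsum w n| <= K by rewrite (le_trans (sqsum_norm _ _)).
rewrite ler_norml; apply/andP; split.
  by apply: limr_ge => //; near=> n; have := h n; rewrite ler_norml => /andP[].
by apply: limr_le => //; near=> n; have := h n; rewrite ler_norml => /andP[].
Unshelve. all: by end_near.
Qed.

(** The shifted sum over the square of side n + 1 differs from the sum of [w] over the square of
    side n by the terms w i n with i < n. These are bounded by the increment of the square sums of
    |w|, which tends to 0. *)
Lemma sqsum_shift w K : (forall n, sqsum (fun i j => `|w i j|) n <= K) ->
  sqsum (fun i j => if i is k.+1 then w k j else 0) n @[n --> \oo] --> limn (sqsum w).
Proof.
move=> wK; pose a n := sqsum (fun i j => `|w i j|) n.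
have ca : cvgn a.
  apply: nondecreasing_is_cvgn; first by apply: sqsum_nd.
  by exists K => _ [n _ <-].
have cw := abs_sqsum_cvg wK.
rewrite -(cvg_shiftS) /=.
have da : (a n.+1 - a n) @[n --> \oo] --> 0.
  rewrite -(subrr (limn a)); apply: cvgB => //.
  by rewrite (cvg_shiftS a).
suff e0 : (sqsum (fun i j => if i is k.+1 then w k j else 0) n.+1 - sqsum w n) @[n --> \oo] --> 0.
  have -> : (fun n => sqsum (fun i j => if i is k.+1 then w k j else 0) n.+1)
     = (fun n => sqsum (fun i j => if i is k.+1 then w k j else 0) n.+1 - sqsum w n + sqsum w n).
    by apply/funext => n; rewrite subrK.
  by rewrite -[limn _]add0r; apply: cvgD.
apply: (@squeeze_cvgr _ _ _ _ (fun n => - (a n.+1 - a n)) (fun n => a n.+1 - a n)).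
- near=> n; rewrite -ler_norml /sqsum big_ord_recl /= big1 ?add0r //.
  have e (v : nat -> nat -> R) : \sum_(i < n) \sum_(j < n.+1) v i j
       = sqsum v n + \sum_(i < n) v i n.
    by rewrite -big_split; apply: eq_bigr => i _; rewrite big_ord_recr.
  rewrite [X in `|X - _|](e (fun i j => w i j)) addrAC subrr add0r.
  rewrite (le_trans (ler_norm_sum _ _ _)) // lerBrDl.
  rewrite -[X in X <= _](e (fun i j => `|w i j|)).
  by rewrite /a; apply: sqsum_rect.
- by rewrite -oppr0; apply: cvgN.
- exact: da.
Unshelve. all: by end_near.
Qed.

Lemma sqsum_tr w : sqsum (fun i j => w j i) = sqsum w.
Proof. by apply/funext => n; rewrite /sqsum exchange_big. Qed.

End RealDouble.

(* fps (fps C) has y as its outer variable, whereas pser has x as its first index. *)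
Definition ser (R : realType) (a : pser R) : fps (fps R[i]) :=
  Fps (fun j => Fps (fun i => a i j)).
Definition unser (R : realType) (G : fps (fps R[i])) : pser R :=
  fun i j => fcoef (fcoef G j) i.

HB.lock Definition pv (R : realType) (G : fps (fps R[i])) (x y : R) : R[i] :=
  pval (unser G) x y.

(** * Weighted norms and values of convergent series *)

Section ComplexSeries.
Variable R : realType.
Local Notation C := R[i].
Local Notation F2 := (fps (fps C)).
Implicit Types (G H : F2) (P Q : {poly {poly C}}).

Lemma unserK G : ser (unser G) = G.
Proof. by apply: fpsP => j; apply: fpsP. Qed.

Lemma pmulE (a b : pser R) : pmul a b = unser (ser a * ser b).
Proof.
apply/funext => i; apply/funext => j.
rewrite /unser fcoefM fcoef_sum /pmul exchange_big.
by apply: eq_bigr => l _; rewrite fcoefM.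
Qed.

Definition cvs G : Prop := cps (unser G).
Definition gabs G i j : R := cabs (unser G i j).
(** A bound on the weighted l1 norm with both radii equal to r. The radius is kept explicit because
    identities between values need one radius common to all the series involved. *)
Definition cvr (r K : R) G : Prop :=
  forall n, sqsum (fun i j => gabs G i j * r ^+ (i + j)) n <= K.

Lemma cvsP G : cvs G <-> exists r : R, 0 < r /\ exists K, cvr r K G.
Proof. by []. Qed.

Lemma cvr_le r s K G : 0 <= s -> s <= r -> cvr r K G -> cvr s K G.
Proof.
move=> s0 sr h n; apply: le_trans (h n); apply: sqsum_le => i j.
by apply: ler_wpM2l; rewrite ?cabs_ge0 ?lerXn2r ?nnegrE ?(le_trans s0 sr).
Qed.

Lemma cvrD r K K' G H : 0 <= r -> cvr r K G -> cvr r K' H -> cvr r (K + K') (G + H).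
Proof.
move=> r0 h h' n; apply: le_trans (lerD (h n) (h' n)); rewrite -sqsumD.
by apply: sqsum_le => i j; rewrite -mulrDl ler_wpM2r ?exprn_ge0 ?cabsD.
Qed.

Lemma cvrZ r K c G : cvr r K G -> cvr r (cabs c * K) (fps_const (fps_const c) * G).
Proof.
move=> h n; apply: le_trans (ler_wpM2l (cabs_ge0 c) (h n)); rewrite -sqsumZ.
apply: sqsum_le => i j; rewrite /gabs /unser !fcoef_constM cabsM mulrA //.
Qed.

Lemma sqsum_shift_le (w : nat -> nat -> R) K n : (forall i j, 0 <= w i j) ->
  (forall n, sqsum w n <= K) ->
  sqsum (fun i j => if i is k.+1 then w k j else 0) n <= K.
Proof.
move=> w0 wK; case: n => [|n].
  by have := wK 0%N; rewrite /sqsum !big_ord0.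
rewrite /sqsum big_ord_recl /= big1 ?add0r //.
by apply: le_trans (sqsum_rect w0 (leqnSn n) (leqnn _)) _.
Qed.

Lemma sqsum_shift2_le (w : nat -> nat -> R) K n : (forall i j, 0 <= w i j) ->
  (forall n, sqsum w n <= K) ->
  sqsum (fun i j => if j is k.+1 then w i k else 0) n <= K.
Proof.
move=> w0 wK.
rewrite -(sqsum_tr (fun i j => if j is k.+1 then w i k else 0)).
by apply: (@sqsum_shift_le (fun i j => w j i)) => // m; rewrite sqsum_tr.
Qed.

Lemma unser_xM G i j :
  unser (fps_const (fps_X _) * G) i j = if i is k.+1 then unser G k j else 0.
Proof. by rewrite /unser fcoef_constM fcoefXM. Qed.

Lemma unser_yM G i j :
  unser (fps_X _ * G) i j = if j is k.+1 then unser G i k else 0.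
Proof. by rewrite /unser fcoefXM; case: j. Qed.

Lemma cvr_xM r K G : 0 <= r -> cvr r K G -> cvr r (r * K) (fps_const (fps_X _) * G).
Proof.
move=> r0 h n.
have -> : (fun i j => gabs (fps_const (fps_X C) * G) i j * r ^+ (i + j)) =
  (fun i j => r * (if i is k.+1 then gabs G k j * r ^+ (k + j) else 0)).
  apply/funext => i; apply/funext => j; rewrite /gabs unser_xM.
  case: i => [|i]; first by rewrite cabs0 mul0r mulr0.
  by rewrite addSn exprS mulrCA.
rewrite sqsumZ ler_wpM2l //.
by apply: sqsum_shift_le => // i j; rewrite mulr_ge0 ?exprn_ge0 ?cabs_ge0.
Qed.

Lemma cvr_yM r K G : 0 <= r -> cvr r K G -> cvr r (r * K) (fps_X _ * G).
Proof.
move=> r0 h n.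
have -> : (fun i j => gabs (fps_X (fps C) * G) i j * r ^+ (i + j)) =
  (fun i j => r * (if j is k.+1 then gabs G i k * r ^+ (i + k) else 0)).
  apply/funext => i; apply/funext => j; rewrite /gabs unser_yM.
  case: j => [|j]; first by rewrite cabs0 mul0r mulr0.
  by rewrite addnS exprS mulrCA.
rewrite sqsumZ ler_wpM2l //.
by apply: sqsum_shift2_le => // i j; rewrite mulr_ge0 ?exprn_ge0 ?cabs_ge0.
Qed.

(** [T] stands for the real or the imaginary part, so that the two real limits defining the value of
    a series are treated at once. *)
Lemma cvr_bound r K G (T : C -> R) x y : (forall z, `|T z| <= cabs z) ->
  `|x| <= r -> `|y| <= r -> cvr r K G ->
  forall n, sqsum (fun i j => `|T (unser G i j) * x ^+ i * y ^+ j|) n <= K.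
Proof.
move=> TC xr yr h n; apply: le_trans (h n); apply: sqsum_le => i j.
have r0 : 0 <= r by apply: le_trans xr.
rewrite -mulrA normrM exprD ler_pM // normrM !normrX.
by rewrite ler_pM ?exprn_ge0 ?lerXn2r ?nnegrE.
Qed.


Lemma Re_psum (a : pser R) x y n :
  complex.Re (psum a x y n) = sqsum (fun i j => complex.Re (a i j) * x ^+ i * y ^+ j) n.
Proof.
rewrite /psum /sqsum (raddf_sum (@complex.Re R : Rcomplex R -> R)); apply: eq_bigr => i _.
rewrite (raddf_sum (@complex.Re R : Rcomplex R -> R)); apply: eq_bigr => j _.
by rewrite -!rmorphXn /=; case: (a i j) => u v /=; ring.
Qed.

Lemma Im_psum (a : pser R) x y n :
  complex.Im (psum a x y n) = sqsum (fun i j => complex.Im (a i j) * x ^+ i * y ^+ j) n.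
Proof.
rewrite /psum /sqsum (raddf_sum (@complex.Im R : Rcomplex R -> R)); apply: eq_bigr => i _.
rewrite (raddf_sum (@complex.Im R : Rcomplex R -> R)); apply: eq_bigr => j _.
by rewrite -!rmorphXn /=; case: (a i j) => u v /=; ring.
Qed.

Definition rsum (T : C -> R) G x y : nat -> R :=
  sqsum (fun i j => T (unser G i j) * x ^+ i * y ^+ j).

Lemma pvE G x y : pv G x y = Complex (limn (rsum (@complex.Re R) G x y))
                                     (limn (rsum (@complex.Im R) G x y)).
Proof.
rewrite pv.unlock /pval; congr Complex; congr (limn _); apply/funext => n.
  by rewrite Re_psum.
by rewrite Im_psum.
Qed.

Section Radius.
Variables (r : R) (x y : R).
Hypotheses (xr : `|x| <= r) (yr : `|y| <= r).

Let r0 : 0 <= r. Proof. exact: le_trans xr. Qed.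

Lemma rsum_cvg K G (T : C -> R) : (forall z, `|T z| <= cabs z) -> cvr r K G ->
  cvgn (rsum T G x y).
Proof. by move=> TC h; apply: abs_sqsum_cvg (cvr_bound TC xr yr h). Qed.

Let ReC := @Re_le_cabs R.
Let ImC := @Im_le_cabs R.

Lemma pv_le K G : cvr r K G -> cabs (pv G x y) <= 2 * K.
Proof.
move=> h; rewrite pvE (le_trans (cabs_le _)) //=.
have := abs_sqsum_lim_le (cvr_bound ReC xr yr h).
have := abs_sqsum_lim_le (cvr_bound ImC xr yr h).
rewrite /rsum; lra.
Qed.

Lemma pvD K K' G H : cvr r K G -> cvr r K' H -> pv (G + H) x y = pv G x y + pv H x y.
Proof.
move=> h h'; rewrite !pvE.
have e (T : C -> R) : (forall u v, T (u + v) = T u + T v) ->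
  rsum T (G + H) x y = rsum T G x y \+ rsum T H x y.
  move=> TD; apply/funext => n; rewrite /= /rsum -sqsumD; congr (sqsum _ n).
  by apply/funext => i; apply/funext => j; rewrite -!mulrDl -TD.
rewrite !e; [|by case=> ? ? []..].
by rewrite !limD //; apply: rsum_cvg; eauto.
Qed.

Lemma pvZ K c G : cvr r K G -> pv (fps_const (fps_const c) * G) x y = c * pv G x y.
Proof.
move=> h; rewrite !pvE; case: c => a b.
have -> : rsum (@complex.Re R) (fps_const (fps_const (a +i* b)) * G) x y =
  (fun n => a * rsum (@complex.Re R) G x y n - b * rsum (@complex.Im R) G x y n).
  apply/funext => n; rewrite /rsum -mulNr -!sqsumZ -sqsumD; congr (sqsum _ n).
  apply/funext => i; apply/funext => j; rewrite /unser !fcoef_constM.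
  by case: (fcoef _ i) => u v /=; ring.
have -> : rsum (@complex.Im R) (fps_const (fps_const (a +i* b)) * G) x y =
  (fun n => a * rsum (@complex.Im R) G x y n + b * rsum (@complex.Re R) G x y n).
  apply/funext => n; rewrite /rsum -!sqsumZ -sqsumD; congr (sqsum _ n).
  apply/funext => i; apply/funext => j; rewrite /unser !fcoef_constM.
  by case: (fcoef _ i) => u v /=; ring.
have cR := rsum_cvg ReC h; have cI := rsum_cvg ImC h.
rewrite (cvg_lim (@Rhausdorff R) (cvgB (cvgM (cvg_cst a) cR) (cvgM (cvg_cst b) cI))).
by rewrite (cvg_lim (@Rhausdorff R) (cvgD (cvgM (cvg_cst a) cI) (cvgM (cvg_cst b) cR))).
Qed.

Lemma pv_xM K G : cvr r K G -> pv (fps_const (fps_X _) * G) x y = x%:C * pv G x y.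
Proof.
move=> h; rewrite !pvE.
have e (T : C -> R) : T 0 = 0 -> (forall z, `|T z| <= cabs z) ->
    limn (rsum T (fps_const (fps_X _) * G) x y) = x * limn (rsum T G x y).
  move=> T0 TC; apply/cvg_lim => //.
  have -> : rsum T (fps_const (fps_X _) * G) x y = (fun n => x *
      sqsum (fun i j => if i is k.+1 then T (unser G k j) * x ^+ k * y ^+ j else 0) n).
    apply/funext => n; rewrite /rsum -sqsumZ; congr (sqsum _ n).
    apply/funext => i; apply/funext => j; rewrite unser_xM; case: i => [|i].
      by rewrite T0 !mul0r mulr0.
    by rewrite exprS; ring.
  apply: cvgMr; apply: (@sqsum_shift _ (fun i j => T (unser G i j) * x ^+ i * y ^+ j) K).
  exact: cvr_bound TC xr yr h.
by rewrite !e //; apply/eqP; rewrite eq_complex /=; apply/andP; split; apply/eqP; ring.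
Qed.

Lemma pv_yM K G : cvr r K G -> pv (fps_X _ * G) x y = y%:C * pv G x y.
Proof.
move=> h; rewrite !pvE.
have e (T : C -> R) : T 0 = 0 -> (forall z, `|T z| <= cabs z) ->
    limn (rsum T (fps_X _ * G) x y) = y * limn (rsum T G x y).
  move=> T0 TC; apply/cvg_lim => //.
  have -> : rsum T (fps_X _ * G) x y = (fun n => y *
      sqsum (fun j i => if j is k.+1 then T (unser G i k) * x ^+ i * y ^+ k else 0) n).
    apply/funext => n; rewrite /rsum -sqsumZ -[sqsum _ in RHS]sqsum_tr; congr (sqsum _ n).
    apply/funext => i; apply/funext => j; rewrite unser_yM; case: j => [|j].
      by rewrite T0 !mul0r mulr0.
    by rewrite exprS; ring.
  apply: cvgMr; rewrite /rsum -(sqsum_tr (fun i j => T (unser G i j) * x ^+ i * y ^+ j)).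
  apply: (@sqsum_shift _ (fun j i => T (unser G i j) * x ^+ i * y ^+ j) K) => n.
  rewrite (sqsum_tr (fun i j => `|T (unser G i j) * x ^+ i * y ^+ j|)).
  exact: cvr_bound TC xr yr h n.
by rewrite !e //; apply/eqP; rewrite eq_complex /=; apply/andP; split; apply/eqP; ring.
Qed.

End Radius.
End ComplexSeries.

HB.lock Definition ps2 (R : realType) (P : {poly {poly R[i]}}) : fps (fps R[i]) :=
  fps_poly (map_poly (@fps_poly R[i]) P).

(** * Multiplication by polynomials: convergence and values *)

Section PolyAction.
Variable R : realType.
Local Notation C := R[i].
Local Notation F2 := (fps (fps C)).
Implicit Types (G H : F2) (P Q : {poly {poly C}}) (c : fps C).

Lemma peval2E P (x y : C) : peval2 P x y = P.[y%:P].[x].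
Proof.
rewrite /peval2 [P.[_]]horner_coef horner_sum; apply: eq_bigr => j _.
rewrite -rmorphXn hornerM hornerC [in RHS]horner_coef mulr_suml.
by apply: eq_bigr.
Qed.

Lemma evalRD P Q x y : evalR (P + Q) x y = evalR P x y + evalR Q x y.
Proof. by rewrite /evalR !peval2E !hornerE. Qed.
Lemma evalRM P Q x y : evalR (P * Q) x y = evalR P x y * evalR Q x y.
Proof. by rewrite /evalR !peval2E !hornerE. Qed.
Lemma evalRC (p : {poly C}) x y : evalR p%:P x y = p.[x%:C].
Proof. by rewrite /evalR peval2E !hornerE. Qed.
Lemma evalRX (x y : R) : evalR 'X x y = y%:C.
Proof. by rewrite /evalR peval2E !hornerE. Qed.
Lemma evalR1 (x y : R) : evalR 1 x y = 1.
Proof. by rewrite -polyC1 evalRC hornerE. Qed.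
Lemma evalRXn P n x y : evalR (P ^+ n) x y = evalR P x y ^+ n.
Proof. by elim: n => [|n IH]; rewrite ?expr0 ?evalR1 // !exprS evalRM IH. Qed.
Lemma evalR_prod (I : Type) (s : seq I) (B : pred I) (F : I -> {poly {poly C}}) x y :
  evalR (\prod_(i <- s | B i) F i) x y = \prod_(i <- s | B i) evalR (F i) x y.
Proof. by elim/big_rec2: _ => [|i u v _ <-]; rewrite ?evalR1 ?evalRM. Qed.

Fact ps2_is_zmod : zmod_morphism (@ps2 R).
Proof. by move=> P Q; rewrite ps2.unlock /= rmorphB /= rmorphB. Qed.
Fact ps2_is_monoid : monoid_morphism (@ps2 R).
Proof. by split=> [|P Q]; rewrite ps2.unlock /= ?rmorph1 // rmorphM /= rmorphM. Qed.
HB.instance Definition _ := GRing.isZmodMorphism.Build _ _ (@ps2 R) ps2_is_zmod.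
HB.instance Definition _ := GRing.isMonoidMorphism.Build _ _ (@ps2 R) ps2_is_monoid.

Lemma ps2C (p : {poly C}) : ps2 p%:P = fps_const (fps_poly p).
Proof. by rewrite ps2.unlock /= map_polyC fps_polyC. Qed.
Lemma ps2X : ps2 'X = fps_X _ :> F2.
Proof. by rewrite ps2.unlock /= map_polyX. Qed.
Lemma ps2D P Q : ps2 (P + Q) = ps2 P + ps2 Q. Proof. exact: rmorphD. Qed.
Lemma ps2B P Q : ps2 (P - Q) = ps2 P - ps2 Q. Proof. exact: rmorphB. Qed.
Lemma ps2N P : ps2 (- P) = - ps2 P. Proof. exact: rmorphN. Qed.
Lemma ps2M P Q : ps2 (P * Q) = ps2 P * ps2 Q. Proof. exact: rmorphM. Qed.
Lemma ps2_1 : ps2 1 = 1 :> F2. Proof. exact: (rmorph1 (@ps2 R)). Qed.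
Lemma ps2_0 : ps2 0 = 0 :> F2. Proof. exact: (rmorph0 (@ps2 R)). Qed.
Lemma unser_ps2 P : unser (ps2 P) = coef2 P.
Proof. by apply/funext => i; apply/funext => j; rewrite ps2.unlock /unser /= coef_map. Qed.

(** Only products with a polynomial factor are ever evaluated. This property passes to sums and
    products of polynomials, so it need only be checked for constants, x and y, where multiplication
    scales or shifts the coefficients. No theorem on Cauchy products of double series is
    involved. *)
Definition acts P := forall r K G, 0 <= r -> cvr r K G ->
  (exists K', cvr r K' (ps2 P * G)) /\
  (forall x y, `|x| <= r -> `|y| <= r -> pv (ps2 P * G) x y = evalR P x y * pv G x y).

Lemma actsD P Q : acts P -> acts Q -> acts (P + Q).
Proof.
move=> hP hQ r K G r0 h.
have [[K1 h1] e1] := hP r K G r0 h; have [[K2 h2] e2] := hQ r K G r0 h.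
rewrite ps2D mulrDl; split=> [|x y xr yr]; first by exists (K1 + K2); apply: cvrD.
by rewrite (pvD xr yr h1 h2) (e1 _ _ xr yr) (e2 _ _ xr yr) evalRD [RHS]mulrDl.
Qed.

Lemma actsM P Q : acts P -> acts Q -> acts (P * Q).
Proof.
move=> hP hQ r K G r0 h.
have [[K2 h2] e2] := hQ r K G r0 h; have [[K1 h1] e1] := hP r K2 _ r0 h2.
rewrite ps2M -mulrA; split=> [|x y xr yr]; first by exists K1.
by rewrite (e1 _ _ xr yr) (e2 _ _ xr yr) evalRM [LHS]mulrA.
Qed.

Lemma acts_all P : acts P.
Proof.
have aC (c : C) : acts c%:P%:P.
  move=> r K G r0 h; rewrite ps2C fps_polyC; split=> [|x y xr yr].
    by exists (cabs c * K); apply: cvrZ.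
  by rewrite (pvZ xr yr c h) evalRC hornerC.
have aX : acts 'X.
  move=> r K G r0 h; rewrite ps2X; split=> [|x y xr yr].
    by exists (r * K); apply: cvr_yM.
  by rewrite (pv_yM xr yr h) evalRX.
have aXC : acts 'X%:P.
  move=> r K G r0 h; rewrite ps2C; split=> [|x y xr yr].
    by exists (r * K); apply: cvr_xM.
  by rewrite (pv_xM xr yr h) evalRC hornerX.
elim/poly_ind: P => [|P p IH]; first by rewrite -polyC0 -polyC0; apply: aC.
apply: actsD; first exact: actsM.
elim/poly_ind: p => [|p c IHp]; first exact: aC.
by rewrite polyCD polyCM; apply: actsD; [exact: actsM|].
Qed.

Lemma ps2M_cvr r K P G : 0 <= r -> cvr r K G -> exists K', cvr r K' (ps2 P * G).
Proof. by move=> r0 h; have [] := acts_all P r0 h. Qed.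

Lemma pvM r K P G x y : cvr r K G -> `|x| <= r -> `|y| <= r ->
  pv (ps2 P * G) x y = evalR P x y * pv G x y.
Proof.
by move=> h xr yr; have [_] := acts_all P (le_trans (normr_ge0 x) xr) h; apply.
Qed.

Lemma cvs_ps2M P G : cvs G -> cvs (ps2 P * G).
Proof.
move=> /cvsP[r [r0 [K h]]]; apply/cvsP; exists r; split=> //.
exact: ps2M_cvr (ltW r0) h.
Qed.

Lemma cvs_common G H : cvs G -> cvs H ->
  exists r : R, 0 < r /\ exists K, cvr r K G /\ cvr r K H.
Proof.
move=> /cvsP[r [r0 [K h]]] /cvsP[r' [r0' [K' h']]].
have m0 : 0 < Num.min r r' by rewrite lt_min r0.
exists (Num.min r r'); split=> //; exists (Num.max K K'); split=> n.
  by apply: le_trans (_ : K <= _); rewrite ?le_max ?lexx //; apply: cvr_le h n; rewrite ?ge_min ?lexx // ltW.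
by apply: le_trans (_ : K' <= _); rewrite ?le_max ?lexx ?orbT //; apply: cvr_le h' n; rewrite ?ge_min ?lexx ?orbT // ltW.
Qed.

Lemma cvsD G H : cvs G -> cvs H -> cvs (G + H).
Proof.
move=> cG cH; have [r [r0 [K [h h']]]] := cvs_common cG cH.
by apply/cvsP; exists r; split=> //; exists (K + K); apply: cvrD => //; apply: ltW.
Qed.

Lemma cvsN G : cvs G -> cvs (- G).
Proof. by move=> h; rewrite -mulN1r -ps2_1 -ps2N; apply: cvs_ps2M. Qed.

Lemma cvsB G H : cvs G -> cvs H -> cvs (G - H).
Proof. by move=> h h'; apply: cvsD => //; apply: cvsN. Qed.

Lemma cvr1 r : 0 <= r -> cvr r 1 (1 : F2).
Proof.
move=> r0 n; have -> : (fun i j => gabs (1 : F2) i j * r ^+ (i + j)) =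
   (fun i j => ((i == 0%N) && (j == 0%N))%:R).
  apply/funext => i; apply/funext => j; rewrite /gabs /unser /=.
  by case: i j => [|i] [|j] /=; rewrite ?cabs0 ?cabs1 ?mul0r ?mul1r.
case: n => [|n]; first by rewrite /sqsum big_ord0.
rewrite /sqsum big_ord_recl big_ord_recl /= !big1 ?addr0 //.
Qed.

Lemma pv1 x y : pv (1 : F2) x y = 1.
Proof.
rewrite pvE; apply/eqP; rewrite eq_complex /=; apply/andP.
have e (T : C -> R) : T 0 = 0 -> limn (rsum T 1 x y) = T 1.
  move=> T0; apply/cvg_lim => //; rewrite -cvg_shiftS /=.
  have -> : (fun n => rsum T 1 x y n.+1) = (fun=> T 1); last exact: cvg_cst.
  apply/funext => n; rewrite /rsum /sqsum big_ord_recl big_ord_recl /=.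
  rewrite [unser _ _ _]/unser /= !mulr1 !big1 ?addr0 // => i _.
    by apply: big1 => j _; rewrite /unser /=; case: j => -[|j] jn /=; rewrite T0 !mul0r.
  by rewrite /unser /= T0 !mul0r.
by rewrite !e.
Qed.

Lemma cvs1 : cvs (1 : F2).
Proof. by apply/cvsP; exists 1; split=> //; exists 1; apply: cvr1. Qed.

Lemma cvs_ps2 P : cvs (ps2 P).
Proof. by rewrite -[ps2 P]mulr1; apply: cvs_ps2M; exact: cvs1. Qed.

Lemma cvs0 : cvs (0 : F2).
Proof. by rewrite -ps2_0; exact: cvs_ps2. Qed.

Lemma cvs_sum (I : Type) (s : seq I) (B : pred I) (F : I -> F2) :
  (forall i, B i -> cvs (F i)) -> cvs (\sum_(i <- s | B i) F i).
Proof.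
by move=> h; elim/big_ind: _ => //; [exact: cvs0|exact: cvsD].
Qed.

Lemma pv_ps2 P x y : pv (ps2 P) x y = evalR P x y.
Proof.
pose r := Num.max `|x| `|y|.
have xr : `|x| <= r by rewrite le_max lexx.
have yr : `|y| <= r by rewrite le_max lexx orbT.
by rewrite -[ps2 P]mulr1 (pvM P (cvr1 (le_trans (normr_ge0 x) xr)) xr yr) pv1 mulr1.
Qed.

Lemma cvs_constP c : cvs (fps_const c) <->
  exists r : R, 0 < r /\ exists K, forall n, \sum_(i < n) cabs (fcoef c i) * r ^+ i <= K.
Proof.
have e r n : sqsum (fun i j => gabs (fps_const c) i j * r ^+ (i + j)) n
    = \sum_(i < n) cabs (fcoef c i) * r ^+ i.
  case: n => [|n]; first by rewrite /sqsum !big_ord0.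
  rewrite /sqsum; apply: eq_bigr => i _; rewrite big_ord_recl addn0 big1 ?addr0 // => j _.
  by rewrite /gabs /unser /= cabs0 mul0r.
split=> -[r [r0 [K h]]]; exists r; split=> //; exists K => n.
  by rewrite -e; apply: h.
by move: (h n); rewrite -e.
Qed.

Lemma cvs_const_tail c a : cvs (fps_const c) ->
  cvs (fps_const (Fps (fun n => fcoef c (a + n)))).
Proof.
move=> /cvs_constP[r [r0 [K h]]]; apply/cvs_constP; exists r; split=> //.
exists (K / r ^+ a) => n; rewrite ler_pdivlMr ?exprn_gt0 //.
apply: le_trans (h (a + n)%N); rewrite big_split_ord /= mulr_suml.
rewrite -[leLHS]add0r lerD //.
  by apply: sumr_ge0 => i _; rewrite mulr_ge0 ?cabs_ge0 ?exprn_ge0 ?ltW.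
by apply: ler_sum => i _; rewrite -mulrA -exprD addnC.
Qed.

End PolyAction.

(** * Convergence of quotients and remainders *)

Section DivisionConvergence.
Variable R : realType.
Local Notation C := R[i].
Local Notation F2 := (fps (fps C)).

Lemma sum_cauchy_le (al be : nat -> R) k : (forall i, 0 <= al i) -> (forall i, 0 <= be i) ->
  \sum_(n < k) \sum_(i < n.+1) al i * be (n - i)%N <= (\sum_(i < k) al i) * (\sum_(i < k) be i).
Proof.
move=> a0 b0.
have -> : \sum_(n < k) \sum_(i < n.+1) al i * be (n - i)%N
        = \sum_(i < k) al i * \sum_(m < k - i) be m.
  elim: k => [|k IH]; first by rewrite !big_ord0.
  rewrite big_ord_recr IH [RHS]big_ord_recr /= subSnn big_ord1.
  rewrite big_ord_recr /= subnn addrA -big_split /=; congr (_ + _).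
  apply: eq_bigr => i _; rewrite -mulrDr; congr (_ * _).
  by rewrite subSn ?(ltnW (ltn_ord i)) // big_ord_recr.
rewrite mulr_suml; apply: ler_sum => i _; rewrite ler_wpM2l //.
rewrite (big_ord_widen _ _ (leq_subr i k)) [leRHS](bigID (fun m : 'I_k => (m < k - i)%N)) /=.
by rewrite lerDl sumr_ge0.
Qed.

(** With weights s^n r^u on x^n y^u and s small, D -> p D_(u+1) shrinks the norm by 1/2, so the
    recursion D_u = Q_u + p D_(u+1) gives norm at most K + (1/2) (2 K) = 2 K. Finiteness of the norm
    is not known beforehand; the bound is therefore proved for truncations in the degree in x, by
    induction, since p has no constant term and raises that degree. *)
Lemma divlim_cvs (p : {poly C}) (Q : F2) : p`_0 = 0 -> cvs Q -> cvs (divlim p Q).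
Proof.
move=> p0 /cvsP[r [r0 [K hQ]]].
have [S S0 SE] : exists2 S : R, 0 <= S & S = \sum_(i < size p) cabs p`_i.
  by eexists; last reflexivity; apply: sumr_ge0 => i _; apply: cabs_ge0.
(* [s <= 1] gives sum_i |p_i| s^i <= s S, and the last entry makes s S <= r / 2. The summand 1 in
   the denominator covers S = 0. *)
pose s := Num.min r (Num.min 1 (r / (2 * (1 + S)))).
have d0 : 0 < 2 * (1 + S) by rewrite mulr_gt0 // ltr_pwDl.
have s0 : 0 < s by rewrite !lt_min r0 ltr01 divr_gt0.
have sr : s <= r by rewrite ge_min lexx.
have s1 : s <= 1 by rewrite !ge_min lexx !orbT.
have sS : s * S <= r / 2.
  apply: (@le_trans _ _ (r / (2 * (1 + S)) * (1 + S))).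
    by apply: ler_pM => //; [exact: ltW|rewrite !ge_min lexx !orbT|rewrite lerDr].
  by rewrite le_eqVlt; apply/orP; left; apply/eqP; field; rewrite gt_eqF // ltr_pwDl.
pose D := gabs (divlim p Q).
pose T k U := \sum_(n < k) \sum_(u < U) D n u * (s ^+ n * r ^+ u).
have D0 n u : 0 <= D n u by apply: cabs_ge0.
have w0 n u : 0 <= s ^+ n * r ^+ u by rewrite mulr_ge0 // exprn_ge0 // ltW.
have K0 : 0 <= K by have := hQ 0%N; rewrite /sqsum big_ord0.
have QK k U : \sum_(n < k) \sum_(u < U) gabs Q n u * (s ^+ n * r ^+ u) <= K.
  apply: le_trans (hQ (maxn k U)).
  apply: le_trans (@sqsum_rect _ (fun i j => gabs Q i j * r ^+ (i + j)) k U _ _ (leq_maxl _ _) (leq_maxr _ _)).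
    apply: ler_sum => n _; apply: ler_sum => u _; rewrite ler_wpM2l ?cabs_ge0 //.
    rewrite exprD ler_wpM2r ?exprn_ge0 ?(ltW r0) //.
    by rewrite lerXn2r ?nnegrE ?(ltW s0) ?(ltW r0).
  by move=> i j; rewrite mulr_ge0 ?cabs_ge0 ?exprn_ge0 ?(ltW s0) ?(ltW r0).
have T2K k U : T k U <= 2 * K.
  elim: k U => [|k IH] U; first by rewrite /T big_ord0 mulr_ge0.
  pose al i := cabs p`_i.+1 * s ^+ i.+1.
  pose be m := s ^+ m * \sum_(u < U) D m u.+1 * r ^+ u.+1.
  have al0 i : 0 <= al i by rewrite mulr_ge0 ?cabs_ge0 ?exprn_ge0 ?(ltW s0) ?(ltW r0).
  have be0 i : 0 <= be i.
    by rewrite mulr_ge0 ?exprn_ge0 ?(ltW s0) ?(ltW r0) //; apply: sumr_ge0 => u _; rewrite mulr_ge0 ?exprn_ge0 ?(ltW s0) ?(ltW r0).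
  (* The factor r^-1 comes from replacing r^u by r^(u+1), the weight that belongs to D_(u+1). *)
  have step : T k.+1 U <= K + r^-1 * \sum_(n < k) \sum_(i < n.+1) al i * be (n - i)%N.
    have -> : \sum_(n < k) \sum_(i < n.+1) al i * be (n - i)%N =
              \sum_(n < k.+1) \sum_(i < n) al i * be (n - i.+1)%N.
      by rewrite [RHS]big_ord_recl big_ord0 add0r; apply: eq_bigr.
    apply: le_trans (lerD (QK k.+1 U) (lexx _)).
    rewrite /T mulr_sumr -big_split /=; apply: ler_sum => n _.
    have -> : r^-1 * (\sum_(i < n) al i * be (n - i.+1)%N) =
       \sum_(u < U) (\sum_(i < n) cabs p`_i.+1 * D (n - i.+1)%N u.+1) * (s ^+ n * r ^+ u).
      rewrite mulr_sumr; under [RHS]eq_bigr do rewrite mulr_suml.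
      rewrite exchange_big; apply: eq_bigr => i _.
      rewrite /al /be !mulr_sumr; apply: eq_bigr => u _.
      have -> : s ^+ n = s ^+ i.+1 * s ^+ (n - i.+1) by rewrite -exprD subnKC.
      rewrite (exprS r); field.
      by rewrite gt_eqF.
    rewrite -big_split /=; apply: ler_sum => u _; rewrite -mulrDl ler_wpM2r //.
    rewrite /D /gabs /unser fcoef_divlim // (le_trans (cabsD _ _)) // lerD2l.
    by rewrite (le_trans (cabs_sum _ _ _)) //; apply: ler_sum => i _; rewrite cabsM.
  have alS : \sum_(i < k) al i <= r / 2.
    apply: le_trans sS; rewrite SE.
    apply: (@le_trans _ _ (\sum_(i < k) s * cabs p`_i.+1)).
      apply: ler_sum => i _; rewrite /al mulrC ler_wpM2r ?cabs_ge0 // exprS.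
      by rewrite -[leRHS]mulr1 ler_wpM2l ?(ltW s0) ?exprn_ile1 ?(ltW s0).
    rewrite -mulr_sumr ler_wpM2l ?(ltW s0) //.
    have -> : \sum_(i < size p) cabs p`_i = \sum_(i < maxn k.+1 (size p)) cabs p`_i.
      rewrite (big_ord_widen _ (fun i => cabs p`_i) (leq_maxr k.+1 (size p))) big_mkcond.
      by apply: eq_bigr => i _; case: ltnP => // h; rewrite nth_default // cabs0.
    apply: (@le_trans _ _ (\sum_(i < k.+1) cabs p`_i)).
      by rewrite big_ord_recl lerDr cabs_ge0.
    rewrite (big_ord_widen _ (fun i => cabs p`_i) (leq_maxl k.+1 (size p))).
    rewrite [leRHS](bigID (fun m : 'I_(maxn k.+1 (size p)) => (m < k.+1)%N)) /=.
    by rewrite lerDl sumr_ge0 // => i _; apply: cabs_ge0.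
  have beT : \sum_(m < k) be m <= 2 * K.
    apply: le_trans (IH U.+1); rewrite /T; apply: ler_sum => n _.
    rewrite big_ord_recl /be mulr_sumr -[leLHS]add0r lerD ?mulr_ge0 //.
      by rewrite exprn_ge0 // ltW.
    by apply: ler_sum => u _; rewrite mulrCA.
  have bnd : (\sum_(i < k) al i) * (\sum_(m < k) be m) <= r / 2 * (2 * K).
    by rewrite ler_pM ?sumr_ge0.
  have := le_trans (sum_cauchy_le k al0 be0) bnd.
  move: step; set X := \sum_(n < k) _; move=> step hX.
  apply: le_trans step _.
  have : r^-1 * X <= K.
    by rewrite mulrC ler_pdivrMr //; apply: le_trans hX _; rewrite le_eqVlt; apply/orP; left; apply/eqP; field.
  lra.
apply/cvsP; exists s; split=> //; exists (2 * K) => n; apply: le_trans (T2K n n).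
apply: ler_sum => i _; apply: ler_sum => u _; rewrite ler_wpM2l ?cabs_ge0 // exprD.
by rewrite ler_wpM2l ?exprn_ge0 ?(ltW s0) // lerXn2r ?nnegrE ?(ltW s0) ?(ltW r0).
Qed.

Lemma cvs_rem (p : {poly C}) (Q : F2) : p`_0 = 0 -> cvs Q -> cvs (fps_const (root_rem p Q)).
Proof.
move=> p0 /(divlim_cvs p0) /cvsP[r [r0 [K h]]]; apply/cvs_constP; exists r; split=> //.
exists K => n; apply: le_trans (h n.+1); have r1 := ltW r0.
apply: le_trans (@sqsum_rect _ _ n 1%N _ _ (leqnSn n) _) => //.
  by apply: ler_sum => i _; rewrite big_ord1 addn0.
by move=> i j; rewrite mulr_ge0 ?cabs_ge0 ?exprn_ge0.
Qed.

Lemma cvs_quo (p : {poly C}) (Q : F2) : p`_0 = 0 -> cvs Q -> cvs (root_quo p Q).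
Proof.
move=> p0 /(divlim_cvs p0) /cvsP[r [r0 [K h]]]; apply/cvsP; exists r; split=> //.
exists (K / r) => n; rewrite ler_pdivlMr //; apply: le_trans (h n.+1); have r1 := ltW r0.
have v0 i j : 0 <= gabs (divlim p Q) i j * r ^+ (i + j).
  by rewrite mulr_ge0 ?cabs_ge0 ?exprn_ge0.
apply: le_trans (sqsum_rect v0 (leqnSn n) (leqnn _)).
rewrite /sqsum mulr_suml; apply: ler_sum => i _; rewrite mulr_suml.
rewrite big_ord_recl -[leLHS]add0r lerD //; apply: ler_sum => j _.
by rewrite -mulrA -exprSr -addnS.
Qed.

(** The series s / (1 - y) takes the value s / (1 - v) at y = v, and 1 - v = u / u_0 for v = 1 - u /
    u_0. Dividing by u thus amounts to taking a remainder modulo y - v, whose convergence is already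
    known. *)
Lemma cvs_div_unit (u : {poly C}) (s : fps C) : u`_0 != 0 -> cvs (fps_const s) ->
  exists2 c, cvs (fps_const c) & s = fps_poly u * c.
Proof.
move=> u0 hs; pose v : {poly C} := 1 - (u`_0)^-1 *: u.
have v0 : v`_0 = 0 by rewrite coefB coef1 coefZ mulVf // subrr.
pose Q : F2 := Fps (fun=> s).
have cQ : cvs Q.
  have /cvs_constP[r [r0 [K h]]] := hs.
  pose t := Num.min r 2^-1.
  have t0 : 0 < t by rewrite lt_min r0 invr_gt0 ltr0n.
  have tr : t <= r by rewrite ge_min lexx.
  have t2 : t <= 2^-1 by rewrite ge_min lexx orbT.
  apply/cvsP; exists t; split=> //; exists (K * 2) => n.
  apply: (@le_trans _ _ ((\sum_(i < n) cabs (fcoef s i) * r ^+ i) * 2)).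
    rewrite /sqsum mulr_suml; apply: ler_sum => i _.
    have -> : \sum_(j < n) gabs Q i j * t ^+ (i + j) = cabs (fcoef s i) * t ^+ i * \sum_(j < n) t ^+ j.
      by rewrite mulr_sumr; apply: eq_bigr => j _; rewrite exprD mulrA.
    rewrite ler_pM ?mulr_ge0 ?cabs_ge0 ?exprn_ge0 ?(ltW t0) ?sumr_ge0 //.
    - by move=> j _; rewrite exprn_ge0 // ltW.
    - by rewrite ler_wpM2l ?cabs_ge0 // lerXn2r ?nnegrE ?(ltW t0) ?(ltW r0).
    - have e m : \sum_(j < m) (2^-1 : R) ^+ j = 2 - 2 * 2^-1 ^+ m.
        elim: m => [|m IH]; first by rewrite big_ord0 expr0 mulr1 subrr.
        by rewrite big_ord_recr /= IH exprS; lra.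
      apply: (@le_trans _ _ (\sum_(j < n) (2^-1 : R) ^+ j)).
        by apply: ler_sum => j _; rewrite lerXn2r ?nnegrE ?(ltW t0) ?invr_ge0.
      by rewrite e gerBl mulr_ge0 ?exprn_ge0 ?invr_ge0.
  by rewrite ler_wpM2r.
have e1 : (1 - fps_X _) * Q = fps_const s.
  apply: fpsP => j; rewrite mulrBl mul1r fcoefB fcoefXM.
  by case: j => [|j]; rewrite /= ?subr0 ?subrr.
have eQ := root_polyE Q v0.
pose c := root_rem v Q; exists (fps_const (u`_0)^-1 * c).
  rewrite rmorphM /= -[fps_const (u`_0)^-1]fps_polyC -ps2C; apply: cvs_ps2M; exact: cvs_rem.
have : fps_const (s - fps_poly (1 - v) * c)
     = root_poly v * ((1 - fps_X _) * root_quo v Q - fps_const c).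
  have -> : fps_const (s - fps_poly (1 - v) * c)
    = fps_const s - (1 - fps_const (fps_poly v)) * fps_const c.
    by rewrite rmorphB rmorphM /= rmorphB rmorph1 rmorphB rmorph1.
  rewrite -e1 [in LHS]eQ -/c /root_poly; ring.
move=> /(root_poly_unique v0)[_ /eqP]; rewrite subr_eq0 => /eqP {1}->.
rewrite /v opprB addrC subrK -mul_polyC rmorphM /= fps_polyC; ring.
Qed.

End DivisionConvergence.

(** * Local integrability near the origin *)

Section Measurability.
Variable R : realType.
Local Notation C := R[i].

(* The line x = 0 is left out: it is negligible and contains the only common
   zero of the branches. *)
Definition pbox (e : R) : set (R * R) :=
  [set z | 0 < `|z.1| /\ `|z.1| < e /\ `|z.2| < e].

Lemma pbox_sub e e' : e <= e' -> pbox e `<=` pbox e'.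
Proof. by move=> ee z [h1 [h2 h3]]; split=> //; split; exact: lt_le_trans ee. Qed.

Lemma measurable_set_ltr d (T : measurableType d) (f g : T -> R) :
  measurable_fun setT f -> measurable_fun setT g -> measurable [set x | f x < g x].
Proof.
move=> mf mg; rewrite -[X in measurable X]setTI.
have -> : [set x | f x < g x] = (fun x => f x < g x) @^-1` [set true].
  by apply/seteqP; split=> x /=.
exact: (measurable_fun_ltr mf mg).
Qed.

Lemma measurable_set_ler d (T : measurableType d) (f g : T -> R) :
  measurable_fun setT f -> measurable_fun setT g -> measurable [set x | f x <= g x].
Proof.
move=> mf mg; rewrite -[X in measurable X]setTI.
have -> : [set x | f x <= g x] = (fun x => f x <= g x) @^-1` [set true].
  by apply/seteqP; split=> x /=.
exact: (measurable_fun_ler mf mg).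
Qed.

Lemma measurable_norm1 : measurable_fun setT (fun z : R * R => `|z.1|).
Proof. exact: measurableT_comp. Qed.
Lemma measurable_norm2 : measurable_fun setT (fun z : R * R => `|z.2|).
Proof. exact: measurableT_comp. Qed.

Lemma measurable_pbox e : measurable (pbox e).
Proof.
have m1 := measurable_norm1; have m2 := measurable_norm2.
have -> : pbox e = [set z | 0 < `|z.1|] `&` ([set z | `|z.1| < e] `&` [set z | `|z.2| < e]) by [].
by apply: measurableI; [|apply: measurableI]; apply: measurable_set_ltr.
Qed.

Lemma measurable_horner1 (q : {poly R}) : measurable_fun setT (fun z : R * R => q.[z.1]).
Proof.
have -> : (fun z : R * R => q.[z.1]) = (fun z => \sum_(i <- enum 'I_(size q)) q`_i * z.1 ^+ i).
  by apply/funext => z; rewrite horner_coef big_enum.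
apply: measurable_sum => i; apply: measurable_funM => //.
by apply: measurable_funX; exact: measurable_fst.
Qed.

Definition cmeas (D : set (R * R)) (f : R * R -> C) :=
  measurable_fun D (fun z => complex.Re (f z)) /\ measurable_fun D (fun z => complex.Im (f z)).

Lemma measurable_inv_ge0 (D : set (R * R)) (f : R * R -> R) : measurable_fun D f ->
  (forall z, 0 <= f z) -> measurable_fun D (fun z => (f z)^-1).
Proof.
move=> mf f0; have -> : (fun z => (f z)^-1) = (fun z => (f z) `^ (-1)).
  by apply/funext => z; rewrite powR_inv1.
exact: (measurableT_comp (measurable_powR _)).
Qed.

Lemma cmeas_sq D f : cmeas D f ->
  measurable_fun D (fun z => complex.Re (f z) ^+ 2 + complex.Im (f z) ^+ 2).
Proof. by move=> [h1 h2]; apply: measurable_funD; apply: measurable_funX. Qed.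

Lemma cmeas_abs D f : cmeas D f -> measurable_fun D (fun z => cabs (f z)).
Proof.
move=> /cmeas_sq h.
have -> : (fun z => cabs (f z)) =
   (fun z => (complex.Re (f z) ^+ 2 + complex.Im (f z) ^+ 2) `^ 2^-1).
  by apply/funext => z; rewrite /cabs powR12_sqrt // addr_ge0 ?sqr_ge0.
exact: (measurableT_comp (measurable_powR _)).
Qed.

Lemma cmeas_div D f g : cmeas D f -> cmeas D g -> cmeas D (fun z => f z / g z).
Proof.
move=> [f1 f2] mg; have [g1 g2] := mg.
have i0 : measurable_fun D (fun z => (complex.Re (g z) ^+ 2 + complex.Im (g z) ^+ 2)^-1).
  by apply: measurable_inv_ge0; [exact: cmeas_sq|move=> z; rewrite addr_ge0 ?sqr_ge0].
split.
  have -> : (fun z => complex.Re (f z / g z)) = (fun z =>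
     (complex.Re (f z) * complex.Re (g z) + complex.Im (f z) * complex.Im (g z)) *
       (complex.Re (g z) ^+ 2 + complex.Im (g z) ^+ 2)^-1).
    by apply/funext => z; case: (f z) (g z) => a b [c d] /=; ring.
  by apply: measurable_funM => //; apply: measurable_funD; apply: measurable_funM.
have -> : (fun z => complex.Im (f z / g z)) = (fun z =>
     (complex.Im (f z) * complex.Re (g z) - complex.Re (f z) * complex.Im (g z)) *
       (complex.Re (g z) ^+ 2 + complex.Im (g z) ^+ 2)^-1).
  by apply/funext => z; case: (f z) (g z) => a b [c d] /=; ring.
by apply: measurable_funM => //; apply: measurable_funB; apply: measurable_funM.
Qed.

Lemma measurable_sqsum (b : nat -> nat -> R) n :
  measurable_fun setT (fun z : R * R => sqsum (fun i j => b i j * z.1 ^+ i * z.2 ^+ j) n).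
Proof.
have -> : (fun z : R * R => sqsum (fun i j => b i j * z.1 ^+ i * z.2 ^+ j) n) =
  (fun z => \sum_(i <- enum 'I_n) \sum_(j <- enum 'I_n) b i j * z.1 ^+ i * z.2 ^+ j).
  by apply/funext => z; rewrite /sqsum big_enum; apply: eq_bigr => i _; rewrite big_enum.
apply: measurable_sum => i; apply: measurable_sum => j.
apply: measurable_funM; last by apply: measurable_funX; exact: measurable_snd.
apply: measurable_funM; first exact: measurable_cst.
by apply: measurable_funX; exact: measurable_fst.
Qed.

Lemma cmeas_pv r K (G : fps (fps C)) (D : set (R * R)) : cvr r K G ->
  (forall z, D z -> `|z.1| <= r /\ `|z.2| <= r) -> cmeas D (fun z => pv G z.1 z.2).
Proof.
move=> h Dr.
have m (T : C -> R) : (forall z, `|T z| <= cabs z) ->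
    measurable_fun D (fun z => limn (rsum T G z.1 z.2)).
  move=> TC; apply: (measurable_fun_cvg (h := fun n z => rsum T G z.1 z.2 n)).
    by move=> n; apply: measurable_funTS; exact: measurable_sqsum.
  by move=> z /Dr[z1 z2]; exact: (rsum_cvg z1 z2 TC h).
split.
  have -> : (fun z => complex.Re (pv G z.1 z.2)) = (fun z => limn (rsum (@complex.Re R) G z.1 z.2)).
    by apply/funext => z; rewrite pvE.
  by apply: m => z; exact: Re_le_cabs.
have -> : (fun z => complex.Im (pv G z.1 z.2)) = (fun z => limn (rsum (@complex.Im R) G z.1 z.2)).
  by apply/funext => z; rewrite pvE.
by apply: m => z; exact: Im_le_cabs.
Qed.

Lemma cmeas_evalR (P : {poly {poly C}}) (e : R) (D : set (R * R)) :
  (forall z, D z -> `|z.1| <= e /\ `|z.2| <= e) -> cmeas D (fun z => evalR P z.1 z.2).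
Proof.
move=> De; have -> : (fun z : R * R => evalR P z.1 z.2) = (fun z => pv (ps2 P) z.1 z.2).
  by apply/funext => z; rewrite pv_ps2.
have e0 : 0 <= `|e| by [].
have [K hK] := @ps2M_cvr R _ _ P _ e0 (cvr1 e0); rewrite mulr1 in hK.
by apply: cmeas_pv hK _ => z /De[h1 h2]; split; [exact: le_trans (ler_norm _)|exact: le_trans (ler_norm _)].
Qed.

End Measurability.

Lemma indic_pred (R : realType) (T : Type) (b : T -> bool) z :
  \1_[set z | b z] z = (b z)%:R :> R.
Proof.
rewrite indicE; case: (boolP (b z)) => h; first by rewrite mem_set.
by rewrite memNset //; exact/negP.
Qed.

(** * Integrals of a majorant of |u|^(-t) *)

Section DyadicMajorant.
Variable R : realType.
Local Notation mu := (@lebesgue_measure R).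
Local Open Scope ereal_scope.

(* Dominates |u|^(-t), with an integral that is read off from lengths of intervals. *)
Definition psi (t u : R) : \bar R :=
  \sum_(0 <= k <oo) (((2 ^+ k.+1) `^ t)%R * (`|u| <= 2^-1 ^+ k)%R%:R)%:E.

Let term_ge0 (t u : R) k : 0 <= (((2 ^+ k.+1) `^ t)%R * (`|u| <= 2^-1 ^+ k)%R%:R)%:E :> \bar R.
Proof. by rewrite lee_fin mulr_ge0 ?powR_ge0. Qed.

Lemma psi_ge0 t u : 0 <= psi t u.
Proof. by apply: nneseries_ge0. Qed.

Lemma dyadic_scale (v : R) : (0 < v)%R -> (v <= 1)%R ->
  exists k : nat, (2^-1 ^+ k.+1 < v)%R /\ (v <= 2^-1 ^+ k)%R.
Proof.
move=> v0 v1.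
have ex : exists k : nat, (2^-1 ^+ k.+1 < v)%R.
  have [n nv] : exists n : nat, (v^-1 < n%:R)%R.
    by exists (Num.trunc v^-1).+1; apply: truncnS_gt.
  exists n; rewrite exprVn invf_plt ?posrE ?exprn_gt0 //.
  apply: lt_le_trans nv _; rewrite -natrX ler_nat.
  by rewrite (leq_trans (ltnW (ltn_expl n (leqnn 2)))) // leq_pexp2l.
case: (ex_minnP ex) => k kv kmin; exists k; split=> //.
case: k kv kmin => [|k] kv kmin; first by rewrite expr0.
by rewrite leNgt; apply/negP => /kmin; rewrite ltnn.
Qed.

Lemma psi_ge t (u v : R) : (0 <= t)%R -> (0 < v)%R -> (v <= 1)%R -> (`|u| <= v)%R ->
  (v `^ (- t))%:E <= psi t u.
Proof.
move=> t0 v0 v1 uv; have [k [k1 k2]] := dyadic_scale v0 v1.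
apply: (@le_trans _ _ (((2 ^+ k.+1) `^ t)%R * (`|u| <= 2^-1 ^+ k)%R%:R)%:E).
  rewrite (le_trans uv k2) mulr1 lee_fin.
  have -> : (v `^ (- t) = v^-1 `^ t)%R by rewrite -(powR_inv1 (ltW v0)) -powRrM mulN1r.
  apply: ge0_ler_powR; rewrite ?nnegrE ?invr_ge0 ?exprn_ge0 ?(ltW v0) //.
  by rewrite invf_ple ?posrE ?exprn_gt0 // -exprVn ltW.
apply: le_trans (nneseries_lim_ge k.+1 _) => [|n _ _] //.
rewrite big_nat_recr //= leeDr //; exact: sume_ge0.
Qed.

Lemma measurable_psi d (T : measurableType d) t (g : T -> R) :
  measurable_fun setT g -> measurable_fun setT (fun z => psi t (g z)).
Proof.
move=> mg; apply: (@ge0_emeasurable_sum _ _ _ _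
  (fun k z => (((2 ^+ k.+1) `^ t)%R * (`|g z| <= 2^-1 ^+ k)%R%:R)%:E) xpredT).
  by move=> k z _ _.
move=> k _; apply/measurable_EFinP; apply: measurable_funM => //.
have -> : (fun z => (`|g z| <= 2^-1 ^+ k)%R%:R) =
   (\1_[set z | (`|g z| <= 2^-1 ^+ k)%R] : T -> R).
  by apply/funext => z; rewrite (@indic_pred _ _ (fun z => (`|g z| <= 2^-1 ^+ k)%R)).
by apply: measurable_indic; apply: measurable_set_ler => //; exact: measurableT_comp.
Qed.

(** Term k integrates to 2^((k+1) t) times the length 2 * 2^-k, that is 2 b s^k with b = 2^t and s =
    b / 2 < 1, whatever the shift c. Uniformity in c serves the inner integral of Tonelli's theorem,
    where the shift is q(x). *)
Lemma integral_psi (t : R) : (0 <= t)%R -> (t < 1)%R ->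
  exists2 K : R, (0 <= K)%R & forall c : R, \int[mu]_y psi t (y + c)%R <= K%:E.
Proof.
move=> t0 t1.
pose b := (2 `^ t)%R; have b0 : (0 < b)%R by rewrite powR_gt0.
pose s := (b / 2)%R; have s0 : (0 <= s)%R by rewrite divr_ge0 // ltW.
have s1 : (s < 1)%R.
  rewrite /s ltr_pdivrMr // mul1r /b -[ltRHS]powRr1 //.
  rewrite /powR; case: eqP => [/eqP|_]; first by rewrite pnatr_eq0.
  by rewrite ltr_expR ltr_pM2r // ln_gt0 // ltr1n.
exists (2 * b / (1 - s))%R; first by rewrite divr_ge0 ?mulr_ge0 ?(ltW b0) // subr_ge0 ltW.
move=> c; rewrite integral_nneseries //; last first.
  move=> k; apply/measurable_EFinP; apply: measurable_funM => //.
  have -> : (fun z => (`|z + c| <= 2^-1 ^+ k)%R%:R) =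
     (\1_[set z | (`|z + c| <= 2^-1 ^+ k)%R] : R -> R).
    by apply/funext => z; rewrite (@indic_pred _ _ (fun z => (`|z + c| <= 2^-1 ^+ k)%R)).
  apply: measurable_indic; apply: measurable_set_ler => //.
  by apply: measurableT_comp => //; apply: measurable_funD.
have e k : \int[mu]_y ((((2 ^+ k.+1) `^ t)%R * (`|y + c| <= 2^-1 ^+ k)%R%:R)%:E)
           = (2 * b * s ^+ k)%:E.
  have -> : (fun y => ((((2 ^+ k.+1) `^ t)%R * (`|y + c| <= 2^-1 ^+ k)%R%:R)%:E)) =
      (fun y => ((2 ^+ k.+1) `^ t)%:E * (\1_`[(- c - 2^-1 ^+ k)%R, (- c + 2^-1 ^+ k)%R] y)%:E).
    apply/funext => y; rewrite -EFinM (@indic_pred _ _ (fun y => y \in _)); congr ((_ * (nat_of_bool _)%:R)%:E).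
    by rewrite in_itv /= -[(y + c)%R]opprK normrN opprD ler_norml; apply/idP/idP => /andP[? ?]; apply/andP; split; lra.
  rewrite ge0_integralZl; first last.
  - by rewrite lee_fin powR_ge0.
  - by move=> y _; rewrite lee_fin.
  - by apply/measurable_EFinP; apply: measurable_indic; exact: measurable_itv.
  - exact: measurableT.
  rewrite integral_indic // setIT /= lebesgue_measure_itv /= lte_fin.
  have p0 : (0 < 2^-1 ^+ k :> R)%R by rewrite exprn_gt0.
  rewrite ifT; last by lra.
  rewrite -EFinB -EFinM; congr EFin.
  have -> : ((2 ^+ k.+1) `^ t = b ^+ k.+1 :> R)%R.
    rewrite /b; elim: k.+1 => [|m IH]; first by rewrite !expr0 powR1.
    by rewrite !exprS powRM ?exprn_ge0 // IH.
  by rewrite /s exprMn exprVn exprS; field; rewrite expf_neq0.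
under eq_eseriesr do rewrite e.
apply: lime_le.
  by apply: is_cvg_nneseries => n _ _; rewrite lee_fin !mulr_ge0 ?exprn_ge0 ?(ltW b0).
near=> n; rewrite /= sumEFin lee_fin -mulr_sumr ler_wpM2l ?mulr_ge0 ?(ltW b0) //.
have -> : (\sum_(0 <= i < n) s ^+ i = (1 - s ^+ n) / (1 - s))%R.
  have ne : (1 - s != 0)%R by rewrite subr_eq0 gt_eqF.
  apply: (mulIf ne); rewrite divfK //.
  elim: (n) => [|m IH]; first by rewrite big_geq // expr0; ring.
  by rewrite big_nat_recr //= mulrDl IH exprS; ring.
by rewrite -[leRHS]mul1r ler_wpM2r ?invr_ge0 ?subr_ge0 ?(ltW s1) // gerBl exprn_ge0.
Unshelve. all: by end_near.
Qed.

Lemma integral_psi2 (t t' : R) (q : {poly R}) :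
  (0 <= t)%R -> (t < 1)%R -> (0 <= t')%R -> (t' < 1)%R ->
  \int[@leb2 R]_z (psi t z.1 * psi t' (z.2 + q.[z.1])%R) < +oo.
Proof.
move=> t0 t1 t0' t1'.
have [K K0 hK] := integral_psi t0 t1; have [K' K0' hK'] := integral_psi t0' t1'.
have m1 : measurable_fun setT (fun z : R * R => psi t z.1).
  by apply: measurable_psi; exact: measurable_fst.
have m2 : measurable_fun setT (fun z : R * R => psi t' (z.2 + q.[z.1])%R).
  apply: measurable_psi; apply: measurable_funD; first exact: measurable_snd.
  exact: measurable_horner1.
rewrite /leb2 fubini_tonelli1 //=; last first.
- by move=> z; rewrite mule_ge0 ?psi_ge0.
- exact: emeasurable_funM.
have mpsi : measurable_fun setT (psi t) by exact: (measurable_psi t (@measurable_id _ R setT)).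
apply: (@le_lt_trans _ _ (\int[mu]_x (K'%:E * psi t x))).
  apply: ge0_le_integral => //.
  - by move=> x _; apply: integral_ge0 => y _; rewrite mule_ge0 ?psi_ge0.
  - apply: (measurable_fun_fubini_tonelli_F (m2 := mu)).
      exact: emeasurable_funM.
    by move=> z; rewrite mule_ge0 ?psi_ge0.
  - exact: emeasurable_funM.
  - move=> x _; rewrite /fubini_F /=.
    rewrite ge0_integralZl ?psi_ge0 //; last 2 first.
    + apply: measurable_psi; apply: measurable_funD => //.
    + by move=> y _; exact: psi_ge0.
    by rewrite muleC lee_wpmul2r ?psi_ge0.
rewrite ge0_integralZl //; last by move=> x _; exact: psi_ge0.
have h : \int[mu]_x psi t x <= K%:E.
  by apply: le_trans (hK 0%R); under [leRHS]eq_integral => y _ do rewrite addr0.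
 apply: (@le_lt_trans _ _ (K'%:E * K%:E)); first by rewrite lee_wpmul2l.
by rewrite -EFinM ltry.
Qed.

End DyadicMajorant.

#[local] Instance leb2_ae_filter (R : realType) : Filter (nbhs (almost_everywhere (@leb2 R))).
Proof. exact: (ae_filter_ringOfSetsType (@lebesgue_measure R \x @lebesgue_measure R)%E). Qed.

(** * Integrability classes on punctured boxes *)

Section LocalClass.
Variable R : realType.
Local Notation mu := (@lebesgue_measure R).
Implicit Types (h g : R * R -> R) (pp : option R).

Definition germ (Phi : R * R -> Prop) := exists e : R, 0 < e /\ forall z, pbox e z -> Phi z.

Lemma germI (A B : R * R -> Prop) : germ A -> germ B -> germ (fun z => A z /\ B z).
Proof.
move=> [e [e0 hA]] [e' [e0' hB]]; exists (Num.min e e'); split; first by rewrite lt_min e0.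
by move=> z hz; split; [apply: hA|apply: hB]; apply: pbox_sub hz; rewrite ge_min lexx ?orbT.
Qed.

Lemma germS (A B : R * R -> Prop) : (forall z, A z -> B z) -> germ A -> germ B.
Proof. by move=> AB [e [e0 h]]; exists e; split=> // z /h/AB. Qed.

Lemma germ_pbox e : 0 < e -> germ (pbox e).
Proof. by move=> e0; exists e. Qed.

Lemma germ_all (I : finType) (A : I -> R * R -> Prop) : (forall i, germ (A i)) ->
  germ (fun z => forall i, A i z).
Proof.
move=> hA.
suff [e [e0 he]] : germ (fun z => forall i, i \in enum I -> A i z).
  by exists e; split=> // z hz i; apply: he; rewrite ?mem_enum.
elim: (enum I) => [|i s IH]; first by exists 1; split.
apply: germS (germI (hA i) IH) => z [h1 h2] j; rewrite inE => /predU1P[->//|]; exact: h2.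
Qed.

Definition gmeas h := exists e : R, 0 < e /\ measurable_fun (pbox e) h.

(* [Some p] stands for the exponent p < oo and [None] for the exponent oo. *)
Definition Lclass pp h : Prop :=
  exists e : R, [/\ 0 < e, measurable_fun (pbox e) h &
    match pp with
    | Some p => (\int[@leb2 R]_(z in pbox e) ((h z) `^ p)%:E < +oo)%E
    | None => exists K : R, {ae @leb2 R, forall z, pbox e z -> h z <= K}
    end].

Lemma measurable_powp e h p : measurable_fun (pbox e) h ->
  measurable_fun (pbox e) (fun z => ((h z) `^ p)%:E).
Proof.
by move=> mh; apply/measurable_EFinP; exact: (measurableT_comp (measurable_powR _)).
Qed.

Lemma Lclass_shrink pp h e0 : Lclass pp h -> 0 < e0 ->
  exists e, [/\ 0 < e, e <= e0, measurable_fun (pbox e) h &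
    match pp with
    | Some p => (\int[@leb2 R]_(z in pbox e) ((h z) `^ p)%:E < +oo)%E
    | None => exists K : R, {ae @leb2 R, forall z, pbox e z -> h z <= K}
    end].
Proof.
move=> [e [e1 mh H]] e0gt; exists (Num.min e e0).
have le : Num.min e e0 <= e by rewrite ge_min lexx.
have mm : measurable_fun (pbox (Num.min e e0)) h.
  exact: measurable_funS (measurable_pbox _) (pbox_sub le) mh.
split=> //; [by rewrite lt_min e1|by rewrite ge_min lexx orbT|].
case: pp H => [p|] H.
  apply: le_lt_trans H; rewrite /leb2; apply: ge0_subset_integral => //.
  - exact: measurable_pbox.
  - exact: measurable_pbox.
  - exact: measurable_powp.
  - by move=> z _; rewrite lee_fin powR_ge0.
  - exact: pbox_sub.
move: H => [K HK]; exists K; move: HK; apply: filterS => z hz /(pbox_sub le); exact: hz.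
Qed.

Lemma Lclass_le pp h g (K : R) : (if pp is Some p then 0 <= p else true) ->
  gmeas h -> Lclass pp g -> 
  germ (fun z => 0 <= h z /\ 0 <= g z /\ h z <= K * g z) -> Lclass pp h.
Proof.
move=> p0 [e1 [e10 mh]] Lg [e2 [e20 hg]].
have m0 : 0 < Num.min e1 e2 by rewrite lt_min e10.
have [e [e0 le mg Hg]] := Lclass_shrink Lg m0; exists e.
have le1 : e <= e1 by apply: le_trans le _; rewrite ge_min lexx.
have le2 : e <= e2 by apply: le_trans le _; rewrite ge_min lexx orbT.
have mhe : measurable_fun (pbox e) h.
  exact: measurable_funS (measurable_pbox _) (pbox_sub le1) mh.
split=> //; case: pp p0 Lg Hg => [p|] p0 _ Hg.
  apply: (@le_lt_trans _ _ ((`|K| `^ p)%:E * \int[@leb2 R]_(z in pbox e) ((g z) `^ p)%:E))%E; last first.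
    rewrite lte_mul_pinfty ?lee_fin ?powR_ge0 //.
  rewrite /leb2 -ge0_integralZl; first last.
  - by rewrite lee_fin powR_ge0.
  - by move=> z _; rewrite lee_fin powR_ge0.
  - exact: measurable_powp.
  - exact: measurable_pbox.
  apply: ge0_le_integral.
  - exact: measurable_pbox.
  - by move=> z _; rewrite lee_fin powR_ge0.
  - exact: measurable_powp.
  - by apply: emeasurable_funM => //; exact: measurable_powp.
  - move=> z /(pbox_sub le2)/hg[h0 [g0 hk]]; rewrite -EFinM lee_fin -powRM //.
    apply: ge0_ler_powR => //; rewrite ?nnegrE ?mulr_ge0 //.
    by apply: le_trans hk _; rewrite ler_wpM2r // ler_norm.
move: Hg => [M HM]; exists (`|K| * `|M|); move: HM.
apply: filterS => z hz bz; have [h0 [g0 hk]] := hg z (pbox_sub le2 bz).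
apply: le_trans hk _; apply: (@le_trans _ _ (`|K| * g z)).
  by rewrite ler_wpM2r // ler_norm.
by rewrite ler_wpM2l //; apply: le_trans (hz bz) (ler_norm _).
Qed.

Lemma Lclass_add pp h g : (if pp is Some p then 0 <= p else true) ->
  (forall z, 0 <= h z) -> (forall z, 0 <= g z) ->
  Lclass pp h -> Lclass pp g -> Lclass pp (fun z => h z + g z).
Proof.
move=> p0 h0 g0 Lh [e1 [e10 mg1 H1]].
have Lg : Lclass pp g by exists e1.
have [e2 [e20 le2 mh2 H2]] := Lclass_shrink Lh e10.
have mg2 : measurable_fun (pbox e2) g.
  exact: measurable_funS (measurable_pbox _) (pbox_sub le2) mg1.
exists e2; split=> //; first exact: measurable_funD.
case: pp p0 Lh H1 Lg H2 => [p|] p0 _ H1 _ H2.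
  have mhp := measurable_powp p mh2; have mgp := measurable_powp p mg2.
  have mE := measurable_pbox e2.
  apply: (@le_lt_trans _ _ ((2 `^ p)%:E * \int[@leb2 R]_(z in pbox e2) (((h z) `^ p)%:E + ((g z) `^ p)%:E)))%E; last first.
    rewrite /leb2 ge0_integralD //; first last.
    - by move=> z _; rewrite lee_fin powR_ge0.
    - by move=> z _; rewrite lee_fin powR_ge0.
    apply: lte_mul_pinfty; [by rewrite lee_fin powR_ge0|by []|].
    apply: lte_add_pinfty; first exact: H2.
    apply: le_lt_trans H1; apply: ge0_subset_integral => //.
    + exact: measurable_pbox.
    + exact: measurable_powp.
    + by move=> z _; rewrite lee_fin powR_ge0.
    + exact: pbox_sub.
  rewrite /leb2 -ge0_integralZl; first last.
  - by rewrite lee_fin powR_ge0.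
  - by move=> z _; rewrite -EFinD lee_fin addr_ge0 ?powR_ge0.
  - exact: emeasurable_funD.
  - exact: mE.
  apply: ge0_le_integral => //.
  - by move=> z _; rewrite lee_fin powR_ge0.
  - by apply: measurable_powp; exact: measurable_funD.
  - by apply: emeasurable_funM => //; exact: emeasurable_funD.
  - move=> z _; rewrite -EFinD -EFinM lee_fin.
    (* The sum is at most twice the larger term; this gives (h + g)^p <= 2^p (h^p + g^p). *)
    have key (a b : R) : 0 <= a -> a <= b -> (b + a) `^ p <= 2 `^ p * b `^ p.
      move=> a0 ab; have b0 := le_trans a0 ab.
      rewrite -powRM //; apply: ge0_ler_powR => //; rewrite ?nnegrE ?addr_ge0 ?mulr_ge0 //; lra.
    rewrite mulrDr; have [hg|gh] := leP (h z) (g z).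
      rewrite addrC; apply: le_trans (key _ _ (h0 z) hg) _; rewrite lerDr mulr_ge0 ?powR_ge0 //.
    by apply: le_trans (key _ _ (g0 z) (ltW gh)) _; rewrite lerDl mulr_ge0 ?powR_ge0.
move: H1 H2 => [K1 H1] [K2 H2]; exists (K2 + K1).
apply: filterS2 H1 H2 => z h1 h2 bz; apply: lerD; first exact: h2.
by apply: h1; apply: pbox_sub bz.
Qed.

Lemma pbox_finite e : (@leb2 R (pbox e) < +oo)%E.
Proof.
rewrite /leb2; apply: (@le_lt_trans _ _ ((mu \x mu) (`](- e)%R, e[ `*` `](- e)%R, e[))%E).
  apply: le_measure; rewrite ?inE.
  - exact: measurable_pbox.
  - by apply: measurableX; exact: measurable_itv.
  - by move=> z [_ [h1 h2]]; split; rewrite /= in_itv /= -ltr_norml.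
rewrite product_measure1E; do ?exact: measurable_itv.
by rewrite /= lebesgue_measure_itv /=; case: ifP => _; rewrite ?mule0 // -EFinB -EFinM ltry.
Qed.

Lemma Lclass_cst pp (K : R) : Lclass pp (fun=> K).
Proof.
exists 1; split=> //; case: pp => [p|].
  have e := integral_cst (mu \x mu)%E (measurable_pbox 1) (K `^ p)%:E.
  apply: (@le_lt_trans _ _ ((K `^ p)%:E * (mu \x mu) (pbox 1)))%E.
    by rewrite -e; exact: lexx.
  apply: lte_mul_pinfty => //.
    by rewrite lee_fin powR_ge0.
  exact: pbox_finite.
by exists K; apply: filterE.
Qed.

Lemma Lclass_sum pp (I : Type) (s : seq I) (F : I -> R * R -> R) :
  (if pp is Some p then 0 <= p else true) -> (forall i z, 0 <= F i z) ->
  (forall i, Lclass pp (F i)) -> Lclass pp (fun z => \sum_(i <- s) F i z).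
Proof.
move=> p0 F0 LF; elim: s => [|i s IH].
  have -> : (fun z => \sum_(i <- [::]) F i z) = (fun=> 0) by apply/funext => z; rewrite big_nil.
  exact: Lclass_cst.
have -> : (fun z => \sum_(i <- i :: s) F i z) = (fun z => F i z + \sum_(i <- s) F i z).
  by apply/funext => z; rewrite big_cons.
by apply: Lclass_add => // z; apply: sumr_ge0.
Qed.

End LocalClass.

(** * Integrability of a power of x divided by one branch *)

Section Branch.
Variable R : realType.
Local Notation mu := (@lebesgue_measure R).
Implicit Types (q : {poly R}) (n m : nat).

(** The value at a real point of a factor of [P], with n = 2 L_j. *)
Definition branch q n (z : R * R) : R[i] := Complex (z.2 + q.[z.1]) (z.1 ^+ n).
Definition bmod q n z : R := cabs (branch q n z).

Lemma bmod_ge_re q n z : `|z.2 + q.[z.1]| <= bmod q n z.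
Proof. exact: (Re_le_cabs (branch q n z)). Qed.
Lemma bmod_ge_im q n z : `|z.1| ^+ n <= bmod q n z.
Proof. by rewrite -normrX; exact: (Im_le_cabs (branch q n z)). Qed.
Lemma bmod_le q n z : bmod q n z <= `|z.2 + q.[z.1]| + `|z.1| ^+ n.
Proof. by rewrite -normrX; exact: (cabs_le (branch q n z)). Qed.
Lemma bmod_gt0 q n e z : pbox e z -> 0 < bmod q n z.
Proof. by move=> [h _]; apply: lt_le_trans (bmod_ge_im q n z); rewrite exprn_gt0. Qed.

Lemma measurable_bmod q n : measurable_fun setT (bmod q n).
Proof.
apply: cmeas_abs; split=> /=.
  by apply: measurable_funD; [exact: measurable_snd|exact: measurable_horner1].
by apply: measurable_funX; exact: measurable_fst.
Qed.

Lemma horner_le0 q : q.[0] = 0 ->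
  exists2 K : R, 0 <= K & forall x, `|x| <= 1 -> `|q.[x]| <= K * `|x|.
Proof.
move=> q0; exists (\sum_(i < size q) `|q`_i|); first exact: sumr_ge0.
move=> x x1; rewrite horner_coef mulr_suml (le_trans (ler_norm_sum _ _ _)) //.
apply: ler_sum => i _; rewrite normrM; case: i => -[|i] ii /=.
  by rewrite -horner_coef0 q0 normr0 !mul0r.
by rewrite ler_wpM2l // normrX exprS -[leRHS]mulr1 ler_wpM2l ?exprn_ile1.
Qed.

Lemma germ_bmod_le1 q n : q.[0] = 0 -> (0 < n)%N -> germ (fun z => bmod q n z <= 1 /\ `|z.1| <= 1).
Proof.
move=> q0 n0; have [K K0 hK] := horner_le0 q0.
have k2 : 0 < K + 2 by lra.
(* On the box of size e the modulus is at most |y| + K |x| + |x|^n < (K + 2) e. *)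
exists (K + 2)^-1; split; first by rewrite invr_gt0.
move=> z [_ [h1 h2]].
have x1 : `|z.1| <= 1.
  by apply: ltW; apply: lt_le_trans h1 _; rewrite invf_le1 //; lra.
split=> //; apply: le_trans (bmod_le q n z) _.
have h3 : `|z.1| ^+ n <= `|z.1|.
  by case: n n0 => // n _; rewrite exprS -[leRHS]mulr1 ler_wpM2l ?exprn_ile1.
have h4 : `|z.2 + q.[z.1]| <= `|z.2| + K * `|z.1|.
  by apply: le_trans (ler_normD _ _) _; rewrite lerD2l hK.
have h5 : K * `|z.1| <= K * (K + 2)^-1 by rewrite ler_wpM2l // ltW.
have h6 : K * (K + 2)^-1 + 2 * (K + 2)^-1 = 1 by field; rewrite gt_eqF.
lra.
Qed.

(** Where |w| <= |x|^n, a strip of width 2 |x|^n, the quotient x^m / f has size |x|^(m - n). The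
    condition says that |x|^((m - n) p + n) is integrable at 0 and, for the exponent oo, that the
    quotient is bounded. *)
Definition integrable_order (pp : option R) n m : Prop :=
  match pp with
  | Some p => n%:R * p - (n%:R + 1) < m%:R * p
  | None => (n <= m)%N
  end.

(** Here a = |x| and b = |f|. Split b^(-p) = b^(-(p-t)) b^(-t): the first factor is bounded by means
    of a^n <= b, the second is kept for the integration in y. *)
Lemma powR_split (a b p t s : R) n m : 0 < a -> a <= 1 -> 0 < b -> a ^+ n <= b ->
  t <= p -> - s <= m%:R * p - n%:R * (p - t) ->
  (a ^+ m / b) `^ p <= a `^ (- s) * b `^ (- t).
Proof.
move=> a0 a1 b0 ab tp sE.
have an0 : 0 < a ^+ n by rewrite exprn_gt0.
rewrite powRM ?exprn_ge0 ?invr_ge0 ?(ltW a0) ?(ltW b0) //.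
have -> : (a ^+ m) `^ p = a `^ (m%:R * p) by rewrite powRrM powR_mulrn ?ltW.
have -> : b^-1 `^ p = b `^ (- (p - t)) * b `^ (- t).
  rewrite -(powR_inv1 (ltW b0)) -powRrM mulN1r -powRD; last by apply/implyP => _; rewrite gt_eqF.
  by congr powR; ring.
rewrite mulrA ler_wpM2r ?powR_ge0 //.
apply: (@le_trans _ _ (a `^ (m%:R * p) * a `^ (- (n%:R * (p - t))))).
  rewrite ler_wpM2l ?powR_ge0 // !powRN powRrM powR_mulrn ?(ltW a0) //.
  rewrite lef_pV2 ?posrE ?powR_gt0 //.
  by apply: ge0_ler_powR; rewrite ?subr_ge0 ?nnegrE ?(ltW an0) ?(ltW b0).
rewrite -powRD; last by apply/implyP => _; rewrite gt_eqF.
by apply: ger_powR => //; rewrite a0.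
Qed.

Lemma Lclass_branch pp q n m : (if pp is Some p then 1 <= p else true) ->
  q.[0] = 0 -> (0 < n)%N -> integrable_order pp n m ->
  Lclass pp (fun z => `|z.1| ^+ m / bmod q n z).
Proof.
move=> p1 q0 n0 good.
have [e [e0 he]] := germ_bmod_le1 q0 n0.
have mh : measurable_fun setT (fun z : R * R => `|z.1| ^+ m / bmod q n z).
  apply: measurable_funM; first by apply: measurable_funX; exact: measurable_norm1.
  by apply: measurable_inv_ge0; [exact: measurable_bmod|move=> z; exact: cabs_ge0].
case: pp p1 good => [p|] p1 good; last first.
  apply: (@Lclass_le _ None _ (fun=> 1) 1) => //.
  - by exists e; split=> //; exact: measurable_funTS.
  - exact: Lclass_cst.
  exists e; split=> // z ze; have [b1 x1] := he z ze; have b0 := bmod_gt0 q n ze.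
  split; first by rewrite divr_ge0 ?exprn_ge0 ?(ltW b0).
  split=> //; rewrite mulr1 ler_pdivrMr // mul1r; apply: le_trans (bmod_ge_im q n z).
  rewrite -(subnK good) exprD -[leRHS]mul1r ler_wpM2r ?exprn_ge0 ?exprn_ile1 //.
exists e; split=> //; first exact: measurable_funTS.
move: good; rewrite /integrable_order => good.
(* [d] is the slack in the integrability condition. Lowering the exponent of |f| from 1 to t = 1 -
   eta costs n eta, and leaves the exponent d - 1 - n eta > -1 for |x|. The maximum with 1/2 in [s]
   keeps it nonnegative. *)
pose d : R := m%:R * p - n%:R * p + n%:R + 1.
have d0 : 0 < d by rewrite /d; lra.
have nn0 : (0 : R) <= n%:R by [].
have [eta [eta0 eta1 eta2]] : exists eta : R, [/\ 0 < eta, eta <= 2^-1 & n%:R * eta < d].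
  exists (Num.min 2^-1 (d / (2 * (n%:R + 1)))).
  have den : 0 < 2 * (n%:R + 1) :> R by lra.
  split; first by rewrite lt_min invr_gt0 ltr0n divr_gt0.
    by rewrite ge_min lexx.
  apply: (@le_lt_trans _ _ (n%:R * (d / (2 * (n%:R + 1))))).
    by rewrite ler_wpM2l // ge_min lexx orbT.
  rewrite mulrA ltr_pdivrMr //; nra.
pose t := 1 - eta; pose s := Num.max (- (d - 1 - n%:R * eta)) 2^-1.
have t0 : 0 <= t by rewrite /t; lra.
have t1 : t < 1 by rewrite /t; lra.
have s0 : 0 <= s by rewrite le_max invr_ge0 ler0n orbT.
have s1 : s < 1 by rewrite gt_max; apply/andP; split; lra.
apply: le_lt_trans (integral_psi2 q s0 s1 t0 t1).
have mpsi : measurable_fun setT (fun z : R * R => (psi s z.1 * psi t (z.2 + q.[z.1])%R)%E).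
  apply: emeasurable_funM; first by apply: measurable_psi; exact: measurable_fst.
  apply: measurable_psi; apply: measurable_funD; first exact: measurable_snd.
  exact: measurable_horner1.
apply: (@le_trans _ _ (\int[@leb2 R]_(z in pbox e) (psi s z.1 * psi t (z.2 + q.[z.1])%R))%E); last first.
  rewrite /leb2; apply: ge0_subset_integral => //; first exact: measurable_pbox.
  by move=> z _; rewrite mule_ge0 ?psi_ge0.
rewrite /leb2; apply: ge0_le_integral => //.
- exact: measurable_pbox.
- by move=> z _; rewrite lee_fin powR_ge0.
- by apply: measurable_powp; exact: measurable_funTS.
- exact: measurable_funTS.
move=> z ze; have [b1 x1] := he z ze; have b0 := bmod_gt0 q n ze.
have x0 : 0 < `|z.1| by case: ze.
apply: (@le_trans _ _ ((`|z.1| `^ (- s))%:E * (bmod q n z `^ (- t))%:E)%E).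
  rewrite -EFinM lee_fin; apply: powR_split => //.
  - exact: bmod_ge_im.
  - by rewrite /t; lra.
  - have : - (d - 1 - n%:R * eta) <= s by rewrite le_max lexx.
    by rewrite /d /t; lra.
apply: lee_pmul; rewrite ?lee_fin ?powR_ge0 //.
  by apply: psi_ge => //; rewrite normr_id.
by apply: psi_ge => //; exact: bmod_ge_re.
Qed.

End Branch.

(** * Divergence on strips along a branch *)

Section Strip.
Variable R : realType.
Local Notation mu := (@lebesgue_measure R).
Variables (q : {poly R}) (n : nat) (t0 t1 : R).
Hypotheses (q0 : q.[0] = 0) (n0 : (0 < n)%N) (t00 : 0 <= t0) (t01 : t0 < t1) (t11 : t1 <= 1).

(** A rectangle in the coordinates x and t = w / x^n. It is half-open in x so that dyadic strips are
    disjoint. *)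
Definition strip (a b : R) : set (R * R) :=
  [set z | (a < z.1 /\ z.1 <= b) /\
           (t0 * z.1 ^+ n <= z.2 + q.[z.1] /\ z.2 + q.[z.1] <= t1 * z.1 ^+ n)].

Lemma measurable_strip a b : measurable (strip a b).
Proof.
have m1 : measurable_fun setT (fun z : R * R => z.1) by exact: measurable_fst.
have m2 : measurable_fun setT (fun z : R * R => z.2 + q.[z.1]).
  by apply: measurable_funD; [exact: measurable_snd|exact: measurable_horner1].
have m3 t : measurable_fun setT (fun z : R * R => t * z.1 ^+ n).
  by apply: measurable_funM => //; apply: measurable_funX.
have -> : strip a b = ([set z : R * R | a < z.1] `&` [set z | z.1 <= b]) `&`
   ([set z | t0 * z.1 ^+ n <= z.2 + q.[z.1]] `&` [set z | z.2 + q.[z.1] <= t1 * z.1 ^+ n]) by [].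
apply: measurableI; apply: measurableI;
  by [apply: measurable_set_ltr|apply: measurable_set_ler].
Qed.

Lemma strip_measure a b : 0 <= a -> a < b ->
  (((t1 - t0) * a ^+ n * (b - a))%:E <= @leb2 R (strip a b))%E.
Proof.
move=> a0 ab; have mS := measurable_strip a b.
have dt : 0 <= t1 - t0 by rewrite subr_ge0 ltW.
rewrite /leb2 /product_measure1 /=.
apply: (@le_trans _ _ (\int[mu]_(x in `]a, b]) cst (((t1 - t0) * a ^+ n)%:E) x)%E).
  have := integral_cst mu (measurable_itv `]a, b]) (((t1 - t0) * a ^+ n)%:E).
  move=> /= ->; rewrite lebesgue_measure_itv /= lte_fin ab -EFinB -EFinM //.
apply: (@le_trans _ _ (\int[mu]_(x in `]a, b]) (mu \o xsection (strip a b)) x)%E); last first.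
  apply: ge0_subset_integral => //.
  exact: measurable_fun_xsection.
apply: ge0_le_integral => //.
- by move=> x _; rewrite lee_fin mulr_ge0 ?exprn_ge0.
- by apply: measurable_funTS; exact: measurable_fun_xsection.
move=> x /=; rewrite in_itv /= => /andP[ax xb].
have x0 : 0 < x by apply: le_lt_trans ax.
have -> : xsection (strip a b) x = `[t0 * x ^+ n - q.[x], t1 * x ^+ n - q.[x]]%classic.
  apply/seteqP; split=> y; rewrite /= in_itv /=.
    move=> /xsectionP [_ /= [h1 h2]]; apply/andP; split; lra.
  move=> /andP[h1 h2]; apply/xsectionP; split=> //=; split; lra.
have lt : t0 * x ^+ n < t1 * x ^+ n by rewrite ltr_pM2r // exprn_gt0.
rewrite lebesgue_measure_itv /= lte_fin ifT; last by lra.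
rewrite -EFinB lee_fin.
have -> : t1 * x ^+ n - q.[x] - (t0 * x ^+ n - q.[x]) = (t1 - t0) * x ^+ n by ring.
by rewrite ler_wpM2l // lerXn2r ?nnegrE // ltW.
Qed.

Lemma strip_pbox e : 0 < e -> exists b0 : R, 0 < b0 /\
  forall a b : R, 0 <= a -> b <= b0 -> strip a b `<=` pbox e.
Proof.
move=> e0; have [K K0 hK] := horner_le0 q0.
have k2 : 0 < K + 2 by lra.
exists (Num.min 1 (e / (K + 2))); split; first by rewrite lt_min ltr01 divr_gt0.
move=> a b a0 bb z [[az zb] [h1 h2]].
have z0 : 0 < z.1 by apply: le_lt_trans az.
have z1 : z.1 <= 1 by apply: le_trans zb (le_trans bb _); rewrite ge_min lexx.
have ze : z.1 <= e / (K + 2) by apply: le_trans zb (le_trans bb _); rewrite ge_min lexx orbT.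
have {}ze : z.1 * (K + 2) <= e by rewrite -ler_pdivlMr.
have nz : `|z.1| = z.1 by rewrite gtr0_norm.
have zn : z.1 ^+ n <= z.1.
  by case: (n) n0 => // m _; rewrite exprS -[leRHS]mulr1 ler_wpM2l ?exprn_ile1 ?(ltW z0).
have zn0 : 0 <= z.1 ^+ n by rewrite exprn_ge0 // ltW.
have := hK z.1; rewrite nz => /(_ z1); rewrite ler_norml => /andP[k1 k3].
have u1 : t1 * z.1 ^+ n <= z.1 ^+ n by rewrite -[leRHS]mul1r ler_wpM2r.
have u0 : 0 <= t0 * z.1 ^+ n by rewrite mulr_ge0.
have kz : 0 <= K * z.1 by rewrite mulr_ge0 // ltW.
by rewrite /pbox /= nz; split=> //; split; [nra|rewrite ltr_norml; apply/andP; split; nra].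
Qed.

Definition dstrip (k : nat) := strip (2^-1 ^+ k.+1) (2^-1 ^+ k).

Lemma dstrip_disjoint : trivIset setT dstrip.
Proof.
apply: ltn_trivIset => k l kl; apply/seteqP; split=> // z [[[h1 h2] _] [[h3 h4] _]].
move: (lt_le_trans h1 h4); rewrite ltNge => /negP; apply.
by rewrite ler_wiXn2l // ?invr_ge0 // invf_le1 // ler1n.
Qed.

(** On a strip of width proportional to x^n, the function x^(-k) fails to be in L^p when x^(n - k p)
    is not integrable at 0. *)
Definition divergent_order (pp : option R) (k : nat) : Prop :=
  match pp with Some p => 0 <= p /\ n%:R + 1 <= k%:R * p | None => (0 < k)%N end.

(** On the l-th dyadic strip h >= c 2^(l k), while the area is at least a constant times 2^(-l (n +
    1)). For p < oo every strip beyond some index therefore contributes at least the same [kap] > 0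
    to the integral; for oo, h exceeds any bound on a set of positive measure. *)
Lemma not_Lclass pp k (c e : R) (h : R * R -> R) : 0 < c -> 0 < e -> divergent_order pp k ->
  (forall z : R * R, 0 < z.1 -> z.1 < e ->
     t0 * z.1 ^+ n <= z.2 + q.[z.1] -> z.2 + q.[z.1] <= t1 * z.1 ^+ n ->
     c / z.1 ^+ k <= h z) ->
  ~ Lclass pp h.
Proof.
move=> c0 e0 bad hh [e1 [e10 mh H]].
have [b0 [b00 hb]] := strip_pbox e10.
have [N hN] : exists N : nat, forall l, (N <= l)%N -> (2^-1 ^+ l < e) /\ 2^-1 ^+ l <= b0.
  have e20 : 0 < Num.min 1 (Num.min (e / 2) b0) by rewrite !lt_min ltr01 divr_gt0.
  have e21 : Num.min 1 (Num.min (e / 2) b0) <= 1 by rewrite ge_min lexx.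
  have [N [N1 _]] := dyadic_scale e20 e21; exists N.+1 => l Nl.
  have : 2^-1 ^+ l <= 2^-1 ^+ N.+1 :> R.
    by rewrite ler_wiXn2l // ?invr_ge0 // invf_le1 // ler1n.
  move=> l1; have := le_lt_trans l1 N1; rewrite !lt_min => /and3P[_ l2 l3].
  by split; [lra|exact: ltW].
have hlow l z : (N <= l)%N -> dstrip l z -> c * (2 ^+ l) ^+ k <= h z.
  move=> /hN[l1 l2] [[z1 z2] [z3 z4]].
  have z0 : 0 < z.1 by apply: le_lt_trans z1; rewrite exprn_ge0 ?invr_ge0.
  apply: le_trans (hh z z0 (le_lt_trans z2 l1) z3 z4).
  rewrite ler_wpM2l ?(ltW c0) // -exprVn lerXn2r ?nnegrE ?exprn_ge0 ?invr_ge0 ?(ltW z0) //.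
  by rewrite -[leLHS]invrK lef_pV2 ?posrE ?invr_gt0 ?exprn_gt0 // -exprVn.
have strip_in l : (N <= l)%N -> dstrip l `<=` pbox e1.
  by move=> /hN[_ l2]; apply: hb => //; rewrite exprn_ge0 // invr_ge0.
have mm l : (((t1 - t0) * 2^-1 ^+ n.+1 * (2^-1 ^+ l) ^+ n.+1)%:E <= @leb2 R (dstrip l))%E.
  have h1 : 0 <= 2^-1 ^+ l.+1 :> R by rewrite exprn_ge0 // invr_ge0.
  have h2 : 2^-1 ^+ l.+1 < 2^-1 ^+ l :> R.
    rewrite exprS -[ltRHS]mul1r ltr_pM2r ?exprn_gt0 ?invr_gt0 // invf_lt1 // ltr1n //.
  apply: le_trans (strip_measure h1 h2); rewrite lee_fin le_eqVlt; apply/orP; left; apply/eqP.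
  by rewrite (exprS _ l) exprMn !(exprS _ n); field.
case: pp bad H => [p|] bad H; last first.
  move: H => [K HK].
  have [l [Nl lK]] : exists l : nat, (N <= l)%N /\ K < c * (2 ^+ l) ^+ k.
    have [r Kr] : exists r : nat, K / c < r%:R.
      by exists (Num.trunc `|K / c|).+1; apply: le_lt_trans (ler_norm _) _; apply: truncnS_gt.
    exists (maxn N r); split; first exact: leq_maxl.
    rewrite mulrC -ltr_pdivrMr //; apply: lt_le_trans Kr _.
    apply: (@le_trans _ _ (2 ^+ maxn N r)).
      rewrite -natrX ler_nat; apply: leq_trans (ltnW (ltn_expl _ (leqnn 2))).
      exact: leq_maxr.
    rewrite -exprM ler_weXn2l ?ler1n // -[leqLHS]muln1 leq_mul //.
  have neg : (@leb2 R).-negligible (dstrip l).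
    case: HK => A [mA A0 hA]; exists A; split=> // z zl; apply: hA => /= hz.
    have := hz (strip_in l Nl z zl); rewrite leNgt => /negP; apply.
    exact: lt_le_trans lK (hlow l z Nl zl).
  have := mm l.
  have -> : @leb2 R (dstrip l) = 0%E.
    exact: (@measure_negligible _ _ _ (mu \x mu)%E _ (measurable_strip _ _) neg).
  rewrite lee_fin leNgt => /negP; apply.
  by rewrite !mulr_gt0 ?exprn_gt0 ?invr_gt0 ?subr_gt0.
move: bad => [p0 bad].
pose kap := c `^ p * ((t1 - t0) * 2^-1 ^+ n.+1).
have kap0 : 0 < kap by rewrite !mulr_gt0 ?powR_gt0 ?exprn_gt0 ?invr_gt0 ?subr_gt0.
have mhp := measurable_powp p mh.
have int_l l : (N <= l)%N -> (kap%:E <= \int[@leb2 R]_(z in dstrip l) ((h z) `^ p)%:E)%E.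
  move=> Nl.
  apply: (@le_trans _ _ (\int[@leb2 R]_(z in dstrip l) cst ((c * (2 ^+ l) ^+ k) `^ p)%:E z)%E).
    have e3 := integral_cst (mu \x mu)%E (measurable_strip (2^-1 ^+ l.+1) (2^-1 ^+ l)) ((c * (2 ^+ l) ^+ k) `^ p)%:E.
    rewrite /leb2 /dstrip e3.
    apply: le_trans (_ : ((c * (2 ^+ l) ^+ k) `^ p)%:E * ((t1 - t0) * 2^-1 ^+ n.+1 * (2^-1 ^+ l) ^+ n.+1)%:E <= _)%E; last first.
      by apply: lee_wpmul2l; [rewrite lee_fin powR_ge0|exact: mm].
    rewrite -EFinM lee_fin /kap powRM ?(ltW c0) ?exprn_ge0 // -!mulrA ler_wpM2l ?powR_ge0 //.
    rewrite mulrCA ler_wpM2l ?subr_ge0 ?(ltW t01) // mulrCA.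
    rewrite -[leLHS]mulr1 ler_wpM2l ?exprn_ge0 ?invr_ge0 //.
    have a1 : 1 <= 2 ^+ l :> R by rewrite exprn_ege1 // ler1n.
    have -> : ((2 ^+ l) ^+ k) `^ p = (2 ^+ l) `^ (k%:R * p) :> R.
      by rewrite powRrM powR_mulrn // exprn_ge0.
    have -> : (2^-1 ^+ l) ^+ n.+1 = ((2 ^+ l) `^ (n%:R + 1))^-1 :> R.
      by rewrite natr1 powR_mulrn ?exprn_ge0 // !exprVn.
    rewrite ler_pdivlMr ?mul1r ?powR_gt0 ?exprn_gt0 //.
    exact: ler_powR.
  rewrite /leb2; apply: ge0_le_integral => //.
  - exact: measurable_strip.
  - by move=> z _; rewrite lee_fin powR_ge0.
  - exact: measurable_funS (measurable_pbox _) (strip_in l Nl) mhp.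
  - move=> z zl; rewrite lee_fin; apply: ge0_ler_powR => //; last exact: hlow.
      by rewrite nnegrE mulr_ge0 ?exprn_ge0 ?(ltW c0).
    rewrite nnegrE; apply: le_trans (hlow l z Nl zl).
    by rewrite mulr_ge0 ?exprn_ge0 ?(ltW c0).
pose F l := dstrip (N + l).
have mF l : measurable (F l) by exact: measurable_strip.
have subF : \bigcup_l F l `<=` pbox e1.
  by move=> z [l _]; apply: strip_in; exact: leq_addr.
have tF : trivIset setT F.
  move=> i j _ _ /= hij; apply/eqP; rewrite -(eqn_add2l N); apply/eqP.
  exact: (dstrip_disjoint _ _ hij).
have ge_all r : ((r%:R * kap)%:E <= \int[@leb2 R]_(z in pbox e1) ((h z) `^ p)%:E)%E.
  apply: (@le_trans _ _ (\int[@leb2 R]_(z in \bigcup_l F l) ((h z) `^ p)%:E)%E); last first.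
    rewrite /leb2; apply: ge0_subset_integral => //.
    - by apply: bigcup_measurable => l _; exact: mF.
    - exact: measurable_pbox.
    - by move=> z _; rewrite lee_fin powR_ge0.
  rewrite /leb2 ge0_integral_bigcup //; last 2 first.
  - by apply: measurable_funS (measurable_pbox _) subF mhp.
  - by move=> z _; rewrite lee_fin powR_ge0.
  apply: le_trans (nneseries_lim_ge r _); last first.
    by move=> l _ _; apply: integral_ge0 => z _; rewrite lee_fin powR_ge0.
  have -> : (r%:R * kap)%:E = (\sum_(0 <= i < r) kap%:E)%E.
    by rewrite sumEFin sumr_const_nat subn0 mulr_natl.
  by apply: lee_sum => l _; apply: int_l; exact: leq_addr.
have I0 : (0 <= \int[@leb2 R]_(z in pbox e1) ((h z) `^ p)%:E)%E.
  by apply: integral_ge0 => z _; rewrite lee_fin powR_ge0.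
have fin : (\int[@leb2 R]_(z in pbox e1) ((h z) `^ p)%:E)%E \is a fin_num by rewrite ge0_fin_numE.
move: ge_all; rewrite -(fineK fin); set I := fine _ => ge_all.
have := ge_all (Num.trunc `|I / kap|).+1; rewrite lee_fin leNgt => /negP; apply.
rewrite -ltr_pdivrMr //; apply: le_lt_trans (ler_norm _) _; apply: truncnS_gt.
Qed.

End Strip.

(** * The branches of [P] and their contact orders *)

Lemma pordP (R : realType) (p : {poly R}) : p != 0 ->
  p`_(pord p) != 0 /\ forall n, (n < pord p)%N -> p`_n = 0.
Proof.
move=> p0.
have hp : has (fun c => c != 0) p.
  apply/hasP; exists (lead_coef p); last by rewrite lead_coef_eq0.
  by rewrite mem_nth // prednK // lt0n size_poly_eq0.
split; first exact: (nth_find 0 hp).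
by move=> n /(before_find 0) /negbFE /eqP.
Qed.

Lemma pord_opp (R : realType) (p : {poly R}) : pord (- p) = pord p.
Proof.
have [->|p0] := eqVneq p 0; first by rewrite oppr0.
have [h1 h2] := pordP p0; have np0 : - p != 0 by rewrite oppr_eq0.
have [h3 h4] := pordP np0; apply/eqP; rewrite eqn_leq; apply/andP; split; rewrite leqNgt.
  by apply/negP => /h4; rewrite coefN => /eqP; rewrite oppr_eq0 (negbTE h1).
by apply/negP => /h2 /eqP; rewrite -oppr_eq0 -coefN (negbTE h3).
Qed.

Section ComplexPoly.
Variable R : realType.
Local Notation C := R[i].

Lemma poly_XnM (g : {poly C}) n : (forall i, (i < n)%N -> g`_i = 0) ->
  exists2 u : {poly C}, g = 'X^n * u & u`_0 = g`_n.
Proof.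
move=> h; exists (drop_poly n g); last by rewrite coef_drop_poly add0n.
apply/polyP => i; rewrite coefXnM coef_drop_poly.
by case: ltnP => [/h //|ni]; rewrite subnK.
Qed.

Lemma poly_bound (u : {poly C}) : exists2 K : R, 0 <= K &
  forall x : R, `|x| <= 1 -> cabs (u.[x%:C] - u`_0) <= K * `|x|.
Proof.
exists (\sum_(i < size u) cabs u`_i); first by apply: sumr_ge0 => i _; exact: cabs_ge0.
move=> x x1; rewrite horner_coef.
case e: (size u) => [|n]; first by rewrite !big_ord0 nth_default ?e // subr0 cabs0 mul0r.
rewrite !big_ord_recl /= expr0 mulr1 addrAC subrr add0r (le_trans (cabs_sum _ _ _)) //.
rewrite mulrDl -[leLHS]add0r lerD ?mulr_ge0 ?cabs_ge0 // mulr_suml; apply: ler_sum => i _.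
rewrite cabsM ler_wpM2l ?cabs_ge0 // cabsX cabsR /bump /= add1n exprS.
by rewrite -[leRHS]mulr1 ler_wpM2l ?exprn_ile1.
Qed.

Lemma poly_order_bounds (g u : {poly C}) n : g = 'X^n * u -> u`_0 != 0 ->
  exists c K e : R, [/\ 0 < c, 0 <= K, 0 < e & forall x : R, `|x| < e ->
    c * `|x| ^+ n <= cabs g.[x%:C] /\ cabs g.[x%:C] <= K * `|x| ^+ n].
Proof.
move=> -> u0; have [B B0 hB] := poly_bound u; have c0 : 0 < cabs u`_0 by rewrite cabs_gt0.
pose v := cabs u`_0; rewrite -/v in c0.
have den : 0 < 2 * (B + 1) by lra.
exists (v / 2), (v + B), (Num.min 1 (v / (2 * (B + 1)))); split.
- by rewrite divr_gt0.
- by rewrite addr_ge0 // ltW.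
- by rewrite lt_min ltr01 divr_gt0.
move=> x; rewrite lt_min => /andP[x1 xv].
have {}xv : `|x| * (2 * (B + 1)) < v by rewrite -ltr_pdivlMr.
have x0 := normr_ge0 x; have Bx := mulr_ge0 B0 x0.
have h := hB x (ltW x1).
rewrite hornerM hornerXn cabsM cabsX cabsR [`|x| ^+ n * _]mulrC.
have l1 : v - cabs (u.[x%:C] - u`_0) <= cabs u.[x%:C].
  rewrite lerBlDr -[cabs (_ - _)]cabsN opprB /v -{1}[u`_0](subrK u.[x%:C]).
  by rewrite addrC [leRHS]addrC (le_trans (cabsD _ _)) // addrC.
have l2 : cabs u.[x%:C] <= v + cabs (u.[x%:C] - u`_0).
  by rewrite -{1}[u.[x%:C]](subrK u`_0) addrC; exact: cabsD.
have Bx1 : B * `|x| <= B.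
  by rewrite -[leRHS]mulr1 ler_wpM2l // ltW.
by split; rewrite ler_wpM2r ?exprn_ge0 //; lra.
Qed.

End ComplexPoly.

Section Branches.
Variables (R : realType) (M : nat) (L : 'I_M -> nat) (q : 'I_M -> {poly R}).
Local Notation C := R[i].
Local Notation F2 := (fps (fps C)).
Local Notation O := (Ojk L q).

Definition Cpoly (p : {poly R}) : {poly C} := map_poly (fun r : R => r%:C) p.
Lemma coef_Cpoly p i : (Cpoly p)`_i = (p`_i)%:C.
Proof. by rewrite coef_map_id0. Qed.
Lemma horner_Cpoly p x : (Cpoly p).[x%:C] = (p.[x])%:C.
Proof. exact: (horner_map (real_complex R)). Qed.

Definition rho j : {poly C} := - (Cpoly (q j) + (Complex 0 1) *: 'X^(2 * L j)).
Definition fq j : {poly {poly C}} :=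
  'X + (Cpoly (q j) + (Complex 0 1) *: 'X^(2 * L j))%:P.
Definition fqc j : {poly {poly C}} :=
  'X + (Cpoly (q j) - (Complex 0 1) *: 'X^(2 * L j))%:P.
(** This is conj f_j - f_k, in which y cancels; equivalently, the value of conj f_j at the root y =
    [rho k] of f_k. *)
Definition gdiff j k : {poly C} :=
  Cpoly (q j) - Cpoly (q k) - (Complex 0 1) *: ('X^(2 * L j) + 'X^(2 * L k)).

Lemma ps2_fq j : ps2 (fq j) = root_poly (rho j).
Proof. by rewrite /fq ps2D ps2X ps2C /root_poly /rho !rmorphN opprK. Qed.

Lemma fqcE j k : fqc j = fq k + (gdiff j k)%:P.
Proof.
rewrite /fqc /fq -addrA -polyCD; congr (_ + _%:P); rewrite /gdiff scalerDr.
set a := _ *: 'X^(2 * L j); set b := _ *: 'X^(2 * L k); ring.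
Qed.

Lemma bracketPE : bracketP L q = \prod_(j < M) fq j.
Proof. by []. Qed.

Lemma pconj_bracketP : pconj (bracketP L q) = \prod_(j < M) fqc j.
Proof.
rewrite /pconj.
have -> : map_poly (map_poly (@cconj R)) (bracketP L q)
        = map_poly (map_poly (@conjc R)) (bracketP L q).
  apply: eq_map_poly => p; apply: eq_map_poly; by case.
rewrite bracketPE rmorph_prod; apply: eq_bigr => j _.
rewrite /fq rmorphD /= map_polyX map_polyC /= /fqc; congr (_ + _%:P).
apply/polyP => i; rewrite coef_map /= !coefD coefN !coefZ coefXn !coef_Cpoly rmorphD /=.
congr (_ + _); first by rewrite /= oppr0.
by case: (i == _); apply/eqP; rewrite eq_complex /=; apply/andP; split; apply/eqP; ring.
Qed.

Lemma evalR_fq j x y : evalR (fq j) x y = branch (q j) (2 * L j) (x, y).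
Proof.
rewrite /fq evalRD evalRX evalRC hornerD horner_Cpoly hornerZ hornerXn -rmorphXn.
by apply/eqP; rewrite eq_complex /=; apply/andP; split; apply/eqP; ring.
Qed.

Lemma cabs_fqc j x y : cabs (evalR (fqc j) x y) = bmod (q j) (2 * L j) (x, y).
Proof.
have -> : evalR (fqc j) x y = Complex (y + (q j).[x]) (- x ^+ (2 * L j)).
  rewrite /fqc evalRD evalRX evalRC hornerD horner_Cpoly hornerN hornerZ hornerXn -rmorphXn.
  by apply/eqP; rewrite eq_complex /=; apply/andP; split; apply/eqP; ring.
by rewrite /bmod /cabs /= sqrrN.
Qed.

Lemma OjkC j k : O j k = O k j.
Proof.
rewrite /Ojk eq_sym [minn (2 * L k) _]minnC; case: eqP => // _.
by rewrite -pord_opp opprB.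
Qed.

Lemma Ojj j : O j j = (2 * L j)%N.
Proof. by rewrite /Ojk eqxx minnn. Qed.

Lemma Ojk_le j k : (O j k <= 2 * L k)%N.
Proof. by rewrite /Ojk; case: ifP => _; lia. Qed.

Lemma coef_gdiff j k i : (gdiff j k)`_i =
  Complex ((q j - q k)`_i) (- ((i == 2 * L j)%N%:R + (i == 2 * L k)%N%:R)).
Proof.
rewrite /gdiff !coefB coefZ coefD !coefXn !coef_Cpoly.
apply/eqP; rewrite eq_complex /=; apply/andP.
by case: (i == _); case: (i == _); split; apply/eqP => /=; ring.
Qed.

(** The real part q_j - q_k and the imaginary part -(x^(2 L_j) + x^(2 L_k)) cannot cancel each
    other, and the two powers carry the same sign. Hence the order is exactly the minimum that
    defines O_jk. *)
Lemma gdiff_order j k : exists2 u : {poly C}, gdiff j k = 'X^(O j k) * u & u`_0 != 0.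
Proof.
rewrite OjkC.
have h0 i : (i < O k j)%N -> (gdiff j k)`_i = 0.
  move=> iO; rewrite coef_gdiff.
  have i1 : (i == 2 * L j)%N = false by apply/negP => /eqP; move: iO; rewrite /Ojk; case: ifP => _; lia.
  have i2 : (i == 2 * L k)%N = false by apply/negP => /eqP; move: iO; rewrite /Ojk; case: ifP => _; lia.
  rewrite i1 i2 addr0 oppr0.
  suff -> : (q j - q k)`_i = 0 by [].
  move: iO; rewrite /Ojk; case: (q j =P q k) => [->|/eqP ne]; first by rewrite subrr coef0.
  have ne0 : q j - q k != 0 by rewrite subr_eq0.
  have [_ h] := pordP ne0.
  by move=> iO; apply: h; lia.
have [u gu u0] := poly_XnM h0; exists u => //; rewrite u0 coef_gdiff eq_complex /=.
apply/negP => /andP[/eqP h1 h2].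
have [e1 e2] : (O k j == 2 * L j)%N = false /\ (O k j == 2 * L k)%N = false.
  move: h2; rewrite oppr_eq0 -natrD pnatr_eq0.
  by case: (O k j == 2 * L j)%N; case: (O k j == 2 * L k)%N.
move: h1; move: e1 e2; rewrite /Ojk; case: (q j =P q k) => [_|/eqP ne].
  by move=> e1 e2; exfalso; lia.
have ne0 : q j - q k != 0 by rewrite subr_eq0.
have [h _] := pordP ne0 => e1 e2.
have -> : minn (pord (q j - q k)) (minn (2 * L j) (2 * L k)) = pord (q j - q k) by lia.
by move=> /eqP; rewrite (negbTE h).
Qed.

Lemma gdiff_bounds j k : exists c K e : R, [/\ 0 < c, 0 <= K, 0 < e & forall x : R, `|x| < e ->
    c * `|x| ^+ O j k <= cabs (gdiff j k).[x%:C] /\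
    cabs (gdiff j k).[x%:C] <= K * `|x| ^+ O j k].
Proof. by have [u gu u0] := gdiff_order j k; apply: poly_order_bounds gu u0. Qed.

Lemma gdiff_le j k x y : cabs (gdiff j k).[x%:C] <=
  bmod (q j) (2 * L j) (x, y) + bmod (q k) (2 * L k) (x, y).
Proof.
have e : (gdiff j k).[x%:C] = evalR (fqc j) x y - evalR (fq k) x y.
  by rewrite (fqcE j k) evalRD evalRC addrAC subrr add0r.
by rewrite e (le_trans (cabsD _ _)) // cabsN cabs_fqc evalR_fq.
Qed.

Lemma bmod_le_gdiff j k x y : bmod (q j) (2 * L j) (x, y) <=
  bmod (q k) (2 * L k) (x, y) + cabs (gdiff j k).[x%:C].
Proof. by rewrite -cabs_fqc (fqcE j k) evalRD evalRC (le_trans (cabsD _ _)) // evalR_fq. Qed.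

(** Modulo f_k each conj f_j becomes the polynomial conj f_j - f_k in x. Over all branches this
    gives the remainder of conj [P] modulo f_k, of order b_k. *)
Lemma prod_fqc_mod k (s : seq 'I_M) : exists H : F2,
  ps2 (\prod_(j <- s) fqc j) = root_poly (rho k) * H + fps_const (fps_poly (\prod_(j <- s) gdiff j k)).
Proof.
elim: s => [|j s [H IH]].
  by exists 0; rewrite !big_nil ps2_1 mulr0 add0r !rmorph1.
exists (ps2 (\prod_(j <- s) fqc j) + fps_const (fps_poly (gdiff j k)) * H).
rewrite !big_cons ps2M IH (fqcE j k) ps2D ps2C ps2_fq.
rewrite [fps_poly (_ * _)]rmorphM [fps_const (_ * _)]rmorphM /=.
set a := root_poly _; set b := fps_const _; set c := fps_const _; ring.
Qed.

Lemma prod_gdiff_order k (s : seq 'I_M) : exists2 u : {poly C},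
  \prod_(j <- s) gdiff j k = 'X^(\sum_(j <- s) O j k) * u & u`_0 != 0.
Proof.
elim: s => [|j s [u eu u0]].
  by exists 1; rewrite ?big_nil ?expr0 ?mulr1 // coef1 oner_eq0.
have [v ev v0] := gdiff_order j k; exists (v * u).
  by rewrite !big_cons eu ev exprD; ring.
by rewrite coefM big_ord1 mulf_neq0.
Qed.

End Branches.

(** * Series with an integrable quotient by a product of branches *)

Section GermSeries.
Variable R : realType.
Local Notation C := R[i].
Local Notation F2 := (fps (fps C)).

Lemma pbox_le (e : R) z : pbox e z -> `|z.1| <= e /\ `|z.2| <= e.
Proof. by move=> [_ [h1 h2]]; split; exact: ltW. Qed.

Lemma germ_pvD (G H : F2) : cvs G -> cvs H ->
  germ (fun z => pv (G + H) z.1 z.2 = pv G z.1 z.2 + pv H z.1 z.2).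
Proof.
move=> cG cH; have [r [r0 [K [h h']]]] := cvs_common cG cH.
exists r; split=> // z /pbox_le[z1 z2]; exact: pvD h h'.
Qed.

Lemma germ_pvM P (G : F2) : cvs G ->
  germ (fun z => pv (ps2 P * G) z.1 z.2 = evalR P z.1 z.2 * pv G z.1 z.2).
Proof.
move=> /cvsP[r [r0 [K h]]]; exists r; split=> // z /pbox_le[z1 z2].
exact: pvM h z1 z2.
Qed.

Lemma germ_pv_le (G : F2) : cvs G ->
  exists2 K : R, 0 <= K & germ (fun z => cabs (pv G z.1 z.2) <= K).
Proof.
move=> /cvsP[r [r0 [K h]]]; exists (2 * K).
  by have := h 0%N; rewrite /sqsum big_ord0 => K0; rewrite mulr_ge0.
by exists r; split=> // z /pbox_le[z1 z2]; exact: pv_le h.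
Qed.

Lemma evalR_le P : exists2 K : R, 0 <= K &
  forall x y : R, `|x| <= 1 -> `|y| <= 1 -> cabs (evalR P x y) <= K.
Proof.
have [K h] := @ps2M_cvr R _ _ P _ ler01 (cvr1 ler01); rewrite mulr1 in h.
exists (2 * K); first by have := h 0%N; rewrite /sqsum big_ord0 => K0; rewrite mulr_ge0.
by move=> x y x1 y1; rewrite -pv_ps2; exact: pv_le h.
Qed.

Lemma gmeas_pv_div (G : F2) (h : R * R -> R) : cvs G -> measurable_fun setT h ->
  (forall z, 0 <= h z) -> gmeas (fun z => cabs (pv G z.1 z.2) / h z).
Proof.
move=> /cvsP[r [r0 [K hK]]] mh h0; exists r; split=> //.
apply: measurable_funM; first by apply: cmeas_abs; apply: cmeas_pv hK _; exact: pbox_le.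
by apply: measurable_inv_ge0 => //; exact: measurable_funTS.
Qed.

(** Repeated division by W = y - p yields the Taylor coefficients in W; each is cut at x^a and the
    tails are collected in [E1]. The main part becomes a polynomial, and both errors are O(x^a)
    wherever |W| <= |x|. *)
Lemma taylor (p : {poly C}) (Q : F2) a : p`_0 = 0 -> cvs Q ->
  exists (d : nat -> {poly C}) (E1 E2 : F2), [/\ cvs E1, cvs E2 &
    Q = ps2 (\sum_(j < a) (d j)%:P * ('X - p%:P) ^+ j)
        + ps2 ('X^a)%:P * E1 + ps2 (('X - p%:P) ^+ a) * E2].
Proof.
move=> p0 cQ; set W := 'X - p%:P.
have wE : ps2 W = root_poly p by rewrite /W ps2B ps2X ps2C.
(* The number of Taylor terms is separated from the cut-off a, so that the induction runs on it
   alone. *)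
suff gen J : exists (d : nat -> {poly C}) (E1 E2 : F2), [/\ cvs E1, cvs E2 &
    Q = ps2 (\sum_(j < J) (d j)%:P * W ^+ j) + ps2 ('X^a)%:P * E1 + ps2 (W ^+ J) * E2].
  exact: gen.
elim: J => [|J [d [E1 [E2 [c1 c2 e]]]]].
  exists (fun=> 0), 0, Q; split=> //; first exact: cvs0.
  have e1 (F : 'I_0 -> {poly {poly C}}) : ps2 (\sum_(j < 0) F j) = 0.
    by rewrite big_ord0; exact: ps2_0.
  have e2 : ps2 (W ^+ 0) = 1 by rewrite expr0; exact: ps2_1.
  by rewrite e1 e2 mulr0 mul1r !add0r.
pose c := root_rem p E2; have cc : cvs (fps_const c) by exact: cvs_rem.
pose dJ : {poly C} := \poly_(n < a) fcoef c n.
pose tl := Fps (fun n => fcoef c (a + n)%N).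
have cE : fps_const c = ps2 dJ%:P + ps2 ('X^a)%:P * fps_const tl.
  rewrite !ps2C -rmorphM -rmorphD /=; congr fps_const.
  have -> : fps_poly ('X^a : {poly C}) = fps_X C ^+ a by rewrite rmorphXn.
  apply: fpsP => n; rewrite fcoefD fcoefXnM /= coef_poly; case: ltnP => an.
    by rewrite addr0.
  by rewrite add0r subnKC.
exists (fun j => if (j == J)%N then dJ else d j), (E1 + ps2 (W ^+ J) * fps_const tl), (root_quo p E2).
split.
- by apply: cvsD => //; apply: cvs_ps2M; exact: cvs_const_tail.
- exact: cvs_quo.
rewrite big_ord_recr /= eqxx.
have -> : \sum_(i < J) (if (i == J :> nat)%N then dJ else d i)%:P * W ^+ i
        = \sum_(i < J) (d i)%:P * W ^+ i.
  by apply: eq_bigr => i _; rewrite ltn_eqF.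
rewrite [in LHS]e [in LHS](root_polyE E2 p0) -/c cE ps2D ps2M exprSr ps2M -wE.
set A := ps2 (\sum_(i < J) _); ring.
Qed.

(* Points 1/(i+2): infinitely many of them, all in (0, 1/2]. *)
Lemma nonroot_point (h : {poly C}) : h != 0 ->
  exists t : R, [/\ 0 < t, t <= 2^-1 & h.[t%:C] != 0].
Proof.
move=> h0; pose pt i : R := (i.+2)%:R^-1.
have [|hall] := pselect (exists i, h.[(pt i)%:C] != 0).
  move=> [i hi]; exists (pt i); split=> //; first by rewrite invr_gt0.
  by rewrite lef_pV2 ?posrE // ler_nat.
exfalso; pose rs := [seq (pt i)%:C | i <- iota 0 (size h)].
have : (size rs < size h)%N.
  apply: max_poly_roots => //.
    apply/allP => z /mapP[i _ ->]; apply/negPn/negP => hi; apply: hall; exists i.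
    exact: hi.
  rewrite map_inj_uniq ?iota_uniq // => i j /complexI /invr_inj /eqP.
  by rewrite eqr_nat => /eqP[].
by rewrite size_map size_iota ltnn.
Qed.

Lemma nonvanishing_interval (h : {poly C}) : h != 0 ->
  exists t0 t1 v : R, [/\ 0 < t0, t0 < t1, t1 <= 1, 0 < v &
    forall t : R, t0 <= t -> t <= t1 -> v <= cabs h.[t%:C]].
Proof.
move=> /nonroot_point[t0 [t00 t02 ht]].
pose u := h \Po ('X + (t0%:C)%:P).
have uE (s : R) : u.[s%:C] = h.[(s + t0)%:C] by rewrite horner_comp !hornerE -rmorphD.
have u0 : u`_0 = h.[t0%:C].
  have := uE 0; rewrite add0r => <-.
  by rewrite -horner_coef0.
have [B B0 hB] := poly_bound u.
pose v := cabs h.[t0%:C]; have v0 : 0 < v by rewrite cabs_gt0.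
have den : 0 < 2 * (B + 1) by lra.
pose dl := Num.min 2^-1 (v / (2 * (B + 1))).
have dl0 : 0 < dl by rewrite lt_min invr_gt0 ltr0n divr_gt0.
have dl2 : dl <= 2^-1 by rewrite ge_min lexx.
have dlv : dl * (2 * (B + 1)) <= v by rewrite -ler_pdivlMr // ge_min lexx orbT.
exists t0, (t0 + dl), (v / 2); split=> //; [lra|lra|by rewrite divr_gt0|].
move=> t h1 h2; pose s := t - t0.
have s0 : 0 <= s by rewrite subr_ge0.
have sd : s <= dl by rewrite /s; lra.
have ns : `|s| = s by rewrite ger0_norm.
have := hB s; rewrite ns => /(_ (le_trans sd (le_trans dl2 _))).
rewrite invf_le1 // ler1n => /(_ isT); rewrite uE u0 subrK => hs.
have l1 : v <= cabs h.[t%:C] + cabs (h.[t%:C] - h.[t0%:C]).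
  rewrite -[cabs (_ - _)]cabsN opprB /v -{1}[h.[t0%:C]](subrK h.[t%:C]) addrC [leRHS]addrC.
  by rewrite (le_trans (cabsD _ _)) // addrC.
nra.
Qed.

End GermSeries.

Lemma half_margin (R : realType) (x K v : R) :
  0 < x -> x * (2 * (K + 1)) < v -> 0 <= x * K -> v / 2 <= v - x * K.
Proof. by move=> *; lra. Qed.

(** * Orders of remainders and integrability of quotients *)

Section Quotients.
Variables (R : realType) (M : nat) (L : 'I_M -> nat) (q : 'I_M -> {poly R}).
Variables (pp : option R) (cc : 'I_M -> nat).
Local Notation C := R[i].
Local Notation F2 := (fps (fps C)).
Local Notation O := (Ojk L q).
Local Notation fq := (fq L q).
Local Notation rho := (rho L q).
Hypothesis pp1 : if pp is Some p then 1 <= p else true.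
Hypothesis q0 : forall j, (q j).[0] = 0.
Hypothesis L0 : forall j, (0 < L j)%N.
Hypothesis cc_le : forall j, (cc j <= 2 * L j)%N.
(** With the next hypothesis this places c_l at the threshold: x^(2 L_l - c_l) / f_l is in L^p, but
    x^(-(c_l + 1)) is not, on a strip along f_l. *)
Hypothesis cc_int : forall j, integrable_order pp (2 * L j) (2 * L j - cc j).
Hypothesis cc_div : forall j, divergent_order (2 * L j) pp (cc j).+1.

Let pp0 : if pp is Some p then 0 <= p else true.
Proof. by case: pp pp1 => // p; exact: le_trans. Qed.

Let n0 j : (0 < 2 * L j)%N. Proof. by have := L0 j; lia. Qed.

Lemma rho0 j : (rho j)`_0 = 0.
Proof.
rewrite /rho coefN coefD coefZ coefXn coef_Cpoly -horner_coef0 q0.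
by rewrite eq_sym (gtn_eqF (n0 j)) mulr0 addr0 oppr0.
Qed.

Definition den (s : seq 'I_M) (z : R * R) : R := \prod_(j <- s) bmod (q j) (2 * L j) z.
Definition V (s : seq 'I_M) (Q : F2) : Prop :=
  cvs Q /\ Lclass pp (fun z => cabs (pv Q z.1 z.2) / den s z).

Lemma den_ge0 s z : 0 <= den s z.
Proof. by apply: prodr_ge0 => j _; exact: cabs_ge0. Qed.

Lemma den_gt0 s e z : pbox e z -> 0 < den s z.
Proof. by move=> ze; apply: prodr_gt0 => j _; exact: bmod_gt0 ze. Qed.

Lemma measurable_den s : measurable_fun setT (den s).
Proof.
elim: s => [|j s IH].
  have -> : den [::] = cst 1 by apply/funext => z; rewrite /den big_nil.
  exact: measurable_cst.
have -> : den (j :: s) = (fun z => bmod (q j) (2 * L j) z * den s z).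
  by apply/funext => z; rewrite /den big_cons.
by apply: measurable_funM => //; exact: measurable_bmod.
Qed.

Lemma quo_ge0 s (Q : F2) z : 0 <= cabs (pv Q z.1 z.2) / den s z.
Proof. by rewrite divr_ge0 ?cabs_ge0 ?den_ge0. Qed.

Lemma gmeas_quo s (Q : F2) : cvs Q -> gmeas (fun z => cabs (pv Q z.1 z.2) / den s z).
Proof. by move=> cQ; apply: gmeas_pv_div => //; [exact: measurable_den|exact: den_ge0]. Qed.

Lemma evalR_fqs s z : cabs (evalR (\prod_(j <- s) fq j) z.1 z.2) = den s z.
Proof.
rewrite evalR_prod cabs_prod; apply: eq_bigr => j _; rewrite evalR_fq /bmod.
by case: z.
Qed.

Lemma V_dom s (Q : F2) h (K : R) : cvs Q -> Lclass pp h ->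
  germ (fun z => 0 <= h z /\ cabs (pv Q z.1 z.2) / den s z <= K * h z) -> V s Q.
Proof.
move=> cQ Lh hg; split=> //; apply: (Lclass_le (K := K) pp0 (gmeas_quo s cQ) Lh).
by apply: germS hg => z [h1 h2]; split; [exact: quo_ge0|].
Qed.

Lemma V_bounded s (Q : F2) (K : R) : cvs Q ->
  germ (fun z => cabs (pv Q z.1 z.2) <= K * den s z) -> V s Q.
Proof.
move=> cQ h; apply: (@V_dom s Q (fun=> 1) K) => //; first exact: Lclass_cst.
apply: germS (germI (germ_pbox ltr01) h) => z [z1 hz]; split=> //.
by rewrite mulr1 ler_pdivrMr // (den_gt0 _ z1).
Qed.

Lemma VB s (Q H : F2) : V s Q -> V s H -> V s (Q - H).
Proof.
move=> [cQ LQ] [cH LH]; have cN := cvsN cH.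
apply: (@V_dom s (Q - H) _ 1 (cvsB cQ cH) (Lclass_add pp0 (quo_ge0 s Q) (quo_ge0 s H) LQ LH)).
have eN : germ (fun z => pv (ps2 (- 1) * H) z.1 z.2 = evalR (- 1) z.1 z.2 * pv H z.1 z.2).
  exact: germ_pvM.
rewrite ps2N ps2_1 mulN1r in eN.
apply: germS (germI (germ_pvD cQ cN) eN) => z [-> ->].
split; first by rewrite addr_ge0 ?quo_ge0.
rewrite mul1r -mulrDl ler_wpM2r ?invr_ge0 ?den_ge0 //.
rewrite (le_trans (cabsD _ _)) // lerD2l cabsM.
have -> : evalR (- 1) z.1 z.2 = - 1 :> C by rewrite -polyC1 -polyCN evalRC !hornerE.
by rewrite cabsN cabs1 mul1r.
Qed.

Lemma V_cons k s (Q : F2) : cvs Q -> V (k :: s) (ps2 (fq k) * Q) <-> V s Q.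
Proof.
move=> cQ; have e := germI (germ_pbox ltr01) (germ_pvM (fq k) cQ).
have {}e : germ (fun z => cabs (pv (ps2 (fq k) * Q) z.1 z.2) / den (k :: s) z
                     = cabs (pv Q z.1 z.2) / den s z).
  apply: germS e => z [z1 ->]; rewrite /den big_cons -/(den s z) cabsM evalR_fq.
  rewrite -surjective_pairing -/(bmod _ _ _) invfM mulrACA divff ?mul1r //.
  by rewrite gt_eqF // (bmod_gt0 _ _ z1).
split=> -[c Lc].
  apply: (V_dom (K := 1) cQ Lc); apply: germS e => z ez.
  by rewrite mul1r -ez lexx ez quo_ge0.
apply: (V_dom (K := 1) (cvs_ps2M _ cQ) Lc); apply: germS e => z ->.
by rewrite mul1r lexx quo_ge0.
Qed.

Lemma gdiff_const : exists (c K : 'I_M -> 'I_M -> R),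
  [/\ forall j k, 0 < c j k, forall j k, 0 <= K j k &
   germ (fun z => forall jk : 'I_M * 'I_M,
    c jk.1 jk.2 * `|z.1| ^+ O jk.1 jk.2 <= cabs (gdiff L q jk.1 jk.2).[(z.1)%:C] /\
    cabs (gdiff L q jk.1 jk.2).[(z.1)%:C] <= K jk.1 jk.2 * `|z.1| ^+ O jk.1 jk.2)].
Proof.
have h : forall jk : 'I_M * 'I_M, exists cKe : R * R * R,
   [/\ 0 < cKe.1.1, 0 <= cKe.1.2, 0 < cKe.2 & forall x : R, `|x| < cKe.2 ->
     cKe.1.1 * `|x| ^+ O jk.1 jk.2 <= cabs (gdiff L q jk.1 jk.2).[x%:C] /\
     cabs (gdiff L q jk.1 jk.2).[x%:C] <= cKe.1.2 * `|x| ^+ O jk.1 jk.2].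
  by move=> [j k]; have [c [K [e h]]] := gdiff_bounds L q j k; exists (c, K, e).
have [f hf] := choice h.
exists (fun j k => (f (j, k)).1.1), (fun j k => (f (j, k)).1.2); split.
- by move=> j k; have [] := hf (j, k).
- by move=> j k; have [] := hf (j, k).
apply: germ_all => -[j k]; have [_ _ e0 he] := hf (j, k).
by exists (f (j, k)).2; split=> // z [_ [z1 _]]; exact: he.
Qed.

(** The number a_l(S). The subtraction is exact when l belongs to [s], as then the sum contains O_ll
    = 2 L_l >= c_l. *)
Definition aord l s := (\sum_(j <- s) O j l - cc l)%N.

(* At each point the branch of least modulus controls all the others:
   |f_j| >= |f_j - conj f_l| / 2 >= c |x|^(O j l). *)
Lemma den_lower s : uniq s -> exists K : 'I_M -> R, (forall l, 0 <= K l) /\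
  germ (fun z => s != [::] -> exists2 l, l \in s &
    `|z.1| ^+ (\sum_(j <- rem l s) O j l) * bmod (q l) (2 * L l) z <= K l * den s z).
Proof.
move=> us; have [c [K' [c0 _ hg]]] := gdiff_const.
exists (fun l => \prod_(j <- rem l s) (2 / c j l)); split.
  by move=> l; apply: prodr_ge0 => j _; rewrite divr_ge0 // ltW.
apply: germS hg => z hz sn.
have [l ls lmin] : exists2 l, l \in s &
    forall j, j \in s -> bmod (q l) (2 * L l) z <= bmod (q j) (2 * L j) z.
  case: s sn {us} => [//|i s] _; elim: s i => [|j s IH] i.
    by exists i; rewrite ?inE // => j; rewrite inE => /eqP->.
  have [l ls lmin] := IH j.
  have [le|lt] := leP (bmod (q i) (2 * L i) z) (bmod (q l) (2 * L l) z).
    exists i; first by rewrite inE eqxx.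
    by move=> k; rewrite inE => /predU1P[->//|/lmin]; exact: le_trans.
  exists l; first by rewrite inE ls orbT.
  by move=> k; rewrite inE => /predU1P[->|/lmin//]; exact: ltW.
exists l => //.
have -> : den s z = bmod (q l) (2 * L l) z * \prod_(j <- rem l s) bmod (q j) (2 * L j) z.
  by rewrite /den (big_rem l).
rewrite mulrCA [leLHS]mulrC ler_wpM2l ?cabs_ge0 //.
have sub j : j \in rem l s -> j \in s by move=> /mem_rem.
elim: (rem l s) sub => [|j t IH] sub; first by rewrite !big_nil expr0 mulr1.
rewrite !big_cons exprD mulrACA; apply: ler_pM; rewrite ?exprn_ge0 //; last first.
  by apply: IH => i it; apply: sub; rewrite inE it orbT.
have js : j \in s by apply: sub; rewrite inE eqxx.
have [h1 _] := hz (j, l); have cj := c0 j l.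
have := gdiff_le L q j l z.1 z.2; rewrite -surjective_pairing => h2.
have h3 := lmin j js; move: h1 => /= h1.
rewrite mulrAC ler_pdivlMr // mulrC; lra.
Qed.

(** The branch of least modulus varies with the point, so the quotient is dominated by the sum over
    all l in [s] of K_l |x|^(2 L_l - c_l) / |f_l|. After the other factors have used up sum_(j != l)
    O_jl, the inequality a >= a_l(S) leaves at least the power 2 L_l - c_l. *)
Lemma Lclass_xpow s a : uniq s -> (forall l, l \in s -> (aord l s <= a)%N) ->
  Lclass pp (fun z => `|z.1| ^+ a / den s z).
Proof.
move=> us ha.
have gm : gmeas (fun z : R * R => `|z.1| ^+ a / den s z).
  exists 1; split=> //; apply: measurable_funTS; apply: measurable_funM.
    by apply: measurable_funX; exact: measurable_norm1.
  by apply: measurable_inv_ge0; [exact: measurable_den|exact: den_ge0].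
case: (eqVneq s [::]) => [s0|sn].
  apply: (@Lclass_le _ pp _ (fun=> 1) 1 pp0 gm); first exact: Lclass_cst.
  exists 1; split=> // z [_ [z1 _]]; rewrite s0 /den big_nil divr1 mulr1.
  by rewrite exprn_ge0 // exprn_ile1 // ltW.
have [K [K0 hK]] := den_lower us.
pose F l z := K l * (`|z.1| ^+ (2 * L l - cc l) / bmod (q l) (2 * L l) z).
have F0 l z : 0 <= F l z by rewrite mulr_ge0 // divr_ge0 ?exprn_ge0 ?cabs_ge0.
have LF l : Lclass pp (F l).
  have Lb := Lclass_branch pp1 (q0 l) (n0 l) (cc_int l).
  apply: (@Lclass_le _ pp _ _ (K l) pp0 _ Lb).
    exists 1; split=> //; apply: measurable_funTS; apply: measurable_funM => //.
    apply: measurable_funM; first by apply: measurable_funX; exact: measurable_norm1.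
    by apply: measurable_inv_ge0; [exact: measurable_bmod|move=> z; exact: cabs_ge0].
  exists 1; split=> // z _; split; first exact: F0.
  by split; rewrite // divr_ge0 ?exprn_ge0 ?cabs_ge0.
apply: (@Lclass_le _ pp _ _ 1 pp0 gm (Lclass_sum s pp0 F0 LF)).
apply: germS (germI (germ_pbox ltr01) hK) => z [z1 /(_ sn)[l ls hl]].
have d0 := den_gt0 s z1; have b0 := bmod_gt0 (q l) (2 * L l) z1.
have [x0 [x1 _]] := z1.
split; first by rewrite divr_ge0 ?exprn_ge0 // ltW.
split; first exact: sumr_ge0.
rewrite mul1r; apply: (@le_trans _ _ (F l z)); last first.
  by rewrite (big_rem l) //= lerDl sumr_ge0.
rewrite /F ler_pdivrMr // mulrA mulrAC ler_pdivlMr //.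
apply: (@le_trans _ _ (`|z.1| ^+ (2 * L l - cc l) *
    (`|z.1| ^+ (\sum_(j <- rem l s) O j l) * bmod (q l) (2 * L l) z))); last first.
  by rewrite [leRHS]mulrAC [leRHS]mulrC ler_wpM2l ?exprn_ge0.
rewrite mulrA -exprD ler_wpM2r ?(ltW b0) // ler_wiXn2l ?(ltW x1) //.
have := ha l ls; rewrite /aord (big_rem l) //= Ojj; have := cc_le l.
by move: (\sum_(j <- _) _)%N (2 * L l)%N (cc l) => u v w; clear; lia.
Qed.

Lemma V_const s (c : fps C) a : uniq s -> (forall l, l \in s -> (aord l s <= a)%N) ->
  (forall n, (n < a)%N -> fcoef c n = 0) -> cvs (fps_const c) -> V s (fps_const c).
Proof.
move=> us ha c0 cc'; pose tl := Fps (fun n => fcoef c (a + n)%N).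
have ct : cvs (fps_const tl) by exact: cvs_const_tail.
have e : fps_const c = ps2 ('X^a)%:P * fps_const tl.
  by rewrite ps2C rmorphXn -rmorphM -(fps_XnK c0).
have [K K0 hK] := germ_pv_le ct.
apply: (V_dom (K := K) cc' (Lclass_xpow us ha)).
have := germ_pvM ('X^a)%:P ct; rewrite -e => he.
apply: germS (germI he hK) => z [-> hk].
split; first by rewrite divr_ge0 ?exprn_ge0 ?den_ge0.
rewrite evalRC hornerXn cabsM cabsX cabsR mulrA ler_wpM2r ?invr_ge0 ?den_ge0 //.
by rewrite mulrC ler_wpM2r ?exprn_ge0.
Qed.

Lemma rem_unique (r : {poly C}) (Q H : F2) (c : fps C) : r`_0 = 0 ->
  Q = root_poly r * H + fps_const c -> H = root_quo r Q /\ c = root_rem r Q.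
Proof.
move=> r0 eQ; have eQ' := root_polyE Q r0.
have : fps_const (c - root_rem r Q) = root_poly r * (root_quo r Q - H).
  have e2 : root_poly r * H + fps_const c = root_poly r * root_quo r Q + fps_const (root_rem r Q).
    by rewrite -eQ.
  have ec : fps_const c = root_poly r * root_quo r Q + fps_const (root_rem r Q) - root_poly r * H.
    by rewrite -e2 addrAC subrr add0r.
  rewrite rmorphB /= ec; set x := root_poly r; set y := fps_const _; ring.
move=> /(root_poly_unique r0)[/eqP h1 /eqP h2].
by rewrite subr_eq0 in h1; rewrite subr_eq0 in h2; rewrite (eqP h1) (eqP h2).
Qed.

(** Membership in the ideal (x^a, f_k) of formal series: a form, evidently additive in Q, of the
    statement that the remainder modulo f_k has order at least a. *)
Definition ordmod k a (Q : F2) := exists G H : F2, Q = ps2 ('X^a)%:P * G + root_poly (rho k) * H.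

Lemma ordmodD k a (Q Q' : F2) : ordmod k a Q -> ordmod k a Q' -> ordmod k a (Q + Q').
Proof.
by move=> [G [H ->]] [G' [H' ->]]; exists (G + G'), (H + H'); rewrite !mulrDr addrACA.
Qed.

Lemma ordmod_rem k a (Q : F2) : ordmod k a Q ->
  forall n, (n < a)%N -> fcoef (root_rem (rho k) Q) n = 0.
Proof.
move=> [G [H e]] n na.
have e' : Q = root_poly (rho k) * (ps2 ('X^a)%:P * root_quo (rho k) G + H)
              + fps_const (fps_X _ ^+ a * root_rem (rho k) G).
  rewrite e {1}(root_polyE G (rho0 k)) ps2C [fps_poly _]rmorphXn [fps_const (_ * _)]rmorphM /=.
  set x := fps_const _; set y := fps_const _; set z := root_poly _; ring.
by have [_ <-] := rem_unique (rho0 k) e'; rewrite fcoefXnM na.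
Qed.

(** Modulo f_k the coordinate w = y + q_k equals -i x^(2 L_k); this is the substitution t = -i. *)
Lemma branch_pow_mod k j : exists H : F2,
  ps2 (('X - (- Cpoly (q k))%:P : {poly {poly C}}) ^+ j)
  = root_poly (rho k) * H + ps2 ((- ((Complex 0 1 : C) *: 'X^(2 * L k) : {poly C})) ^+ j)%:P.
Proof.
set W := 'X - _; set b := - (_ *: _).
have wE : ps2 W = root_poly (rho k) + ps2 b%:P.
  rewrite -ps2_fq -ps2D; congr (ps2 _); rewrite /W /fq /b polyCN opprK polyCD polyCN.
  by rewrite -addrA addrK.
elim: j => [|j [H IH]].
  exists 0; rewrite mulr0 add0r !expr0; congr (ps2 _); by rewrite polyC1.
exists (H * ps2 W + ps2 (b ^+ j)%:P).
rewrite exprSr ps2M IH exprSr polyCM ps2M wE; ring.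
Qed.

Lemma evalR_poly (F : nat -> {poly C}) a x y :
  evalR (\poly_(j < a) F j) x y = \sum_(j < a) (F j).[x%:C] * y%:C ^+ j.
Proof.
rewrite /evalR peval2E horner_poly horner_sum; apply: eq_bigr => j _.
by rewrite hornerM horner_exp hornerC.
Qed.

Lemma evalR_sum (I : Type) (r : seq I) (F : I -> {poly {poly C}}) x y :
  evalR (\sum_(i <- r) F i) x y = \sum_(i <- r) evalR (F i) x y.
Proof.
elim: r => [|i r IH]; last by rewrite !big_cons evalRD IH.
by rewrite !big_nil -polyC0 evalRC horner0.
Qed.

Lemma den_upper k s : exists2 K : R, 0 < K & germ (fun z =>
  `|z.2 + (q k).[z.1]| <= `|z.1| ^+ (2 * L k) ->
  den s z <= K * `|z.1| ^+ (\sum_(j <- s) O j k)).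
Proof.
have [c [K [_ K0 hg]]] := gdiff_const.
(* In this region |f_k| <= 2 |x|^(2 L_k) <= 2 |x|^(O_jk), and passing from f_k to conj f_j adds at
   most K_jk |x|^(O_jk). *)
exists (\prod_(j <- s) (2 + K j k)).
  by apply: prodr_gt0 => j _; have := K0 j k; lra.
apply: germS (germI (germ_pbox ltr01) hg) => z [[_ [z1 _]] hz] hw.
rewrite /den; elim: s => [|j s IH]; first by rewrite !big_nil expr0 mulr1.
rewrite !big_cons exprD mulrACA ler_pM ?cabs_ge0 //; first by apply: prodr_ge0 => i _; exact: cabs_ge0.
have := bmod_le_gdiff L q j k z.1 z.2; rewrite -surjective_pairing => h1.
have [_ /= h2] := hz (j, k); have h3 := bmod_le (q k) (2 * L k) z.
have h4 : `|z.1| ^+ (2 * L k) <= `|z.1| ^+ O j k.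
  by rewrite ler_wiXn2l ?(ltW z1) // Ojk_le.
lra.
Qed.

(** After the swap x is the outer variable, so the coefficient B_i is the polynomial in t that
    multiplies x^i in the main part of Q at w = t x^(2 L_k). If B_m were the first nonzero one,
    |B_m| >= v on some interval of t would give |Q| >= (v / 2) x^m on a strip, where the denominator
    is at most a constant times x^b. The quotient would then be at least a constant times x^(-(c_k +
    1)), which is not in L^p. *)
Lemma V_strip_coef k s (Q E1 E2 : F2) (d : nat -> {poly C}) a :
  let W : {poly {poly C}} := 'X - (- Cpoly (q k))%:P in
  let B := swapXY (\poly_(j < a) (d j * 'X^(2 * L k * j))) in
  V (k :: s) Q -> (a <= aord k (k :: s))%N -> cvs E1 -> cvs E2 ->
  Q = ps2 (\sum_(j < a) (d j)%:P * W ^+ j) + ps2 ('X^a)%:P * E1 + ps2 (W ^+ a) * E2 ->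
  forall m, (m < a)%N -> (forall i, (i < m)%N -> B`_i = 0) -> B`_m = 0.
Proof.
move=> W B [cQ LQ] aa c1 c2 eQ m ma hm; apply/eqP; apply/negPn/negP => hB.
have [t0 [t1 [v [t00 t01 t11 v0 hv]]]] := nonvanishing_interval hB.
have [K1 K10 h1] := germ_pv_le c1; have [K2 K20 h2] := germ_pv_le c2.
(* The part of B above order m, so that B = x^m (B_m(t) + x D'). *)
pose D' := drop_poly 1 (drop_poly m B).
have [K3 K30 h3] := evalR_le D'.
have BE (t x : R) : evalR B t x = x%:C ^+ m * (x%:C * evalR D' t x + (B`_m).[t%:C]).
  have Beq : B = 'X^m * ('X * D' + (B`_m)%:P).
    apply/polyP => i; rewrite coefXnM; case: ltnP => [/hm //|mi].
    rewrite coefD coefXM coefC /D'.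
    have [->|ne] := eqVneq i m; first by rewrite subnn add0r.
    have -> : (i - m)%N = (i - m.+1).+1 by move/eqP: ne mi; clear; lia.
    rewrite addr0 /= !coef_drop_poly; congr (B`_ _).
    by move/eqP: ne mi; clear; lia.
  by rewrite {1}Beq evalRM evalRXn evalRD evalRM evalRC !evalRX.
have [Kd Kd0 hd] := den_upper k (k :: s).
set b := \sum_(j <- k :: s) O j k in hd.
(* The strict inequality m < a <= b - c_k yields the extra 1, which is what turns the threshold
   exponent c_k into a divergent one. *)
have ab : (m + (cc k).+1 <= b)%N 
  by move: aa ma; rewrite /aord -/b; move: (b) (cc k) => u w; clear; lia.
have cA : cvs (ps2 (\sum_(j < a) (d j)%:P * W ^+ j)) by exact: cvs_ps2.
have cB : cvs (ps2 ('X^a)%:P * E1) by exact: cvs_ps2M.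
have cC : cvs (ps2 (W ^+ a) * E2) by exact: cvs_ps2M.
have e1 := germ_pvD (cvsD cA cB) cC; have e2 := germ_pvD cA cB.
have e3 := germ_pvM ('X^a)%:P c1; have e4 := germ_pvM (W ^+ a) c2.
have [e [e0 he]] := germI (germI (germI e1 e2) (germI e3 e4)) (germI (germI h1 h2) hd).
rewrite -eQ in he.
have [b0 [b00 hb]] := strip_pbox (q0 k) (n0 k) (ltW t00) t11 e0.
pose Ks := K3 + K1 + K2.
have Ks0 : 0 <= Ks by rewrite !addr_ge0.
have den0 : 0 < 2 * (Ks + 1) by rewrite mulr_gt0 // ltr_wpDl.
(* For x < [ee] the three error terms, from D', [E1] and [E2], amount together to at most x Ks x^m
   <= (v / 2) x^m. *)
pose ee := Num.min (Num.min 1 b0) (v / (2 * (Ks + 1))).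
have ee0 : 0 < ee by rewrite !lt_min ltr01 b00 divr_gt0.
apply: (@not_Lclass _ (q k) (2 * L k) t0 t1 (q0 k) (n0 k) (ltW t00) t01 t11
   pp (cc k).+1 (v / 2 / Kd) ee _ _ ee0 (cc_div k) _ LQ); first by rewrite !divr_gt0.
move=> z x0; rewrite !lt_min => /andP[/andP[x1 xb] xv] w0 w1.
have ze : pbox e z.
  by apply: (hb 0 z.1 (lexx 0) (ltW xb)); split.
have [[[e1' e2'] [e3' e4']] [[h1' h2'] hd']] := he z ze.
pose x := z.1; pose w := z.2 + (q k).[z.1].
rewrite -/x -/w in x0 x1 xb xv w0 w1 hd' h1' h2' e1' e2' e3' e4' *.
have nx : `|x| = x by rewrite gtr0_norm.
have xN0 : 0 < x ^+ (2 * L k) by rewrite exprn_gt0.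
have w00 : 0 <= w by apply: le_trans w0; rewrite mulr_ge0 ?ltW.
have wN : w <= x ^+ (2 * L k) by apply: le_trans w1 _; rewrite -[leRHS]mul1r ler_wpM2r // ltW.
have wx : w <= x.
  apply: le_trans wN _; rewrite -[leRHS]expr1 ler_wiXn2l ?(ltW x0) ?(ltW x1) //.
have {hd'} hden : den (k :: s) z <= Kd * x ^+ b.
  by have := hd'; rewrite ger0_norm // nx; apply.
pose t := w / x ^+ (2 * L k).
have tl : t0 <= t by rewrite ler_pdivlMr.
have tu : t <= t1 by rewrite ler_pdivrMr.
have tE : w = t * x ^+ (2 * L k) by rewrite /t divfK // gt_eqF.
have eW : evalR W x z.2 = w%:C.
  rewrite /W evalRD evalRX -polyCN evalRC hornerN hornerN opprK horner_Cpoly -rmorphD //.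
have eA : evalR (\sum_(j < a) (d j)%:P * W ^+ j) x z.2 = evalR B t x.
  have -> : evalR B t x = evalR (\poly_(j < a) (d j * 'X^(2 * L k * j))) x t.
    by rewrite /evalR !peval2E; exact: horner2_swapXY.
  rewrite evalR_poly evalR_sum; apply: eq_bigr => j _.
  rewrite evalRM evalRC evalRXn eW tE hornerM hornerXn rmorphM rmorphXn exprMn -exprM.
  by rewrite -mulrA; congr (_ * _); rewrite mulrC.
have xa : x ^+ a <= x ^+ m.+1 by rewrite ler_wiXn2l ?(ltW x0) ?(ltW x1).
have wa : w ^+ a <= x ^+ a by rewrite lerXn2r ?nnegrE ?(ltW x0).
have xm0 : 0 < x ^+ m by rewrite exprn_gt0.
have low : v / 2 * x ^+ m <= cabs (pv Q x z.2).
  rewrite e1' e2' pv_ps2 e3' e4' eA BE evalRC hornerXn evalRXn eW.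
  have t1' : `|t| <= 1 by rewrite ger0_norm; [exact: le_trans tu t11|exact: le_trans (ltW t00) tl].
  have h3' := h3 t x t1'; rewrite nx in h3'; have {}h3' := h3' (ltW x1).
  have hv' := hv t tl tu.
  set T1 := cabs (pv E1 x z.2) in h1'; set T2 := cabs (pv E2 x z.2) in h2'.
  have b1 : cabs (x%:C ^+ a * pv E1 x z.2) <= x ^+ m.+1 * K1.
    by rewrite cabsM cabsX cabsR nx ler_pM ?cabs_ge0 ?exprn_ge0 ?(ltW x0).
  have b2 : cabs (w%:C ^+ a * pv E2 x z.2) <= x ^+ m.+1 * K2.
    rewrite cabsM cabsX cabsR ger0_norm // ler_pM ?cabs_ge0 ?exprn_ge0 //.
    exact: le_trans wa xa.
  have b3 : cabs (x%:C * evalR D' t x) <= x * K3.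
    by rewrite cabsM cabsR nx ler_wpM2l // ltW.
  have b4 : v - x * K3 <= cabs (x%:C * evalR D' t x + (B`_m).[t%:C]).
    by rewrite [X in cabs X]addrC; apply: le_trans (cabs_lerB _ _); exact: lerB.
  have b5 : x ^+ m * (v - x * K3) <= cabs (x%:C ^+ m * (x%:C * evalR D' t x + (B`_m).[t%:C])).
    by rewrite cabsM cabsX cabsR nx ler_wpM2l // ltW.
  apply: le_trans (cabs_lerB _ _).
  apply: le_trans (lerB (cabs_lerB _ _) b2).
  apply: le_trans (lerB (lerB b5 b1) (lexx _)).
  have xv' : x * (2 * (Ks + 1)) < v by rewrite -ltr_pdivlMr.
  have -> : x ^+ m * (v - x * K3) - x ^+ m.+1 * K1 - x ^+ m.+1 * K2 = (v - x * Ks) * x ^+ m.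
    by rewrite exprS /Ks; ring.
  rewrite ler_wpM2r ?(ltW xm0) //.
  have : 0 <= x * Ks by rewrite mulr_ge0 // ltW.
  exact: half_margin.
have dgt := den_gt0 (k :: s) ze.
rewrite ler_pdivlMr //; apply: le_trans low.
apply: (@le_trans _ _ (v / 2 / Kd / x ^+ (cc k).+1 * (Kd * x ^+ b))).
  rewrite ler_wpM2l // !divr_ge0 ?exprn_ge0 ?(ltW x0) ?(ltW v0) ?(ltW Kd0) //.
have -> : v / 2 / Kd / x ^+ (cc k).+1 * (Kd * x ^+ b) = v / 2 * (x ^+ b / x ^+ (cc k).+1).
  by field; rewrite !gt_eqF ?exprn_gt0.
rewrite ler_wpM2l ?divr_ge0 ?(ltW v0) // ler_pdivrMr ?exprn_gt0 // -exprD.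
by rewrite ler_wiXn2l ?(ltW x0) ?(ltW x1).
Qed.

(** The coefficients B_0, ..., B_(a-1) vanish one after the other, and they vanish as polynomials in
    t although only real t in (0, 1] were tested. So x^a divides each d_j x^(2 L_k j), which is
    unaffected by putting t = -i; the two error terms are divisible by x^a modulo f_k as well. *)
Lemma V_rem_order k s (Q : F2) : V (k :: s) Q ->
  forall n, (n < aord k (k :: s))%N -> fcoef (root_rem (rho k) Q) n = 0.
Proof.
move=> VQ; have [cQ _] := VQ; set a := aord k (k :: s).
have p0 : (- Cpoly (q k))`_0 = 0.
  by rewrite coefN coef_Cpoly -horner_coef0 q0 oppr0.
have [d [E1 [E2 [c1 c2 eQ]]]] := taylor a p0 cQ.
have step := V_strip_coef VQ (leqnn _) c1 c2 eQ.
set B := swapXY _ in step.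
have B0 m : (m <= a)%N -> forall i, (i < m)%N -> B`_i = 0.
  elim: m => [//|m IH] ma i; rewrite ltnS leq_eqVlt => /predU1P[->|im].
    by apply: step => // i' /IH; apply; exact: ltnW.
  by apply: IH => //; exact: ltnW.
have dX j : (j < a)%N -> exists u : {poly C}, d j * 'X^(2 * L k * j) = 'X^a * u.
  move=> ja; have h i : (i < a)%N -> (d j * 'X^(2 * L k * j))`_i = 0.
    move=> ia; have := congr1 (fun p : {poly C} => p`_j) (B0 a (leqnn a) i ia).
    by rewrite /B coef_swapXY coef_poly ja coef0.
  by have [u eu _] := poly_XnM h; exists u.
apply: ordmod_rem; rewrite eQ; apply: ordmodD; first apply: ordmodD.
- rewrite (rmorph_sum (@ps2 R)) /=; elim/big_rec: _ => [|j G _ hG].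
    by exists 0, 0; rewrite !mulr0 addr0.
  apply: ordmodD => //; rewrite ps2M; have [H ->] := branch_pow_mod k j.
  have [u eu] := dX j (ltn_ord j).
  pose cst := (- (Complex 0 1 : C)) ^+ j.
  exists (ps2 (cst%:P * u)%:P), (ps2 (d j)%:P * H).
  have e : d j * (- ((Complex 0 1) *: 'X^(2 * L k))) ^+ j = 'X^a * (cst%:P * u).
    rewrite -scaleNr -mul_polyC exprMn -exprM -rmorphXn -/cst mulrCA eu; exact: mulrCA.
  rewrite mulrDr -ps2M -polyCM e polyCM ps2M addrC mulrCA; congr (_ + _).
- by exists E1, 0; rewrite mulr0 addr0.
have [H ->] := branch_pow_mod k a.
pose cst := (- (Complex 0 1 : C)) ^+ a.
(* The power x^(2 L_k a) contains x^a because 2 L_k >= 1. *)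
have e : (- ((Complex 0 1 : C) *: 'X^(2 * L k))) ^+ a = 'X^a * (cst%:P * 'X^((2 * L k).-1 * a)).
  rewrite -scaleNr -mul_polyC exprMn -exprM -rmorphXn -/cst mulrCA -exprD; congr (_ * 'X^_).
  by rewrite -mulSn prednK.
exists (ps2 (cst%:P * 'X^((2 * L k).-1 * a))%:P * E2), (H * E2).
by rewrite e polyCM ps2M mulrDl addrC !mulrA.
Qed.

End Quotients.

(** * A triangular basis of the quotient *)

Section LinearCombinations.
Variable R : realType.
Local Notation C := R[i].
Local Notation F2 := (fps (fps C)).

Definition lcg (g : seq F2) (c : nat -> C) : F2 :=
  \sum_(i < size g) fps_const (fps_const (c i)) * nth 0 g i.

Lemma lcg_cat g1 g2 c : lcg (g1 ++ g2) c = lcg g1 c + lcg g2 (fun i => c (size g1 + i)%N).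
Proof.
rewrite /lcg size_cat big_split_ord /=; congr (_ + _); apply: eq_bigr => i _.
  by rewrite nth_cat ltn_ord.
by rewrite nth_cat ltnNge leq_addr /= addKn.
Qed.

Lemma lcg_mul (h : F2) g c : lcg [seq h * x | x <- g] c = h * lcg g c.
Proof.
rewrite /lcg size_map mulr_sumr; apply: eq_bigr => i _.
by rewrite (nth_map 0) // mulrCA.
Qed.

Definition xpowers a n : seq F2 := [seq fps_const (fps_X C ^+ (a + i)) | i <- iota 0 n].

Lemma lcg_xpowers a n c :
  lcg (xpowers a n) c = fps_const (fps_X C ^+ a * fps_poly (\poly_(i < n) c i)).
Proof.
rewrite /lcg /xpowers size_map size_iota poly_def (raddf_sum (@fps_poly C)) mulr_sumr.
rewrite (raddf_sum (@fps_const (fps C))); apply: eq_bigr => i _.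
rewrite (nth_map 0%N) ?size_iota // nth_iota // add0n -rmorphM /=; congr fps_const.
rewrite -mul_polyC rmorphM /= fps_polyC rmorphXn exprD; exact: mulrCA.
Qed.

Lemma fps_unit_cancel (u : {poly C}) (r : fps C) : u`_0 != 0 -> fps_poly u * r = 0 -> r = 0.
Proof.
move=> u0 e; apply: fpsP => n; elim/ltn_ind: n => n IH.
have := congr1 (fun a => fcoef a n) e; rewrite fcoefM big_ord_recl subn0 big1 ?addr0.
  by move=> /eqP; rewrite mulf_eq0 (negbTE u0) => /eqP.
by move=> i _; rewrite IH ?mulr0 //= /bump /= add1n; have := ltn_ord i; lia.
Qed.

Lemma fps_X_cancel (r : fps C) n : fps_X C ^+ n * r = 0 -> r = 0.
Proof.
move=> e; apply: fpsP => i; have := congr1 (fun a => fcoef a (n + i)%N) e.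
by rewrite fcoefXnM ltnNge leq_addr /= addKn.
Qed.

End LinearCombinations.

(** * Generators: spanning and independence *)

Section Span.
Variables (R : realType) (M : nat) (L : 'I_M -> nat) (q : 'I_M -> {poly R}).
Variables (pp : option R) (cc : 'I_M -> nat) (T : seq 'I_M).
Local Notation C := R[i].
Local Notation F2 := (fps (fps C)).
Local Notation O := (Ojk L q).
Local Notation fq := (fq L q).
Local Notation rho := (rho L q).
Local Notation V := (V L q pp).
Local Notation aord := (aord L q cc).
Hypothesis pp1 : if pp is Some p then 1 <= p else true.
Hypothesis q0 : forall j, (q j).[0] = 0.
Hypothesis L0 : forall j, (0 < L j)%N.
Hypothesis cc_le : forall j, (cc j <= 2 * L j)%N.
Hypothesis cc_int : forall j, integrable_order pp (2 * L j) (2 * L j - cc j).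
Hypothesis cc_div : forall j, divergent_order (2 * L j) pp (cc j).+1.
Hypothesis uT : uniq T.

Let rho0' k : (rho k)`_0 = 0. Proof. exact: (rho0 pp1 q0 L0 k). Qed.

Definition Bbar : {poly {poly C}} := \prod_(j <- T) fqc L q j.
Definition Bpoly s : {poly {poly C}} := \prod_(j <- s) fq j.
(** The order of conj [P] at the root of f_k when [T] lists all branches; the sum includes O_kk = 2
    L_k. *)
Definition bord k := (\sum_(j <- T) O j k)%N.

Fixpoint greedy s : Prop :=
  if s is k :: s' then (forall l, l \in s -> (aord l s <= aord k s)%N) /\ greedy s' else True.

(** The powers for branch k stop at x^(b_k - 1), since from x^(b_k) on multiples of conj [P] can be
    subtracted. *)
Fixpoint gens s : seq F2 :=
  if s is k :: s' then
    xpowers R (aord k s) (bord k - aord k s) ++ [seq ps2 (fq k) * g | g <- gens s']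
  else [::].

Lemma aord_le_bord s0 k s : T = s0 ++ k :: s -> (aord k (k :: s) <= bord k)%N.
Proof.
move=> eT; rewrite /aord /bord eT big_cat /= leq_subLR.
by apply: leq_trans (leq_addl _ _); rewrite leq_addl.
Qed.

(** At real points |conj f_j| = |f_j|, so the factors over [s] cancel the denominator, and the
    remaining ones are at most 1 near the origin. *)
Lemma V_Bbar s0 s D : T = s0 ++ s -> cvs D -> V s (ps2 Bbar * D).
Proof.
move=> eT cD; have [K K0 hK] := germ_pv_le cD.
apply: (V_bounded (K := K) pp1 (cvs_ps2M _ cD)).
have hb : germ (fun z => forall j, bmod (q j) (2 * L j) z <= 1 /\ `|z.1| <= 1).
  by apply: germ_all => j; apply: germ_bmod_le1 => //; have := L0 j; lia.
apply: germS (germI (germ_pvM Bbar cD) (germI hK hb)) => z [-> [hk hz]].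
rewrite cabsM mulrC; apply: ler_pM; rewrite ?cabs_ge0 //.
rewrite /Bbar evalR_prod cabs_prod /den eT big_cat /=.
have e r : \prod_(j <- r) cabs (evalR (fqc L q j) z.1 z.2) = \prod_(j <- r) bmod (q j) (2 * L j) z.
  by apply: eq_bigr => j _; rewrite cabs_fqc -surjective_pairing.
rewrite !e -[leRHS]mul1r ler_wpM2r //; first by apply: prodr_ge0 => j _; exact: cabs_ge0.
elim: (s0) => [|j t IH]; first by rewrite big_nil.
rewrite big_cons -[leRHS]mul1r; apply: ler_pM => //; first exact: cabs_ge0.
  by apply: prodr_ge0 => i _; exact: cabs_ge0.
by have [] := hz j.
Qed.

Lemma gens_V s0 s : T = s0 ++ s -> greedy s -> forall g, g \in gens s -> V s g.
Proof.
elim: s s0 => [//|k s IH] s0 eT [gr grs] g.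
have us : uniq (k :: s) by move: uT; rewrite eT cat_uniq => /and3P[].
rewrite [gens _]/= mem_cat => /orP[/mapP[i _ ->]|/mapP[h hg ->]].
  have cX : cvs (fps_const (fps_X C ^+ (aord k (k :: s) + i))).
    have -> : fps_X C ^+ (aord k (k :: s) + i) = fps_poly 'X^(aord k (k :: s) + i).
      by rewrite rmorphXn.
    by rewrite -ps2C; exact: cvs_ps2.
  apply: (V_const pp1 q0 L0 cc_le cc_int us gr _ cX) => n na.
  by rewrite exprD fcoefXnM na.
have Vh : V s h by apply: (IH (rcons s0 k)) => //; rewrite cat_rcons.
by apply/(V_cons L q pp1); have [] := Vh.
Qed.

(** Let c_1 be the remainder of Q modulo f_k, which starts at x^a. Its terms from x^a to x^(b-1) are
    combinations of generators. The tail from x^b on is the remainder of conj [P] times a convergent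
    series r(x), because conj [P] reduces to x^b times a unit. After subtraction of both, what is
    left is f_k times a member of the space for the shorter segment. *)
Lemma gens_span s0 s Q : T = s0 ++ s -> greedy s -> V s Q ->
  exists (c : nat -> C) (A D : F2), [/\ cvs A, cvs D &
    Q = lcg (gens s) c + ps2 (Bpoly s) * A + ps2 Bbar * D].
Proof.
elim: s s0 Q => [|k s IH] s0 Q eT.
  move=> _ [cQ _]; exists (fun=> 0), Q, 0; split=> //; first exact: cvs0.
  have -> : ps2 (Bpoly [::]) = 1 by rewrite /Bpoly big_nil; exact: ps2_1.
  by rewrite /lcg big_ord0 mul1r mulr0 add0r addr0.
move=> [gr grs] VQ; have [cQ _] := VQ; have r0 := rho0' k.
have us : uniq (k :: s) by move: uT; rewrite eT cat_uniq => /and3P[].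
set a := aord k (k :: s) in gr.
have ab : (a <= bord k)%N by exact: aord_le_bord eT.
pose c1 := root_rem (rho k) Q; have cc1 : cvs (fps_const c1) by exact: cvs_rem.
have c1a n : (n < a)%N -> fcoef c1 n = 0 by exact: (V_rem_order pp1 q0 L0 cc_div VQ).
pose d := (bord k - a)%N.
have adE : (a + d)%N = bord k by rewrite subnKC.
pose pl : {poly C} := \poly_(i < d) fcoef c1 (a + i)%N.
pose tl := Fps (fun n => fcoef c1 (bord k + n)%N).
have c1E : c1 = fps_X C ^+ a * fps_poly pl + fps_X C ^+ bord k * tl.
  have plE i : fcoef (fps_poly pl) i = if (i < d)%N then fcoef c1 (a + i)%N else 0.
    have -> : fcoef (fps_poly pl) i = pl`_i by [].
    by rewrite coef_poly.
  have tlE i : fcoef tl i = fcoef c1 (bord k + i)%N by [].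
  apply: fpsP => n; rewrite fcoefD !fcoefXnM plE tlE.
  case: (ltnP n a) => na; first by rewrite (leq_trans na ab) addr0 c1a.
  case: (ltnP n (bord k)) => nb; first by rewrite addr0 ltn_subLR // adE nb subnKC.
  by rewrite ltn_subLR // adE ltnNge nb add0r subnKC.
have [u bE u0] := prod_gdiff_order L q k T.
have [r cr tlE] := cvs_div_unit u0 (cvs_const_tail (bord k) cc1).
have [H hH] := prod_fqc_mod L q k T.
have XbE : fps_X C ^+ bord k * tl = fps_poly (\prod_(j <- T) gdiff L q j k) * r.
  by rewrite /tl tlE bE rmorphM rmorphXn mulrA.
pose px := fps_const (fps_X C ^+ a * fps_poly pl).
pose Q1 := Q - px - ps2 Bbar * fps_const r.
have cpx : cvs px.
  have -> : px = ps2 ('X^a * pl)%:P by rewrite ps2C rmorphM rmorphXn.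
  exact: cvs_ps2.
have Q1E : Q1 = root_poly (rho k) * (root_quo (rho k) Q - H * fps_const r) + fps_const 0.
  rewrite /Q1 {1}(root_polyE Q r0) -/c1 c1E XbE /Bbar hH rmorphD /= -/px.
  rewrite [fps_const (fps_poly _ * r)]rmorphM /= rmorph0.
  set x1 := root_poly _; set x2 := fps_const (fps_poly _); set x3 := fps_const r; ring.
have cQ1 : cvs Q1 by apply: cvsB; [exact: cvsB|exact: cvs_ps2M].
have [qE _] := rem_unique r0 Q1E.
pose Q2 := root_quo (rho k) Q1.
have cQ2 : cvs Q2 by exact: cvs_quo.
have Q1f : Q1 = ps2 (fq k) * Q2 by rewrite ps2_fq /Q2 -qE Q1E rmorph0 addr0.
have VQ2 : V s Q2.
  apply/(V_cons L q pp1 k s cQ2); rewrite -Q1f.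
  apply: (VB pp1); last exact: V_Bbar eT cr.
  apply: (VB pp1) => //; apply: (V_const pp1 q0 L0 cc_le cc_int us gr _ cpx) => n na.
  by rewrite fcoefXnM na.
have eT' : T = rcons s0 k ++ s by rewrite cat_rcons.
have [c [A [D [cA cD Q2E]]]] := IH _ Q2 eT' grs VQ2.
exists (fun i => if (i < d)%N then fcoef c1 (a + i)%N else c (i - d)%N), A, (fps_const r + ps2 (fq k) * D).
split=> //; first by apply: cvsD => //; exact: cvs_ps2M.
rewrite [gens _]/= lcg_cat lcg_xpowers lcg_mul -/a -/d.
have -> : \poly_(i < d) (if (i < d)%N then fcoef c1 (a + i)%N else c (i - d)%N) = pl.
  by apply/polyP => i; rewrite /pl !coef_poly; case: ifP => // ->.
rewrite -/px.
have -> : lcg (gens s) (fun i => (fun i0 => if (i0 < d)%N then fcoef c1 (a + i0)%N else c (i0 - d)%N)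
     (size (xpowers R a d) + i)%N) = lcg (gens s) c.
  apply: eq_bigr => i _; rewrite /xpowers size_map size_iota ltnNge leq_addr /=.
  by rewrite addKn.
have -> : ps2 (Bpoly (k :: s)) = ps2 (fq k) * ps2 (Bpoly s) by rewrite /Bpoly big_cons ps2M.
have -> : Q = px + ps2 Bbar * fps_const r + Q1.
  by rewrite /Q1; set x1 := ps2 _ * _; ring.
rewrite Q1f Q2E.
set x1 := ps2 (fq k); set x2 := ps2 Bbar; set x3 := ps2 (Bpoly s); set x4 := lcg _ _; ring.
Qed.

(** Reducing the relation modulo f_k leaves x^a pl = be rD, with pl of degree below b - a and be of
    order b, so both sides are zero. Then f_k divides every term and can be cancelled, which gives a
    relation of the same form for the shorter segment. *)
Lemma gens_indep s0 s (c : nat -> C) (A D : F2) : T = s0 ++ s ->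
  lcg (gens s) c = ps2 (Bpoly s) * A + ps2 Bbar * D ->
  forall i, (i < size (gens s))%N -> c i = 0.
Proof.
elim: s s0 c A D => [//|k s IH] s0 c A D eT; have r0 := rho0' k.
set a := aord k (k :: s).
have ab : (a <= bord k)%N by exact: aord_le_bord eT.
pose d := (bord k - a)%N.
rewrite [gens _]/= lcg_cat lcg_xpowers lcg_mul -/a -/d.
have -> : ps2 (Bpoly (k :: s)) = ps2 (fq k) * ps2 (Bpoly s) by rewrite /Bpoly big_cons ps2M.
have sz : size (xpowers R a d) = d by rewrite /xpowers size_map size_iota.
rewrite sz; set pl := \poly_(i < d) c i; set c' := fun i => c (d + i)%N.
have [u bE u0] := prod_gdiff_order L q k T.
have [H hH] := prod_fqc_mod L q k T; rewrite -/Bbar in hH.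
set be := \prod_(j <- T) gdiff L q j k in bE hH.
rewrite ps2_fq => e.
pose rD := root_rem (rho k) D.
have DE := root_polyE D r0; rewrite -/rD in DE.
have : fps_const (fps_X C ^+ a * fps_poly pl - fps_poly be * rD)
   = root_poly (rho k) * (ps2 (Bpoly s) * A + H * D
       + fps_const (fps_poly be) * root_quo (rho k) D - lcg (gens s) c').
  rewrite rmorphB /= [fps_const (fps_poly be * _)]rmorphM /=.
  have -> : fps_const (fps_X C ^+ a * fps_poly pl) =
     root_poly (rho k) * ps2 (Bpoly s) * A + ps2 Bbar * D - root_poly (rho k) * lcg (gens s) c'.
    by rewrite -e addrK.
  rewrite hH.
  have -> : fps_const rD = D - root_poly (rho k) * root_quo (rho k) D by rewrite {1}DE addrAC subrr add0r.
  set x1 := root_poly _; set x2 := fps_const _; set x3 := root_quo _ _; set x4 := lcg _ _; ring.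
move=> /(root_poly_unique r0)[_ /eqP]; rewrite subr_eq0 => /eqP ple.
have be_X : fps_poly be = fps_X C ^+ bord k * fps_poly u by rewrite bE rmorphM rmorphXn.
have pl0 : pl = 0.
  apply/polyP => i; rewrite coef0; case: (ltnP i d) => id; last by rewrite coef_poly ltnNge id.
  have := congr1 (fun f => fcoef f (a + i)%N) ple.
  rewrite be_X -mulrA !fcoefXnM ltnNge leq_addr /= addKn => ->.
  by rewrite ifT // -ltn_subRL.
have rD0 : rD = 0.
  apply: (fps_unit_cancel u0); apply: (@fps_X_cancel _ _ (bord k)).
  by rewrite mulrA -be_X -ple pl0 rmorph0 mulr0.
have e2 : lcg (gens s) c' = ps2 (Bpoly s) * A + ps2 Bbar * root_quo (rho k) D.
  apply: (root_poly_lreg r0).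
  move: e; rewrite pl0 rmorph0 mulr0 rmorph0 add0r => ->.
  rewrite {1}DE rD0 rmorph0 addr0.
  set x1 := root_poly _; set x2 := ps2 Bbar; ring.
have eT' : T = rcons s0 k ++ s by rewrite cat_rcons.
have IHc := IH _ c' A _ eT' e2.
move=> i; rewrite size_cat size_map sz => isz.
case: (ltnP i d) => id.
  by have := congr1 (fun p : {poly C} => p`_i) pl0; rewrite coef_poly id coef0.
by have := IHc (i - d)%N; rewrite /c' subnKC //; apply; rewrite ltn_subLR.
Qed.

End Span.

(** * Counting the generators *)

Section Counting.
Variables (R : realType) (M : nat) (L : 'I_M -> nat) (q : 'I_M -> {poly R}) (cc : 'I_M -> nat).
Local Notation O := (Ojk L q).
Local Notation aord := (aord L q cc).
Hypothesis cc_le : forall j, (cc j <= 2 * L j)%N.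

Lemma aord_perm l s s' : perm_eq s s' -> aord l s = aord l s'.
Proof. by move=> ss; rewrite /aord (perm_big _ ss). Qed.

Lemma greedy_perm s : exists2 T, perm_eq T s & greedy L q cc T.
Proof.
have [n] := ubnP (size s); elim: n s => [//|n IH] s; rewrite ltnS => sn.
case: (eqVneq s [::]) => [->|s0]; first by exists [::].
have [k ks kmax] : exists2 k, k \in s & forall l, l \in s -> (aord l s <= aord k s)%N.
  have [i0 i0s] : exists i, i \in s by case: (s) s0 => // i t _; exists i; rewrite inE eqxx.
  have [k ks km] := @arg_maxnP _ i0 (mem s) (fun l => aord l s) i0s.
  by exists k.
have sz : (size (rem k s) < n)%N.
  by rewrite size_rem //; case: (s) s0 sn.
have [T pT gT] := IH _ sz; exists (k :: T).
  by rewrite perm_sym (perm_trans (perm_to_rem ks)) // perm_cons perm_sym.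
have pk : perm_eq (k :: T) s.
  by rewrite perm_sym (perm_trans (perm_to_rem ks)) // perm_cons perm_sym.
split=> // l; rewrite (perm_mem pk) => ls; rewrite !(aord_perm _ pk); exact: kmax.
Qed.

(** [asum] adds up the a_k over the final segments. [tri] is the same sum without the c_k: every
    pair of positions is counted once, and so is the diagonal, whatever the order of the
    branches. *)
Fixpoint asum s : nat := if s is k :: s' then (aord k s + asum s')%N else 0%N.
Fixpoint tri s : nat := if s is k :: s' then (\sum_(j <- s) O j k + tri s')%N else 0%N.

Lemma size_gens T s0 s : T = s0 ++ s ->
  (size (gens L q cc T s) + asum s = \sum_(k <- s) bord L q T k)%N.
Proof.
elim: s s0 => [|k s IH] s0 eT; first by rewrite big_nil.
rewrite [gens _ _ _ _ _]/= size_cat !size_map size_iota big_cons -(IH (rcons s0 k)); last first.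
  by rewrite cat_rcons.
rewrite [asum _]/= addnACA subnK //; exact: aord_le_bord eT.
Qed.

Lemma asum_tri s : (asum s + \sum_(k <- s) cc k = tri s)%N.
Proof.
elim: s => [|k s IH]; first by rewrite big_nil.
rewrite [asum _]/= [tri _]/= big_cons addnACA IH subnK //.
by rewrite big_cons Ojj (leq_trans (cc_le k)) // leq_addr.
Qed.

Lemma tri_double s :
  (2 * tri s = \sum_(k <- s) \sum_(j <- s) O j k + \sum_(k <- s) O k k)%N.
Proof.
elim: s => [|k s IH]; first by rewrite !big_nil.
rewrite [tri _]/= mulnDr IH !big_cons.
have -> : (\sum_(j <- s) \sum_(j0 <- k :: s) O j0 j
  = \sum_(j <- s) O j k + \sum_(j <- s) \sum_(j0 <- s) O j0 j)%N.
  rewrite -big_split /=; apply: eq_bigr => j _; rewrite big_cons; congr (_ + _)%N; exact: OjkC.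
lia.
Qed.

Definition upper_sum := (\sum_(j < M) \sum_(k < M | (j < k)%N) O j k)%N.

Lemma full_sum : (\sum_(k < M) \sum_(j < M) O j k = 2 * upper_sum + \sum_(k < M) O k k)%N.
Proof.
have e k : (\sum_(j < M) O j k = \sum_(j < M | (j < k)%N) O j k
     + (O k k + \sum_(j < M | (k < j)%N) O j k))%N.
  rewrite (bigID (fun j : 'I_M => (j < k)%N)) /=; congr (_ + _)%N.
  rewrite (bigD1 k) /=; last by rewrite ltnn.
  congr (_ + _)%N; apply: eq_bigl => j.
  by rewrite -leqNgt ltn_neqAle andbC eq_sym.
under eq_bigr do rewrite e; rewrite !big_split /=.
have -> : (\sum_(k < M) \sum_(j < M | (j < k)%N) O j k = upper_sum)%N.
  by rewrite /upper_sum (exchange_big_dep xpredT).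
have -> : (\sum_(k < M) \sum_(j < M | (k < j)%N) O j k = upper_sum)%N.
  by apply: eq_bigr => k _; apply: eq_bigr => j _; exact: OjkC.
lia.
Qed.

(** Let U be the sum of O_jk over pairs j < k, and D the sum of the O_kk. The b_k add up to 2 U + D
    and the a_k to U + D minus the sum of the c_k. *)
Lemma size_gens_perm T : perm_eq T (enum 'I_M) ->
  size (gens L q cc T T) = (upper_sum + \sum_(k < M) cc k)%N.
Proof.
move=> pT; have h1 := @size_gens T [::] T erefl; have h2 := asum_tri T; have h3 := tri_double T.
have toO (F : 'I_M -> nat) : (\sum_(k <- T) F k = \sum_(k < M) F k)%N.
  by rewrite (perm_big _ pT) big_enum.
have e1 : (\sum_(k < M) \sum_(j <- T) O j k = \sum_(k < M) \sum_(j < M) O j k)%N.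
  by apply: eq_bigr => k _; exact: toO.
rewrite toO [RHS]e1 in h1; rewrite toO in h2; rewrite !toO e1 in h3.
rewrite full_sum in h1 h3.
move: h1 h2 h3; move: (size _) (asum T) (tri T) upper_sum => a b c d.
move: (\sum_(k < M) O k k)%N (\sum_(k < M) cc k)%N => e f; clear; lia.
Qed.

End Counting.

(** * From generators to the dimension of the quotient *)

Section QuotientDimension.
Variable R : realType.
Local Notation C := R[i].
Local Notation F2 := (fps (fps C)).

Lemma unserD (G H : F2) : unser (G + H) = fun i j => unser G i j + unser H i j.
Proof. by []. Qed.

Lemma unser_sum (I : Type) (r : seq I) (F : I -> F2) i j :
  unser (\sum_(k <- r) F k) i j = \sum_(k <- r) unser (F k) i j.
Proof. by rewrite /unser !fcoef_sum. Qed.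

Lemma lincombE n (c : 'I_n -> C) (v : 'I_n -> pser R) :
  lincomb c v = unser (\sum_(k < n) fps_const (fps_const (c k)) * ser (v k)).
Proof.
apply/funext => i; apply/funext => j; rewrite unser_sum /lincomb; apply: eq_bigr => k _.
by rewrite /unser !fcoef_constM.
Qed.

Lemma ideal2P (B B' : {poly {poly C}}) (Q : pser R) : ideal2 (coef2 B) (coef2 B') Q <->
  exists A D : F2, [/\ cvs A, cvs D & ser Q = ps2 B * A + ps2 B' * D].
Proof.
have sB (P : {poly {poly C}}) : ser (coef2 P) = ps2 P by rewrite -unser_ps2 unserK.
split=> [[A [D [cA cD ->]]]|[A [D [cA cD e]]]].
  exists (ser A), (ser D); split=> //.
  rewrite !pmulE -unserD unserK !sB; congr (_ + _); exact: mulrC.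
exists (unser A), (unser D); split=> //.
rewrite !pmulE !unserK !sB -unserD [A * _]mulrC [D * _]mulrC -e; by [].
Qed.

Lemma quot_dim_gens (VV : F2 -> Prop) (B B' : {poly {poly C}}) (g : seq F2) (W : set (pser R)) :
  (forall Q, W Q <-> VV (ser Q)) ->
  (forall A D, cvs A -> cvs D -> VV (ps2 B * A + ps2 B' * D)) ->
  (forall x, x \in g -> VV x) ->
  (forall Q, VV Q -> exists (c : nat -> C) (A D : F2), [/\ cvs A, cvs D &
      Q = lcg g c + ps2 B * A + ps2 B' * D]) ->
  (forall c A D, lcg g c = ps2 B * A + ps2 B' * D -> forall i, (i < size g)%N -> c i = 0) ->
  quot_dim W (ideal2 (coef2 B) (coef2 B')) (size g).
Proof.
move=> WV subV gV span indep; split.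
- by move=> Q /ideal2P[A [D [cA cD e]]]; apply/WV; rewrite e; exact: subV.
- exists (fun k => unser (nth 0 g k)); split.
    by move=> k; apply/WV; rewrite unserK; apply: gV; exact: mem_nth.
  move=> c; rewrite lincombE => /ideal2P[A [D [_ _]]]; rewrite unserK => e k.
  pose c' i := if insub i is Some k then c k else 0.
  have ck (i : 'I_(size g)) : c' i = c i by rewrite /c' valK.
  rewrite -ck; apply: (indep c' A D) => //; rewrite -e /lcg; apply: eq_bigr => i _.
  by rewrite unserK ck.
- move=> v hv; set N := size g.
  have h k : exists cAD : (nat -> C) * F2 * F2, [/\ cvs cAD.1.2, cvs cAD.2 &
      ser (v k) = lcg g cAD.1.1 + ps2 B * cAD.1.2 + ps2 B' * cAD.2].
    by have /WV/span[c [A [D [cA cD e]]]] := hv k; exists (c, A, D).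
  have [f hf] := choice h.
  (* The N + 1 rows of coordinates have length N, so some nonzero combination of them vanishes; the
     same combination of the series lies in the ideal. *)
  pose Mx : 'M[C]_(N.+1, N) := \matrix_(k, i) (f k).1.1 i.
  have : kermx Mx != 0.
    by rewrite kermx_eq0 /row_free neq_ltn ltnS rank_leq_col.
  case/rowV0Pn => u /sub_kermxP uM u0.
  exists (fun k => u 0 k); split.
    apply: contrapT => hn; case/negP: u0; apply/eqP/rowP => k; rewrite mxE.
    by apply/eqP/negPn/negP => uk; apply: hn; exists k.
  rewrite lincombE; apply/ideal2P; rewrite unserK.
  pose sc k : F2 := fps_const (fps_const (u 0 k)).
  have csc k (G : F2) : cvs G -> cvs (sc k * G).
    by move=> cG; rewrite /sc -[fps_const (u 0 k)]fps_polyC -ps2C; exact: cvs_ps2M.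
  exists (\sum_(k < N.+1) sc k * (f k).1.2), (\sum_(k < N.+1) sc k * (f k).2); split.
  + by apply: cvs_sum => k _; apply: csc; have [] := hf k.
  + by apply: cvs_sum => k _; apply: csc; have [] := hf k.
  have -> : \sum_(k < N.+1) fps_const (fps_const (u 0 k)) * ser (v k) =
    \sum_(k < N.+1) sc k * lcg g (f k).1.1 +
    (ps2 B * (\sum_(k < N.+1) sc k * (f k).1.2) + ps2 B' * (\sum_(k < N.+1) sc k * (f k).2)).
    rewrite !mulr_sumr -!big_split /=; apply: eq_bigr => k _.
    have [_ _ ->] := hf k; rewrite -/(sc k); ring.
  rewrite -[RHS]add0r; congr (_ + _); rewrite /lcg.
  under eq_bigr do rewrite mulr_sumr.
  rewrite exchange_big /=; apply: big1 => i _.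
  have -> : \sum_(k < N.+1) sc k * (fps_const (fps_const ((f k).1.1 i)) * nth 0 g i) =
     fps_const (fps_const (\sum_(k < N.+1) u 0 k * (f k).1.1 i)) * nth 0 g i.
    rewrite !rmorph_sum mulr_suml; apply: eq_bigr => k _.
    by rewrite mulrA /sc -!rmorphM.
  have -> : \sum_(k < N.+1) u 0 k * (f k).1.1 i = (u *m Mx) 0 i.
    by rewrite mxE; apply: eq_bigr => k _; rewrite mxE.
  by rewrite uM mxE !rmorph0 mul0r.
Qed.

End QuotientDimension.

(** * From neighbourhoods of the origin to punctured boxes *)

Section FullBox.
Variable R : realType.
Local Notation C := R[i].
Local Notation F2 := (fps (fps C)).
Local Notation mu := (@lebesgue_measure R).

Definition Lloc (pp : option R) (f : R * R -> C) : Prop :=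
  match pp with Some p => Lp_loc p f | None => Linf_loc f end.

Definition fbox (e : R) : set (R * R) := [set z | `|z.1| < e /\ `|z.2| < e].

Lemma measurable_fbox e : measurable (fbox e).
Proof.
have m1 := @measurable_norm1 R; have m2 := @measurable_norm2 R.
have -> : fbox e = [set z | `|z.1| < e] `&` [set z | `|z.2| < e] by [].
by apply: measurableI; apply: measurable_set_ltr.
Qed.

Lemma fbox_ball e : fbox e = ball ((0 : R), (0 : R)) e.
Proof.
apply/seteqP; split=> z; rewrite /fbox /ball /= /prod_ball /ball /= !sub0r !normrN //.
Qed.

Lemma nbhs_fbox e : 0 < e -> nbhs ((0 : R), (0 : R)) (fbox e).
Proof. by move=> e0; rewrite fbox_ball; apply/nbhs_ballP; exists e. Qed.

Lemma nbhs_pbox (U : set (R * R)) : nbhs ((0 : R), (0 : R)) U ->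
  exists e : R, 0 < e /\ pbox e `<=` U.
Proof.
move=> /nbhs_ballP[e e0 h]; exists e; split=> // z [_ [h1 h2]]; apply: h.
by rewrite -fbox_ball.
Qed.

Definition axis : set (R * R) := [set 0] `*` setT.

Lemma measurable_axis : measurable axis.
Proof. by apply: measurableX. Qed.

Lemma axis_null : @leb2 R axis = 0%E.
Proof.
rewrite /leb2 product_measure1E //.
by rewrite [X in (X * _)%E](_ : _ = 0%E) ?mul0e //; exact: lebesgue_measure_set1.
Qed.

Lemma fboxD e : fbox e `\` axis = pbox e.
Proof.
apply/seteqP; split=> z.
  move=> [[h1 h2] h3]; split=> //; rewrite normr_gt0; apply/eqP => z0; apply: h3.
  by split.
move=> [h0 [h1 h2]]; split=> // -[/= z0 _]; move: h0; by rewrite z0 normr0 ltxx.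
Qed.

Lemma Lloc_Lclass pp (f : R * R -> C) : Lloc pp f -> Lclass pp (fun z => cabs (f z)).
Proof.
case: pp => [p|] [U [nU [mU mR mI H]]]; have [e [e0 eU]] := nbhs_pbox nU; exists e.
  have mf : measurable_fun U (fun z => cabs (f z)) by apply: cmeas_abs.
  split=> //; first exact: measurable_funS mU eU mf.
  apply: le_lt_trans H; rewrite /leb2; apply: ge0_subset_integral => //.
  - exact: measurable_pbox.
  - by apply/measurable_EFinP; exact: (measurableT_comp (measurable_powR _)).
  - by move=> z _; rewrite lee_fin powR_ge0.
have mf : measurable_fun U (fun z => cabs (f z)) by apply: cmeas_abs.
split=> //; first exact: measurable_funS mU eU mf.
by case: H => K H; exists K; apply: filterS H => z hz /eU.
Qed.

(** The full and the punctured box differ by a subset of the null line x = 0. Only measurability on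
    the full box has to be supplied separately. *)
Lemma Lclass_Lloc pp (f : R * R -> C) (e : R) : 0 < e -> cmeas (fbox e) f ->
  Lclass pp (fun z => cabs (f z)) -> Lloc pp f.
Proof.
move=> e0 mf Lf; have [e' [e0' le mh H]] := Lclass_shrink Lf e0.
have sub : fbox e' `<=` fbox e.
  by move=> z [h1 h2]; split; exact: lt_le_trans le.
have mf' : cmeas (fbox e') f.
  by case: mf => m1 m2; split; apply: measurable_funS (measurable_fbox e) sub _.
have mE := measurable_fbox e'; case: (mf') => m1 m2.
case: pp Lf H => [p|] _ H; exists (fbox e'); split; do ?exact: nbhs_fbox; split=> //.
  move: H; rewrite -fboxD; apply: le_lt_trans; rewrite le_eqVlt; apply/orP; left; apply/eqP.
  apply: (@ge0_negligible_integral _ _ _ (mu \x mu)%E _ _ _ measurable_axis mE).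
  - apply/measurable_EFinP; apply: (measurableT_comp (measurable_powR _)).
    exact: cmeas_abs.
  - by move=> z _; rewrite lee_fin powR_ge0.
  - exact: axis_null.
case: H => K H; exists K.
have ax : {ae @leb2 R, forall z, ~ axis z}.
  exists axis; split; [exact: measurable_axis|exact: axis_null|].
  by move=> z /= /contrapT.
apply: filterS2 H ax => z hz nz uz; apply: hz; rewrite -fboxD; by split.
Qed.

Lemma cmeas_quotient (G : F2) (P : {poly {poly C}}) : cvs G ->
  exists e : R, 0 < e /\ cmeas (fbox e) (fun z => pv G z.1 z.2 / evalR P z.1 z.2).
Proof.
move=> /cvsP[r [r0 [K h]]]; exists r; split=> //.
have le z : fbox r z -> `|z.1| <= r /\ `|z.2| <= r by move=> [h1 h2]; split; exact: ltW.
by apply: cmeas_div; [exact: cmeas_pv h le|exact: cmeas_evalR le].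
Qed.

Lemma bounded_ratio_germ (P B : {poly {poly C}}) : bounded_ratio P B ->
  exists K : R, germ (fun z => [/\ evalR P z.1 z.2 != 0, evalR B z.1 z.2 != 0,
    cabs (evalR P z.1 z.2) <= K * cabs (evalR B z.1 z.2) &
    cabs (evalR B z.1 z.2) <= K * cabs (evalR P z.1 z.2)]).
Proof.
(* A box of half-side e / 2 lies inside the disc of radius e. *)
move=> [e [e0 [K h]]]; exists K, (e / 2); split; first by rewrite divr_gt0.
move=> z [z0 [z1 z2]].
have ne : (z.1, z.2) != (0, 0) by rewrite xpair_eqE negb_and -normr_gt0 z0.
have sq (x : R) : `|x| < e / 2 -> x ^+ 2 < e ^+ 2 / 2.
  move=> hx; rewrite -real_normK ?num_real //; have := normr_ge0 x; nra.
have lt : z.1 ^+ 2 + z.2 ^+ 2 < e ^+ 2 by have := sq _ z1; have := sq _ z2; lra.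
have [P0 B0 h1 h2] := h _ _ ne lt; split=> //.
  by move: h1; rewrite cabsM cabsV ler_pdivrMr ?cabs_gt0.
by move: h2; rewrite cabsM cabsV ler_pdivrMr ?cabs_gt0.
Qed.

Lemma ratio_le (a b c K : R) : 0 <= a -> 0 < b -> 0 < c -> c <= K * b -> a / b <= K * (a / c).
Proof.
move=> a0 b0 c0 cb; rewrite ler_pdivrMr // mulrA mulrAC ler_pdivlMr //.
by rewrite mulrAC [leRHS]mulrC ler_wpM2l.
Qed.

Lemma Lloc_V M (L : 'I_M -> nat) (q : 'I_M -> {poly R}) pp (P : {poly {poly C}}) T (G : F2) :
  is_true (if pp is Some p then 1 <= p else true) -> perm_eq T (enum 'I_M) ->
  bounded_ratio P (bracketP L q) -> cvs G ->
  Lloc pp (fun z => pv G z.1 z.2 / evalR P z.1 z.2) <-> V L q pp T G.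
Proof.
move=> pp1 pT /bounded_ratio_germ[K hK] cG.
have pp0 : is_true (if pp is Some p then 0 <= p else true) by case: pp pp1 => // p; exact: le_trans.
have dE z : den L q T z = cabs (evalR (bracketP L q) z.1 z.2).
  by rewrite -evalR_fqs bracketPE (perm_big _ pT) big_enum.
have [e [e0 mq]] := cmeas_quotient P cG.
have gq : gmeas (fun z => cabs (pv G z.1 z.2 / evalR P z.1 z.2)).
  exists e; split=> //; apply: measurable_funS (measurable_fbox e) _ (cmeas_abs mq).
  by move=> z [_].
split=> [/Lloc_Lclass Lf|[_ Lf]].
  split=> //; apply: (Lclass_le (K := K) pp0 (gmeas_quo L q T cG) Lf).
  apply: germS hK => z [P0 B0 h1 h2]; split; first exact: quo_ge0.
  split; first exact: cabs_ge0.
  by rewrite dE cabsM cabsV; apply: ratio_le; rewrite ?cabs_ge0 ?cabs_gt0.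
apply: (Lclass_Lloc e0 mq).
apply: (Lclass_le (K := K) pp0 gq Lf).
apply: germS hK => z [P0 B0 h1 h2]; split; first exact: cabs_ge0.
split; first exact: quo_ge0.
by rewrite dE cabsM cabsV; apply: ratio_le; rewrite ?cabs_ge0 ?cabs_gt0.
Qed.

Lemma quot_dim_class M (L : 'I_M -> nat) (q : 'I_M -> {poly R}) pp (cc : 'I_M -> nat)
    (P : {poly {poly C}}) (W : set (pser R)) :
  is_true (if pp is Some p then 1 <= p else true) ->
  (forall j, (q j).[0] = 0) -> (forall j, (0 < L j)%N) ->
  (forall j, (cc j <= 2 * L j)%N) ->
  (forall j, integrable_order pp (2 * L j) (2 * L j - cc j)) ->
  (forall j, divergent_order (2 * L j) pp (cc j).+1) ->
  bounded_ratio P (bracketP L q) ->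
  (forall Q, W Q <-> cps Q /\ Lloc pp (fun z => pval Q z.1 z.2 / evalR P z.1 z.2)) ->
  quot_dim W (ideal2 (coef2 (bracketP L q)) (coef2 (pconj (bracketP L q))))
    (upper_sum L q + \sum_(k < M) cc k)%N.
Proof.
move=> pp1 q0 L0 cc_le cc_int cc_div bP WE.
have [T pT gT] := greedy_perm L q cc (enum 'I_M).
have uT : uniq T by rewrite (perm_uniq pT) enum_uniq.
have BE : bracketP L q = Bpoly L q T by rewrite bracketPE /Bpoly (perm_big _ pT) big_enum.
have B'E : pconj (bracketP L q) = Bbar L q T.
  by rewrite pconj_bracketP /Bbar (perm_big _ pT) big_enum.
rewrite -(size_gens_perm q cc_le pT) B'E BE.
apply: (@quot_dim_gens _ (V L q pp T)).
- move=> Q; rewrite WE.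
  have -> : (fun z : R * R => pval Q z.1 z.2 / evalR P z.1 z.2) =
            (fun z => pv (ser Q) z.1 z.2 / evalR P z.1 z.2).
    by apply/funext => z; rewrite pv.unlock.
  split=> [[cQ LQ]|VQ]; first exact/(Lloc_V (G := ser Q) pp1 pT bP cQ).
  by have [cQ _] := VQ; split=> //; apply/(Lloc_V pp1 pT bP cQ).
- move=> A D cA cD; rewrite addrC -[ps2 _ * A]opprK -mulrN.
  apply: (VB pp1); first exact: (V_Bbar (s0 := [::]) pp1 q0 L0 uT erefl cD).
  have cN := cvsN cA; have [K K0 hK] := germ_pv_le cN.
  apply: (V_bounded (K := K) pp1 (cvs_ps2M _ cN)).
  apply: germS (germI (germ_pvM (Bpoly L q T) cN) hK) => z [-> hk].
  by rewrite cabsM evalR_fqs mulrC ler_wpM2r // den_ge0.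
- exact: (gens_V (s0 := [::]) pp1 q0 L0 cc_le cc_int uT erefl gT).
- by move=> Q; exact: (gens_span (s0 := [::]) pp1 q0 L0 cc_le cc_int cc_div uT erefl gT).
- move=> c A D; exact: (gens_indep (s0 := [::]) pp1 q0 L0 erefl).
Qed.

End FullBox.

(** * The thresholds for finite p, and the dimension formulas *)

(** The ceiling c is determined by (c - 1) p < n + 1 <= c p. The left inequality is the
    integrability condition, the right one the divergence condition, and p >= 1 in the left one
    gives c - 1 <= n. *)
Lemma ceil_orders (R : realType) (p : R) n (c : int) : 1 <= p ->
  c = Num.ceil ((n + 1)%:R / p) -> let cc := `|c - 1|%N in
  [/\ c - 1 = cc%:Z, (cc <= n)%N, integrable_order (Some p) n (n - cc) &
      divergent_order n (Some p) cc.+1].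
Proof.
move=> p1 cE cc; have p0 : 0 < p by exact: lt_le_trans ltr01 p1.
have c0 : 0 < c by rewrite cE ceil_gt0 divr_gt0 // ltr0n addn1.
have ccE : c - 1 = cc%:Z by rewrite /cc gez0_abs //; lia.
have cR : (c - 1)%:~R = cc%:R :> R by rewrite ccE.
have lt : cc%:R * p < (n + 1)%:R.
  by rewrite -ltr_pdivlMr // -cR cE ceilB1_lt.
have ge : (n + 1)%:R <= cc.+1%:R * p.
  rewrite -ler_pdivrMr //; apply: le_trans (ceil_ge _) _.
  by rewrite -cE -natr1 -cR intrB subrK.
have ccn : (cc <= n)%N.
  rewrite -ltnS -[n.+1]addn1 -(ltr_nat R); apply: le_lt_trans lt.
  by rewrite -[leLHS]mulr1 ler_wpM2l.
split=> //.
  by rewrite /integrable_order natrB // mulrBl; move: lt; rewrite natrD; lra.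
by rewrite /divergent_order; split; [exact: ltW|move: ge; rewrite natrD].
Qed.

Theorem theorem1p7 (R : realType) (P : {poly {poly R[i]}}) (M : nat)
  (L : 'I_M -> nat) (q : 'I_M -> {poly R}) :
  no_zeros_H2 P ->
  coef2 P 0 0 = 0 ->
  no_common_factor P (pconj P) ->
  vanish_order P M ->
  (forall j, [/\ (q j).[0] = 0, 0 < (q j)^`().[0] & (size (q j) <= 2 * L j)%N]) ->
  bounded_ratio P (bracketP L q) ->
  (forall p : R, 1 <= p ->
     exists N : nat,
       quot_dim (Ip p P)
         (ideal2 (coef2 (bracketP L q)) (coef2 (pconj (bracketP L q)))) N /\
       N%:Z = \sum_(j < M) \sum_(k < M | (j < k)%N) (Ojk L q j k)%:Z
              + \sum_(k < M) (Num.ceil ((2 * L k + 1)%:R / p) - 1)) /\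
  (exists N : nat,
     quot_dim (Iinf P)
       (ideal2 (coef2 (bracketP L q)) (coef2 (pconj (bracketP L q)))) N /\
     N = (\sum_(j < M) \sum_(k < M | (j < k)%N) Ojk L q j k)%N).
Proof.
move=> _ _ _ _ hq bP.
have q0 j : (q j).[0] = 0 by have [] := hq j.
have L0 j : (0 < L j)%N.
  (* For L_j = 0 the degree bound would make q_j zero, contrary to q_j'(0) > 0. *)
  have [_ h1 h2] := hq j; rewrite lt0n; apply/eqP => Lj; move: h1 h2.
  rewrite Lj muln0 leqn0 size_poly_eq0 => h /eqP q00; move: h.
  by rewrite q00 deriv0 horner0 ltxx.
split=> [p p1|].
  pose cc k := `|Num.ceil ((2 * L k + 1)%:R / p) - 1|%N.
  have h k := @ceil_orders R p (2 * L k) _ p1 erefl.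
  exists (upper_sum L q + \sum_(k < M) cc k)%N; split.
    apply: (@quot_dim_class R M L q (Some p) cc P) => //.
    - by move=> k; have [] := h k.
    - by move=> k; have [] := h k.
    - by move=> k; have [] := h k.
  rewrite PoszD /upper_sum (big_morph Posz PoszD erefl); congr (_ + _).
    by apply: eq_bigr => j _; rewrite (big_morph Posz PoszD erefl).
  by rewrite (big_morph Posz PoszD erefl); apply: eq_bigr => k _; have [] := h k.
exists (upper_sum L q); split=> //.
(* For the exponent oo all thresholds are 0: x^(2 L_k) / f_k is bounded and 1 / x is not. *)
have := @quot_dim_class R M L q None (fun=> 0%N) P (Iinf P).
rewrite big1 // addn0; apply=> //.
by move=> j; rewrite subn0 /integrable_order.
Qed.
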